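(* Let $m,n$ be positive integers with $\gcd(m,n)=1$, let $\gamma=\frac mn$, let $\mathbb{H}_\gamma=\{(z_1,z_2)\in\mathbb{C}^2: |z_1|^\gamma<|z_2|<1\}$, and let $\boldsymbol{B}$ denote the Bergman projection on $\mathbb{H}_\gamma$. (1) For every integer $k\ge 1$, $\boldsymbol{B}$ fails to map $L^2_k(\mathbb{H}_\gamma)\to L^2_k(\mathbb{H}_\gamma)$. (2) Let $j,l$ be non-negative integers. Then $\frac{\partial^{j+l}}{\partial z_1^j\,\partial z_2^l}\circ \boldsymbol{B}$ fails to map $C^\infty(\overline{\mathbb{H}_\gamma})\to L^p(\mathbb{H}_\gamma)$ for every $p\in(1,\infty)$ with $$p\ \ge\ \frac{2m+2n}{m(l+1)+n(j+1)-1}.$$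
   Context: For an open set $\Omega\subset\mathbb{C}^n$, $1<p<\infty$ and an integer $k\ge 0$, $L^p_k(\Omega)$ is the $L^p$ Sobolev space of order $k$: the measurable functions $f$ with $\|f\|_{L^p_k(\Omega)}=\big(\sum_{|\alpha|\le k}\int_\Omega|\partial^\alpha f|^p\,dV\big)^{1/p}<\infty$, where $\partial^\alpha$ runs over all partial derivatives (in the real coordinates, equivalently in $z_i,\bar z_i$) taken in the distributional sense and $dV$ is Lebesgue measure. $L^p_0=L^p$. The Bergman projection $\boldsymbol{B}=\boldsymbol{B}_\Omega$ is the orthogonal projection of $L^2(\Omega)$ onto the closed subspace of holomorphic functions in $L^2(\Omega)$; it is given by $\boldsymbol{B}f(z)=\int_\Omega B_\Omega(z,w)f(w)\,dV(w)$, where $B_\Omega$ is the Bergman kernel of $\Omega$. $C^\infty(\overline{\Omega})$ denotes functions smooth up to the boundary of $\Omega$. ''An operator $T$ fails to map $X\to Y$'' means that there is $f\in X$ with $Tf\notin Y$. *)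

(* Defs.v *)
From HB Require Import structures.
From mathcomp Require Import all_boot all_order all_algebra.
From mathcomp Require Import complex.
From mathcomp Require Import all_classical all_reals all_analysis.
Set Implicit Arguments.
Unset Strict Implicit.
Unset Printing Implicit Defensive.
Import Order.TTheory GRing.Theory Num.Theory numFieldNormedType.Exports.
Local Open Scope classical_set_scope.
Local Open Scope complex_scope.
Local Open Scope ring_scope.

(* [C2 R] is C^2 as a normed module over C = R[i] (used for complex
   differentiability); [R4 R] is R^4, with real coordinates
   ((Re z1, Im z1), (Re z2, Im z2)) (used for measure and real derivatives). *)
Definition C2 (R : realType) : normedModType R[i] := (R[i]^o * R[i]^o)%type.
Notation R4 R := ((R * R) * (R * R))%type.

Definition toC2 (R : realType) (x : R4 R) : C2 R :=
  (x.1.1 +i* x.1.2, x.2.1 +i* x.2.2).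

(* The modulus as an element of R ([`|z|] lives in R[i]). *)
Definition cmod (R : realType) (z : R[i]) : R := complex.Re `|z|.

Definition fails_to_map (S T : Type) (A : S -> T) (X : set S) (Y : set T) :=
  exists f, X f /\ ~ Y (A f).

Definition Hgamma (R : realType) (gamma : R) : set (C2 R) :=
  [set z | cmod z.1 `^ gamma < cmod z.2 /\ cmod z.2 < 1].

(* Lebesgue measure on R^2.  The library's sigma-finiteness instance for
   products is hidden by the one for subprobabilities, hence this constant. *)
Definition dA (R : realType) :
    set (measurableTypeR R * measurableTypeR R) -> \bar R :=
  (@lebesgue_measure R \x @lebesgue_measure R)%E.
HB.instance Definition _ (R : realType) := Measure.on (@dA R).

Lemma dA_sigma_finite (R : realType) : sigma_finite setT (@dA R).
Proof.
have /sigma_finiteP[F [TF ndF Foo]] := sigma_finiteT (@lebesgue_measure R).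
exists (fun n => F n `*` F n).
  rewrite -setXTT TF predeqE => -[x y]; split.
    move=> [/= [n _ Fnx] [k _ Gky]]; exists (maxn n k) => //; split.
    - by move: x Fnx; exact/subsetPset/ndF/leq_maxl.
    - by move: y Gky; exact/subsetPset/ndF/leq_maxr.
  by move=> [n _ []/= ? ?]; split; exists n.
move=> k; have [? ?] := Foo k.
split; first exact: measurableX.
by rewrite /dA product_measure1E// lte_mul_pinfty// ge0_fin_numE.
Qed.
HB.instance Definition _ (R : realType) :=
  Measure_isSigmaFinite.Build _ _ _ (@dA R) (@dA_sigma_finite R).

(* [R4 R] with the Borel sigma-algebra carried by [lebesgue_measure]. *)
Notation mR4 R := ((measurableTypeR R * measurableTypeR R) *
                   (measurableTypeR R * measurableTypeR R))%type.

Definition dV (R : realType) : {measure set (mR4 R) -> \bar R} :=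
  (@dA R \x @dA R)%E.

Section Integration.
Variable R : realType.
Implicit Types (Omega : set (C2 R)) (f g : C2 R -> R[i]).

Definition real_domain Omega : set (mR4 R) := [set x | Omega (toC2 x)].

Definition cintegral Omega f : R[i] :=
  (\int[@dV R]_(x in real_domain Omega) complex.Re (f (toC2 x)))
  +i* (\int[@dV R]_(x in real_domain Omega) complex.Im (f (toC2 x))).

Definition Lp (p : R) Omega : set (C2 R -> R[i]) :=
  [set f : C2 R -> R[i] |
    [/\ measurable_fun (real_domain Omega)
          (fun x : mR4 R => complex.Re (f (toC2 x))),
        measurable_fun (real_domain Omega)
          (fun x : mR4 R => complex.Im (f (toC2 x))) &
        (\int[@dV R]_(x in real_domain Omega) (cmod (f (toC2 x)) `^ p)%:E < +oo)%E]].

End Integration.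

Section RealDerivatives.
Variable R : realType.

Definition e4 (i : 'I_4) : R4 R :=
  tnth [tuple ((1, 0), (0, 0)); ((0, 1), (0, 0));
              ((0, 0), (1, 0)); ((0, 0), (0, 1))] i.

(* [partials s phi] takes the partial derivatives listed in [s], in any order
   and with repetitions. *)
Definition partials (s : seq 'I_4) (phi : R4 R -> R) : R4 R -> R :=
  foldr (fun i psi x => 'D_(e4 i) psi x) phi s.

Definition smooth (phi : R4 R -> R) :=
  forall s : seq 'I_4, continuous (partials s phi) /\
    forall i x, derivable (partials s phi) x (e4 i).

Definition multi_index := {ffun 'I_4 -> nat}.

Definition mi_order (alpha : multi_index) : nat := (\sum_i alpha i)%N.

Definition mi_partial (alpha : multi_index) : (R4 R -> R) -> R4 R -> R :=
  partials (flatten [seq nseq (alpha i) i | i <- enum 'I_4]).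

Definition test_function (Omega : set (C2 R)) (phi : R4 R -> R) :=
  [/\ smooth phi,
      compact (closure [set x | phi x != 0]) &
      closure [set x | phi x != 0] `<=` @toC2 R @^-1` Omega].

End RealDerivatives.

Section FunctionSpaces.
Variable R : realType.
Implicit Types (Omega : set (C2 R)) (f g : C2 R -> R[i]).

(* [v] is the distributional derivative of [u] of index [alpha] on [Omega], for
   [u] and [v] locally integrable there (as is the case in [sobolev]).  *)
Definition real_weak_derivative Omega (alpha : multi_index)
    (u v : R4 R -> R) :=
  forall phi : R4 R -> R, test_function Omega phi ->
    \int[@dV R]_(x in real_domain Omega) (u x * mi_partial alpha phi x) =
    (- 1) ^+ mi_order alpha *
      \int[@dV R]_(x in real_domain Omega) (v x * phi x).

(* Real test functions suffice for complex-valued functions, by linearity. *)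
Definition weak_derivative Omega (alpha : multi_index) f g :=
  real_weak_derivative Omega alpha
    (fun x => complex.Re (f (toC2 x))) (fun x => complex.Re (g (toC2 x))) /\
  real_weak_derivative Omega alpha
    (fun x => complex.Im (f (toC2 x))) (fun x => complex.Im (g (toC2 x))).

Definition sobolev (p : R) (k : nat) Omega : set (C2 R -> R[i]) :=
  [set f : C2 R -> R[i] | Lp p Omega f /\
    forall alpha : multi_index, (mi_order alpha <= k)%N ->
      exists2 g, Lp p Omega g & weak_derivative Omega alpha f g].

(* C^oo(closure Omega): restrictions to [closure Omega] of smooth functions on
   the whole of C^2. *)
Definition smooth_closure Omega : set (C2 R -> R[i]) :=
  [set f : C2 R -> R[i] | exists F : C2 R -> R[i],
    [/\ smooth (fun x => complex.Re (F (toC2 x))),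
        smooth (fun x => complex.Im (F (toC2 x))) &
        forall z, closure Omega z -> f z = F z]].

Definition holomorphic Omega f :=
  forall z, Omega z -> differentiable (f : C2 R -> R[i]^o) z.

Definition dz1 f : C2 R -> R[i] :=
  fun z => 'D_((1, 0) : C2 R) (f : C2 R -> R[i]^o) z.
Definition dz2 f : C2 R -> R[i] :=
  fun z => 'D_((0, 1) : C2 R) (f : C2 R -> R[i]^o) z.

Definition bergman_space Omega : set (C2 R -> R[i]) :=
  [set g : C2 R -> R[i] | holomorphic Omega g /\ Lp 2 Omega g].

Definition L2_dot Omega f g : R[i] := cintegral Omega (fun z => f z * (g z)^*).

(* The orthogonal projection of [f] in L^2(Omega) onto the Bergman space: the
   function [g] there such that [f - g] is orthogonal to the whole space.  It is
   unique as a function on [Omega]; its values off [Omega] are irrelevant. *)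
Definition bergman_projection Omega f : C2 R -> R[i] :=
  xget (fun=> 0) [set g : C2 R -> R[i] | bergman_space Omega g /\
    forall h, bergman_space Omega h -> L2_dot Omega (fun z => f z - g z) h = 0].

End FunctionSpaces.

(* Main.v *)
Require Import Defs.
From HB Require Import structures.
From mathcomp Require Import all_boot all_order all_algebra.
From mathcomp Require Import complex ring lra.
From mathcomp Require Import all_classical all_reals all_analysis measurable_realfun.
Import Order.TTheory GRing.Theory Num.Theory numFieldNormedType.Exports.
Local Open Scope classical_set_scope.
Local Open Scope ring_scope.
Set Implicit Arguments.
Unset Strict Implicit.
Unset Printing Implicit Defensive.

(** Let [e = z1^p z2^-N] with natural numbers [p], [N] such that
[n (p + 1) + m = m N + 1]; since [m] and [n] are coprime they exist, with [p]
as large as one likes ([bezout_exponents]). On the part of the domain where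
[|z2|] is about [2^(-m i)], [|z1|] is at most about [2^(-n i)], so that [|e|]
is at most a constant times [2^(i (m N - n p))], on a set of volume at most a
constant times [2^(-2 i (m + n))]. As [m N - n p = m + n - 1], the integral of [|e|^2]
over this part is [O(4^-i)]: the monomial [e] is in the Bergman space, with
just enough room ([mono_L2]).

The counterexample is the polynomial [f = z1^p conj(z2)^N]. Its projection is
[C e] with [C > 0] ([bergman_projection_conj_mono]), because [f] and [e] are
multiplied by the same factor under the rotations of the two coordinates. In
detail, an element [h] of the Bergman space is [G e] with [G] holomorphic off
[z1 = 0]; hence [(f - C e) conj(h) = k conj(G)] with [k = (f - C e) conj(e)]
real and invariant under rotations. Rotations preserve the volume
([preserves_rot]), so [G] may be replaced by its mean over the torus through
the point. That mean is the same at all points: moving one coordinate at a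
time, this is Cauchy's theorem on an annulus ([circle_mean_spiral]), here
obtained from Goursat's bisection ([goursat]) for the pull-back of the form to
a rectangle. So the inner product of [f - C e] and [h] is a constant times
[int k], and [C] is chosen to make [int k] vanish ([integral_torus0]).

Both statements then follow from one scaling computation. The maps
[(z1, z2) |-> (t^n z1, t^m z2)] with [t = 2^-i] send the domain into itself;
they multiply [|z1^a z2^-b|] by [2^(i D)] with [D = m b - n a], and volumes by
[2^(-2 i (m + n))]. The images of a small box are disjoint, so the integral of
[|z1^a z2^-b|^q] is infinite as soon as [D q >= 2 m + 2 n] ([mono_not_Lp]).
For the derivative of [C e] of order [(j, l)] with [j <= p], which is a nonzero
multiple of [z1^(p-j) z2^-(N+l)], one finds [D = m (l + 1) + n (j + 1) - 1]:
this is the range of exponents in the second statement.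

For the first statement, [f] is smooth up to the boundary of a bounded domain,
so that integration by parts against a test function gives all its weak
derivatives ([smc2_sobolev]). Suppose that [C e] had a weak derivative [g] in
[L^2] in the direction of [Re z2]. Testing with bumps in the dilated boxes
identifies the integrals of [Re g] against them with those of the classical
derivative, of size [2^(i (2 m + n - 1))]; since [2 m + n - 1 >= m + n], the
integral of [(Re g)^2] over each of the boxes is bounded below
([young_lower_bound], [box_scaling]), which is absurd ([proj_not_sobolev]). *)

(** * Goursat's theorem on a rectangle *)

Section IntervalIntegral.
Variable R : realType.
Implicit Types (f g : R -> R) (a b c : R).

Definition itg (a b : R) (f : R -> R) : R :=
  \int[@lebesgue_measure R]_(x in `[a, b]) f x.

Definition cont_on (a b : R) (f : R -> R) :=
  forall x, a <= x <= b -> {for x, continuous f}.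

Lemma cont_on_itv a b f : cont_on a b f -> {within `[a, b], continuous f}.
Proof.
move=> cf; apply: continuous_in_subspaceT => x.
by rewrite inE/= in_itv/= => /cf.
Qed.

Lemma cont_on_integrable a b f : cont_on a b f ->
  (@lebesgue_measure R).-integrable `[a, b] (EFin \o f).
Proof.
move=> cf; apply: continuous_compact_integrable; first exact: segment_compact.
exact: cont_on_itv.
Qed.

Lemma cont_onB a b f g : cont_on a b f -> cont_on a b g ->
  cont_on a b (fun x => f x - g x).
Proof. by move=> cf cg x xab; apply: cvgB; [exact: cf|exact: cg]. Qed.

Lemma itg_split a b c f : a <= b -> b <= c -> cont_on a c f ->
  itg a c f = itg a b f + itg b c f.
Proof.
move=> ab bc cf; have fi := cont_on_integrable cf.
apply/eqP; rewrite addrC -subr_eq; apply/eqP.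
rewrite /itg Rintegral_itvB ?bnd_simp//.
rewrite -Rintegral_itv_obnd_cbnd; last first.
  apply: (integrableS _ _ _ fi) => //.
  by apply: subset_itvr; rewrite bnd_simp.
by [].
Qed.

Lemma itgB a b f g : cont_on a b f -> cont_on a b g ->
  itg a b (fun x => f x - g x) = itg a b f - itg a b g.
Proof.
by move=> cf cg; rewrite /itg RintegralB//; exact: cont_on_integrable.
Qed.

Lemma itg_cst a b k : a <= b -> itg a b (fun=> k) = k * (b - a).
Proof.
move=> ab; rewrite /itg Rintegral_cst//; congr (_ * _).
rewrite [X in fine X](lebesgue_measure_itv `[a, b])/= lte_fin.
case: ifPn => //; rewrite -leNgt => ba.
by rewrite (le_anti (introT andP (conj ab ba))) subrr.
Qed.

(** A continuous function within [e] of a constant; the error estimate for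
one side of a small rectangle. *)
Lemma itg_near_cst a b k e f : a <= b -> cont_on a b f ->
  (forall x, a <= x <= b -> `|f x - k| <= e) ->
  `|itg a b f - k * (b - a)| <= e * (b - a).
Proof.
move=> ab cf fe; rewrite -(itg_cst k ab).
have ck r : cont_on a b (fun=> r) by move=> x _; exact: cvg_cst.
rewrite -itgB//; apply: le_trans.
  by apply: le_normr_Rintegral => //; exact/cont_on_integrable/cont_onB.
rewrite -itg_cst//; apply: le_Rintegral => //.
- by apply: integrable_norm; exact/cont_on_integrable/cont_onB.
- by apply: (cont_on_integrable (ck e)).
Qed.

End IntervalIntegral.

Section Goursat.
Variable R : realType.
Variables P Q : R -> R -> R.

(** [P ds + Q dt] is differentiable at [(s, t)] and its exterior derivative
vanishes there: [k] is both the [t]-derivative of [P] and the [s]-derivative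
of [Q]. *)
Definition closed_form_at (s t : R) := exists p k q : R,
  forall e, 0 < e -> exists2 d, 0 < d & forall s' t',
    `|s' - s| <= d -> `|t' - t| <= d ->
    `|P s' t' - (P s t + p * (s' - s) + k * (t' - t))|
       <= e * (`|s' - s| + `|t' - t|) /\
    `|Q s' t' - (Q s t + k * (s' - s) + q * (t' - t))|
       <= e * (`|s' - s| + `|t' - t|).

(** The circulation of [P ds + Q dt] along the boundary of
[[a, b] x [c, d]]. Opposite sides are paired, which makes the first-order
cancellation on a small rectangle visible in each of the two integrands. *)
Definition circ (a b c d : R) :=
  itg a b (fun s => P s c - P s d) + itg c d (fun t => Q b t - Q a t).

Variables (a0 b0 c0 d0 : R).
Hypothesis closedPQ : forall s t, a0 <= s <= b0 -> c0 <= t <= d0 ->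
  closed_form_at s t.

Lemma closed_form_cont s t : a0 <= s <= b0 -> c0 <= t <= d0 ->
  [/\ {for s, continuous (P^~ t)}, {for t, continuous (P s)},
      {for s, continuous (Q^~ t)} & {for t, continuous (Q s)}].
Proof.
move=> sab tcd; have [p [k [q H]]] := closedPQ sab tcd.
have [d d0' Hd] := H 1 ltr01.
have bnd (x y u v : R) (h : R) : 0 <= h -> `|x - (y + u * h)| <= h ->
   `|x - y| <= (1 + `|u|) * h.
  move=> h0 xy; rewrite (_ : x - y = (x - (y + u * h)) + u * h); last by ring.
  rewrite (le_trans (ler_normD _ _))// mulrDl mul1r lerD//.
  by rewrite normrM (ger0_norm h0).
have main (f : R -> R) (x u : R) :
    (forall y, `|y - x| <= d -> `|f y - (f x + u * (y - x))| <= `|y - x|) ->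
    {for x, continuous f}.
  move=> fx; apply/cvgrPdist_lt => e e0.
  near=> y; rewrite distrC.
  have yx : `|y - x| <= d.
    by rewrite distrC ltW//; near: y; apply: cvgr_dist_lt => //; exact: cvg_id.
  rewrite (_ : f y - f x = (f y - (f x + u * (y - x))) + u * (y - x)); last by ring.
  rewrite (le_lt_trans (ler_normD _ _))//.
  rewrite (@le_lt_trans _ _ ((1 + `|u|) * `|y - x|))//.
    by rewrite mulrDl mul1r normrM lerD// fx.
  rewrite -ltr_pdivlMl ?ltr_pwDl// distrC; near: y.
  have e1 : 0 < (1 + `|u|)^-1 * e by rewrite mulr_gt0// invr_gt0 ltr_pwDl.
  by apply: cvgr_dist_lt => //; exact: cvg_id.
have z : `|0 : R| <= d by rewrite normr0 ltW.
split.
- apply: (main _ _ p) => y yd.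
  have [|+ _] := Hd y t yd; first by rewrite subrr.
  by rewrite subrr mulr0 addr0 normr0 addr0 mul1r.
- apply: (main _ _ k) => y yd.
  have [|+ _] := Hd s y _ yd; first by rewrite subrr.
  by rewrite subrr mulr0 addr0 normr0 add0r mul1r.
- apply: (main _ _ k) => y yd.
  have [|_ +] := Hd y t yd; first by rewrite subrr.
  by rewrite subrr mulr0 addr0 normr0 addr0 mul1r.
- apply: (main _ _ q) => y yd.
  have [|_ +] := Hd s y _ yd; first by rewrite subrr.
  by rewrite subrr mulr0 addr0 normr0 add0r mul1r.
Unshelve. all: by end_near. Qed.

Lemma cont_P a b t : a0 <= a -> b <= b0 -> c0 <= t <= d0 ->
  cont_on a b (P^~ t).
Proof.
move=> aa bb tcd x /andP[ax xb]; have [|+ _ _ _] := closed_form_cont (s := x) _ tcd => //.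
by rewrite (le_trans aa)//= (le_trans xb).
Qed.

Lemma cont_Q c d s : c0 <= c -> d <= d0 -> a0 <= s <= b0 ->
  cont_on c d (Q s).
Proof.
move=> cc dd sab x /andP[cx xd].
have [|_ _ _ +] := closed_form_cont (t := x) sab => //.
by rewrite (le_trans cc)//= (le_trans xd).
Qed.

Definition subrect a b c d := [/\ a0 <= a, a <= b, b <= b0 &
  [/\ c0 <= c, c <= d & d <= d0]].

Lemma circE a b c d : subrect a b c d ->
  circ a b c d = itg a b (P^~ c) - itg a b (P^~ d) + (itg c d (Q b) - itg c d (Q a)).
Proof.
move=> [aa ab bb [cc cd dd]]; rewrite /circ !itgB//.
- by apply: cont_Q => //; rewrite (le_trans aa ab).
- by apply: cont_Q => //; rewrite aa (le_trans ab bb).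
- by apply: cont_P => //; rewrite cc (le_trans cd dd).
- by apply: cont_P => //; rewrite (le_trans cc cd).
Qed.

Lemma circ_quarter a b c d e f : subrect a b c d -> a <= e <= b -> c <= f <= d ->
  circ a b c d = circ a e c f + circ e b c f + (circ a e f d + circ e b f d).
Proof.
move=> [aa ab bb [cc cd dd]] /andP[ae eb] /andP[cf fd].
have ee : a0 <= e <= b0 by rewrite (le_trans aa ae) (le_trans eb bb).
have ff : c0 <= f <= d0 by rewrite (le_trans cc cf) (le_trans fd dd).
have [a0e eb0] := andP ee; have [c0f fd0] := andP ff.
rewrite !circE//.
have cP t : c0 <= t <= d0 -> cont_on a b (P^~ t) by move=> ?; exact: cont_P.
have cQ s : a0 <= s <= b0 -> cont_on c d (Q s) by move=> ?; exact: cont_Q.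
have cP1 : c0 <= c <= d0 by rewrite cc (le_trans cd).
have cP2 : c0 <= d <= d0 by rewrite dd (le_trans cc).
have cQ1 : a0 <= a <= b0 by rewrite aa (le_trans ab).
have cQ2 : a0 <= b <= b0 by rewrite bb (le_trans aa).
rewrite (itg_split ae eb (cP _ cP1)) (itg_split ae eb (cP _ cP2)).
rewrite (itg_split cf fd (cQ _ cQ1)) (itg_split cf fd (cQ _ cQ2)).
ring.
Qed.

(** The affine part of the form contributes [k (c - d)] to the first
integrand and [k (b - a)] to the second, which cancel after integration; only
the error term is left. *)
Lemma circ_small a b c d s t p k q e : subrect a b c d ->
  a <= s <= b -> c <= t <= d -> 0 <= e ->
  (forall s' t', a <= s' <= b -> c <= t' <= d ->
    `|P s' t' - (P s t + p * (s' - s) + k * (t' - t))|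
       <= e * (`|s' - s| + `|t' - t|) /\
    `|Q s' t' - (Q s t + k * (s' - s) + q * (t' - t))|
       <= e * (`|s' - s| + `|t' - t|)) ->
  `|circ a b c d| <= 2 * e * ((b - a) + (d - c)) ^+ 2.
Proof.
move=> sub sab tcd e0 H; have [aa ab bb [cc cd dd]] := sub.
set w := (b - a) + (d - c).
have aab : a <= a <= b by rewrite lexx. have bab : a <= b <= b by rewrite lexx ab.
have ccd : c <= c <= d by rewrite lexx. have dcd : c <= d <= d by rewrite lexx cd.
have near s' t' : a <= s' <= b -> c <= t' <= d ->
    e * (`|s' - s| + `|t' - t|) <= e * w.
  move=> /andP[as' sb'] /andP[ct' td']; apply: ler_wpM2l => //; apply: lerD.
    by rewrite ler_norml; lra.
  by rewrite ler_norml; lra.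
have cP t' : c <= t' <= d -> cont_on a b (P^~ t').
  by move=> /andP[ct td]; apply: cont_P => //; rewrite (le_trans cc)//= (le_trans td).
have cQ s' : a <= s' <= b -> cont_on c d (Q s').
  by move=> /andP[as' sb]; apply: cont_Q => //; rewrite (le_trans aa)//= (le_trans sb).
have I1 : `|itg a b (fun s => P s c - P s d) - k * (c - d) * (b - a)|
     <= 2 * e * w * (b - a).
  apply: itg_near_cst => //; first by apply: cont_onB; exact: cP.
  move=> x xab.
  have [h1 _] := H x c xab ccd; have [h2 _] := H x d xab dcd.
  have {h1}h1 := le_trans h1 (near _ _ xab ccd).
  have {h2}h2 := le_trans h2 (near _ _ xab dcd).
  rewrite (_ : _ - _ = (P x c - (P s t + p * (x - s) + k * (c - t))) -
    (P x d - (P s t + p * (x - s) + k * (d - t)))); last by ring.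
  rewrite (le_trans (ler_normB _ _))//; lra.
have I2 : `|itg c d (fun t => Q b t - Q a t) - k * (b - a) * (d - c)|
     <= 2 * e * w * (d - c).
  apply: itg_near_cst => //; first by apply: cont_onB; exact: cQ.
  move=> x xcd.
  have [_ h1] := H b x bab xcd; have [_ h2] := H a x aab xcd.
  have {h1}h1 := le_trans h1 (near _ _ bab xcd).
  have {h2}h2 := le_trans h2 (near _ _ aab xcd).
  rewrite (_ : _ - _ = (Q b x - (Q s t + k * (b - s) + q * (x - t))) -
    (Q a x - (Q s t + k * (a - s) + q * (x - t)))); last by ring.
  rewrite (le_trans (ler_normB _ _))//; lra.
rewrite /circ.
set A := itg a b _ in I1 *; set B := itg c d _ in I2 *.
rewrite (_ : A + B = (A - k * (c - d) * (b - a)) + (B - k * (b - a) * (d - c)));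
  last by ring.
rewrite (le_trans (ler_normD _ _))// (le_trans (lerD I1 I2))//.
by rewrite -mulrDr -/w expr2 mulrA.
Qed.

(** One of the four quarters carries at least a quarter of the circulation.
It is stated for all quadruples, with no claim when [r] is not a subrectangle,
so that the choice of the quarter is a total function that can be iterated. *)
Lemma circ_bisect (r : R * R * (R * R)) : exists r' : R * R * (R * R),
  subrect r.1.1 r.1.2 r.2.1 r.2.2 ->
  [/\ subrect r'.1.1 r'.1.2 r'.2.1 r'.2.2,
     r.1.1 <= r'.1.1 /\ r'.1.2 <= r.1.2,
     r.2.1 <= r'.2.1 /\ r'.2.2 <= r.2.2,
     r'.1.2 - r'.1.1 = (r.1.2 - r.1.1) / 2 /\
       r'.2.2 - r'.2.1 = (r.2.2 - r.2.1) / 2 &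
     `|circ r.1.1 r.1.2 r.2.1 r.2.2| <= 4 * `|circ r'.1.1 r'.1.2 r'.2.1 r'.2.2|].
Proof.
case: r => [[a b] [c d]] /=.
have [sub|nsub] := pselect (subrect a b c d); last by exists (a, b, (c, d)).
pose e := (a + b) / 2; pose f := (c + d) / 2.
have [aa ab bb [cc cd dd]] := sub.
have ae : a <= e <= b by rewrite /e; lra.
have cf : c <= f <= d by rewrite /f; lra.
have E := circ_quarter sub ae cf.
have [/andP[ae1 ae2] /andP[cf1 cf2]] := (ae, cf).
have N : `|circ a b c d| <= `|circ a e c f| + `|circ e b c f| +
    (`|circ a e f d| + `|circ e b f d|).
  by rewrite E (le_trans (ler_normD _ _))// lerD// ler_normD.
have [be ea] : b - e = (b - a) / 2 /\ e - a = (b - a) / 2 by rewrite /e; split; field.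
have [df fc] : d - f = (d - c) / 2 /\ f - c = (d - c) / 2 by rewrite /f; split; field.
have sr x1 x2 y1 y2 : a <= x1 -> x1 <= x2 -> x2 <= b -> c <= y1 -> y1 <= y2 ->
    y2 <= d -> subrect x1 x2 y1 y2.
  move=> ? ? xb cy ? yd; split; rewrite ?(le_trans aa) ?(le_trans xb bb)//.
  by rewrite ?(le_trans cc) ?(le_trans yd dd).
have [H1|H1] := leP (`|circ a b c d|) (4 * `|circ a e c f|).
  by exists (a, e, (c, f)) => _; split=> //; exact: sr.
have [H2|H2] := leP (`|circ a b c d|) (4 * `|circ e b c f|).
  by exists (e, b, (c, f)) => _; split=> //; exact: sr.
have [H3|H3] := leP (`|circ a b c d|) (4 * `|circ a e f d|).
  by exists (a, e, (f, d)) => _; split=> //; exact: sr.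
exists (e, b, (f, d)) => _; split=> //=; first exact: sr.
by clear -H1 H2 H3 N; lra.
Qed.

(** Goursat's argument: at the common point of nested rectangles with at
least [4^-n] of the circulation, differentiability makes that circulation
[o(4^-n)]. *)
Theorem goursat : a0 <= b0 -> c0 <= d0 -> circ a0 b0 c0 d0 = 0.
Proof.
move=> ab0 cd0; apply/eqP/negPn/negP; rewrite -normr_gt0.
set D := `|_| => D0.
have [step stepP] := choice circ_bisect.
pose r n := iter n step (a0, b0, (c0, d0)).
pose w := (b0 - a0) + (d0 - c0).
have H n : [/\ subrect (r n).1.1 (r n).1.2 (r n).2.1 (r n).2.2,
    (r n).1.2 - (r n).1.1 = (b0 - a0) / 2 ^+ n /\
      (r n).2.2 - (r n).2.1 = (d0 - c0) / 2 ^+ n &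
    D <= 4 ^+ n * `|circ (r n).1.1 (r n).1.2 (r n).2.1 (r n).2.2|].
  elim: n => [|n [sub [wn hn] Dn]].
    by rewrite !expr0 mul1r !divr1; split => //; split => //; split.
  have [sub' _ _ [wn' hn'] Dn'] := stepP (r n) sub; split => //=.
    rewrite wn' hn' wn hn !exprS !invfM.
    by split; rewrite -!mulrA; congr (_ * _); rewrite mulrC.
  rewrite (le_trans Dn)// exprSr -mulrA ler_wpM2l// exprn_ge0.
have mon n : [/\ (r n).1.1 <= (r n.+1).1.1, (r n.+1).1.2 <= (r n).1.2,
    (r n).2.1 <= (r n.+1).2.1 & (r n.+1).2.2 <= (r n).2.2].
  have [sub _ _] := H n.
  by have [_ [? ?] [? ?] _ _] := stepP (r n) sub; split.
have nested (x y : nat -> R) : (forall n, x n <= x n.+1) ->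
    (forall n, y n.+1 <= y n) -> (forall n, x n <= y n) ->
    exists z, forall n, x n <= z <= y n.
  move=> ndx niy xy.
  have ub k n : x k <= y n.
    have [kn|/ltnW nk] := leqP k n.
      by apply: le_trans (xy n); exact: (nondecreasing_seqP x).1.
    apply: (le_trans (xy k)).
    exact: (nonincreasing_seqP y).1.
  have hs : has_sup (range x).
    by split; [exists (x 0%N), 0%N|exists (y 0%N) => _ [k _ <-]].
  exists (sup (range x)) => n; apply/andP; split.
    by apply: sup_ubound; [case: hs|exists n].
  by apply: ge_sup; [case: hs|move=> _ [k _ <-]].
have [s sP] : exists s, forall n, (r n).1.1 <= s <= (r n).1.2.
  apply: nested => n; try by case: (mon n).
  by have [[]] := H n.
have [t tP] : exists t, forall n, (r n).2.1 <= t <= (r n).2.2.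
  apply: nested => n; try by case: (mon n).
  by have [[_ _ _ []]] := H n.
have [p [k [q loc]]] := closedPQ (sP 0%N) (tP 0%N).
(* Small enough for [2 e w^2 < D], also when [w = 0]. *)
pose e := D / (4 * (w ^+ 2 + 1)).
have w2 : 0 < w ^+ 2 + 1 by rewrite ltr_wpDl// sqr_ge0.
have e0 : 0 < e by rewrite /e divr_gt0// mulr_gt0.
have [del del0 locd] := loc e e0.
have w0 : 0 <= w by rewrite /w; lra.
(* The [n]-th rectangle has half-perimeter [w / 2^n]. *)
have [n wn] : exists n, w / 2 ^+ n <= del.
  pose N := Num.truncn (w / del); exists N.+1.
  rewrite ler_pdivrMr ?exprn_gt0// -ler_pdivrMl// mulrC.
  have : w / del < N.+1%:R by rewrite truncnS_gt.
  move=> /ltW/le_trans; apply.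
  by rewrite -natrX ler_nat ltnW// ltn_expl.
have [sub [hw hh] Dn] := H n.
have [aa ab bb [cc cd dd]] := sub.
have P2 : (0 : R) < 2 ^+ n by rewrite exprn_gt0.
have := circ_small (p := p) (k := k) (q := q) sub (sP n) (tP n) (ltW e0).
have small s' t' : (r n).1.1 <= s' <= (r n).1.2 -> (r n).2.1 <= t' <= (r n).2.2 ->
   `|s' - s| <= del /\ `|t' - t| <= del.
  move=> s'b t'b; have sb := sP n; have tb := tP n.
  have : w / 2 ^+ n = (b0 - a0) / 2 ^+ n + (d0 - c0) / 2 ^+ n by rewrite -mulrDl.
  rewrite -hw -hh => ww.
  by split; rewrite ler_norml; lra.
case/(_ _)/Wrap => [s' t' s'b t'b|[]].
  by have [h1 h2] := small _ _ s'b t'b; exact: locd.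
rewrite hw hh -mulrDl -/w => small'.
have : D <= 2 * e * w ^+ 2.
  have E4 : (4 : R) ^+ n = (2 ^+ n) ^+ 2.
    by rewrite -exprM mulnC exprM; congr (_ ^+ n); ring.
  apply: (le_trans Dn); rewrite E4.
  rewrite (_ : 2 * e * w ^+ 2 = (2 ^+ n) ^+ 2 * (2 * e * (w / 2 ^+ n) ^+ 2)).
    by rewrite ler_wpM2l// sqr_ge0.
  by field; rewrite gt_eqF.
rewrite /e => DD.
have : 2 * (D / (4 * (w ^+ 2 + 1))) * w ^+ 2 < D.
  rewrite mulrAC mulrA ltr_pdivrMr ?mulr_gt0//.
  have : 0 <= w ^+ 2 by rewrite sqr_ge0.
  nra.
by move=> /(le_lt_trans DD); rewrite ltxx.
Qed.

End Goursat.

(** * Rotations preserve Lebesgue measure, and averaging over them *)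

Section Preserves.
Local Open Scope ereal_scope.

Definition preserves d (X : measurableType d) (R : realType)
    (mu : set X -> \bar R) (T : X -> X) :=
  measurable_fun setT T /\ forall A, measurable A -> mu (T @^-1` A) = mu A.

Lemma preserves_comp d (X : measurableType d) (R : realType)
    (mu : set X -> \bar R) (S T : X -> X) :
  preserves mu S -> preserves mu T -> preserves mu (S \o T).
Proof.
move=> [mS pS] [mT pT]; split; first exact: measurableT_comp.
move=> A mA; rewrite comp_preimage pT ?pS//.
by rewrite -[X in measurable X]setTI; exact: mS.
Qed.

Lemma preserves_id d (X : measurableType d) (R : realType)
    (mu : set X -> \bar R) : preserves mu id.
Proof. by split => //; exact: measurable_id. Qed.

Section skew.
Context d1 d2 (X : measurableType d1) (Y : measurableType d2) (R : realType).
Variable m1 : {sigma_finite_measure set X -> \bar R}.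
Variable m2 : {sigma_finite_measure set Y -> \bar R}.

(** A skew product of measure-preserving maps acts on each section by a
measure-preserving map, and the product measure integrates sections. *)
Lemma preserves_skew2 (T : X -> Y -> Y) :
  measurable_fun setT (fun p : X * Y => T p.1 p.2) ->
  (forall x, preserves m2 (T x)) ->
  preserves (m1 \x m2) (fun p : X * Y => (p.1, T p.1 p.2)).
Proof.
move=> mT pT; split; first exact: measurable_fun_pair.
move=> A mA; rewrite /product_measure1; apply: eq_integral => x _ /=.
rewrite -[RHS](pT x).2; last exact: measurable_xsection.
by congr (m2 _); apply/seteqP; split => y; rewrite /xsection/= !inE.
Qed.

Lemma product_measure12E (A : set (X * Y)) : measurable A ->
  (m1 \x m2) A = (m1 \x^ m2) A.
Proof.
by move=> mA; apply: product_measure_unique => // *; exact: product_measure2E.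
Qed.

Lemma preserves_skew1 (T : Y -> X -> X) :
  measurable_fun setT (fun p : X * Y => T p.2 p.1) ->
  (forall y, preserves m1 (T y)) ->
  preserves (m1 \x m2) (fun p : X * Y => (T p.2 p.1, p.2)).
Proof.
move=> mT pT.
have mS : measurable_fun setT (fun p : X * Y => (T p.2 p.1, p.2)).
  exact: measurable_fun_pair.
split => // A mA; rewrite !product_measure12E//; last first.
  by rewrite -[X in measurable X]setTI; exact: mS.
rewrite /product_measure2; apply: eq_integral => y _ /=.
rewrite -[RHS](pT y).2; last exact: measurable_ysection.
by congr (m1 _); apply/seteqP; split => x; rewrite /ysection/= !inE.
Qed.
End skew.

Section integral.
Context d (X : measurableType d) (R : realType).
Variable mu : {measure set X -> \bar R}.
Variable T : X -> X.
Hypothesis pT : preserves mu T.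

(** A change of variables without Jacobian: the image of [mu] under [T] is
[mu]. *)
Lemma ge0_integral_preserves (f : X -> \bar R) :
  measurable_fun setT f -> (forall x, 0 <= f x) ->
  \int[mu]_x f (T x) = \int[mu]_x f x.
Proof.
move=> mf f0; have [mT eT] := pT.
have := @ge0_integral_pushforward _ _ X X R T mT mu setT f measurableT mf
  (fun y _ => f0 y).
rewrite preimage_setT => <-; apply: eq_measure_integral => A mA _.
exact: eT.
Qed.

Lemma integrable_preserves (f : X -> \bar R) :
  mu.-integrable setT f -> mu.-integrable setT (f \o T).
Proof.
move=> /integrableP[mf fi]; apply/integrableP; split.
  by apply: measurableT_comp => //; exact: pT.1.
rewrite (@ge0_integral_preserves (fun x => `|f x|))//.
exact: measurableT_comp.
Qed.

Lemma integral_preserves (f : X -> \bar R) : mu.-integrable setT f ->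
  \int[mu]_x f (T x) = \int[mu]_x f x.
Proof.
move=> fi; have [mT eT] := pT.
have := @integral_pushforward _ _ X X R T mT mu setT f (measurable_int _ fi).
rewrite preimage_setT => /(_ (integrable_preserves fi) measurableT) <-.
by apply: eq_measure_integral => A mA _; exact: eT.
Qed.
End integral.

Section average.
Context d (X : measurableType d) (R : realType).
Variable mu : {sigma_finite_measure set X -> \bar R}.
Variable T : R -> X -> X.
Hypothesis mT : measurable_fun setT (fun p : X * measurableTypeR R => T p.2 p.1).
Hypothesis pT : forall t, preserves mu (T t).
Variables (a b : R).
Hypothesis ab : (a <= b)%R.
Variable F : X -> R.
Hypothesis Fi : mu.-integrable setT (EFin \o F).

Local Notation la := (@lebesgue_measure R).
Let I : set (measurableTypeR R) := `[a, b]%classic.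
Let Phi (p : X * measurableTypeR R) : \bar R := (\1_I p.2 * F (T p.2 p.1))%:E.

Let mI : measurable I. Proof. exact: measurable_itv. Qed.

Let laI : la I = (b - a)%:E.
Proof.
rewrite [LHS](lebesgue_measure_itv `[a, b])/= lte_fin.
case: ifPn => //; rewrite -leNgt => ba.
by rewrite (le_anti (introT andP (conj ab ba))) subrr.
Qed.

Let mPhi : measurable_fun setT Phi.
Proof.
apply/measurable_EFinP; apply: measurable_funM.
  exact: measurableT_comp.
have /measurable_EFinP := measurable_int _ Fi.
by move=> mF; exact: measurableT_comp.
Qed.

Let iPhi : (mu \x la).-integrable setT Phi.
Proof.
apply: (integrable21ltyP _ _ mPhi).2.
have [_ Foo] := integrableP _ _ _ Fi.
rewrite [ltLHS](_ : _ = \int[la]_x ((\int[mu]_y `|(F y)%:E|) * (\1_I x)%:E)).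
  rewrite ge0_integralZl//; last 2 first.
  - by apply/measurable_EFinP; exact: measurable_indic.
  - exact: integral_ge0.
  rewrite integral_indic// setIT [X in _ * X]laI; apply: lte_mul_pinfty => //.
  - exact: integral_ge0.
  - by rewrite ge0_fin_numE// integral_ge0.
  - exact: ltry.
apply: eq_integral => t _; rewrite /Phi.
under eq_integral do rewrite /= normrM EFinM.
rewrite ge0_integralZl//; last first.
  apply/measurable_EFinP; apply: measurableT_comp => //.
  have /measurable_EFinP mF := measurable_int _ Fi.
  by apply: measurableT_comp => //; exact: (pT t).1.
rewrite (ge0_integral_preserves (pT t) (f := fun y => `|(F y)%:E|))//; last first.
  by apply: measurableT_comp => //; exact: measurable_int Fi.
by rewrite muleC; congr (_ * _%:E); rewrite ger0_norm.
Qed.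

Let AE x : (itg a b (fun t => F (T t x))) = fine (\int[la]_t Phi (x, t)).
Proof.
rewrite /itg /Rintegral integral_mkcond; congr fine; apply: eq_integral => t _.
rewrite /Phi patchE /= indicE /I; case: ifPn => tI; first by rewrite mul1r.
by rewrite mul0r.
Qed.

(** The average exists and is integrable because [F (T t x)] is integrable
on the product with the interval, each [T t] preserving the integral of [|F|]. *)
Lemma integrable_average :
  mu.-integrable setT (fun x => (itg a b (fun t => F (T t x)))%:E).
Proof.
under eq_fun do rewrite AE.
have /integrableP[mG Gi] := integrable_fubini_F iPhi.
apply/integrableP; split.
  by apply/measurable_EFinP; apply: measurableT_comp => //; exact: mG.
apply: le_lt_trans Gi; apply: ge0_le_integral => //.
- apply: measurableT_comp => //; apply/measurable_EFinP.
  by apply: measurableT_comp => //; exact: mG.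
- exact: measurableT_comp.
- by move=> x _; rewrite /fubini_F; case: (\int[la]_t _) => //= *; rewrite ?normr0// leey.
Qed.

(** Fubini's theorem: for each [t] the integral over [x] is that of [F]. *)
Lemma integral_average :
  \int[mu]_x (itg a b (fun t => F (T t x)))%:E = (b - a)%:E * \int[mu]_x (F x)%:E.
Proof.
under eq_integral do rewrite AE.
have iG := integrable_fubini_F iPhi.
transitivity (\int[mu]_x \int[la]_t Phi (x, t)).
  apply: ae_eq_integral => //.
  - by apply/measurable_EFinP; apply: measurableT_comp => //; exact: measurable_int iG.
  - exact: measurable_int iG.
  - by apply: filterS (integrable_ae measurableT iG) => x /= /(_ Logic.I) fx _; rewrite fineK.
rewrite (integral12_prod_meas1 iPhi) -(integral21_prod_meas1 iPhi) /fubini_G.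
have fF : \int[mu]_x (F x)%:E \is a fin_num.
  exact: (integrable_fin_num measurableT Fi).
transitivity (\int[la]_t ((fine (\int[mu]_x (F x)%:E)) * \1_I t)%:E).
  apply: eq_integral => t _; rewrite /Phi EFinM fineK//.
  under eq_integral do rewrite /= EFinM.
  rewrite integralZl//; last exact: (integrable_preserves (pT t) Fi).
  by rewrite (integral_preserves (pT t) (f := EFin \o F))// muleC.
under eq_integral do rewrite EFinM.
rewrite integralZl//; last first.
  exact: (integrable_indic_itv a b true false).
by rewrite integral_indic// setIT [X in _ * X]laI fineK// muleC.
Qed.

End average.
End Preserves.

Section Rotation.
Variable R : realType.
Local Notation la := (@lebesgue_measure R).
Local Notation mR := (measurableTypeR R).

(** Translations map intervals to intervals of the same length, and the
lengths of the intervals determine the measure. *)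
Lemma preserves_translation (c : R) : preserves la (fun x : mR => x + c).
Proof.
have mT : measurable_fun [set: mR] (fun x : mR => (x + c : mR)).
  exact: measurable_funD.
split=> // A mA.
apply/esym; apply: (@lebesgue_measure_unique R (pushforward la (fun x : mR => (x + c : mR)))) => //.
move=> _ [[u v] _ <-] /=; rewrite /pushforward.
rewrite (_ : _ @^-1` _ = `]u - c, v - c]%classic); last first.
  by apply/seteqP; split => x; rewrite /= !in_itv/= ltrBlDr lerBrDr.
by rewrite !lebesgue_measure_itv/= !lte_fin ltrD2r -!EFinB; case: ifP => // _; congr _%:E; ring.
Qed.

Definition shear1 (a : R) (x : R * R) : R * R := (x.1 + a * x.2, x.2).
Definition shear2 (a : R) (x : R * R) : R * R := (x.1, x.2 + a * x.1).
Definition rot (c s : R) (x : R * R) : R * R :=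
  (c * x.1 - s * x.2, s * x.1 + c * x.2).

Lemma preserves_shear1 (a : R) :
  preserves (@dA R) (shear1 a : mR * mR -> mR * mR).
Proof.
apply: (@preserves_skew1 _ _ mR mR R la la (fun (y x : R) => x + a * y)).
  by apply: measurable_funD => //; apply: measurable_funM.
by move=> y; exact: preserves_translation.
Qed.

Lemma preserves_shear2 (a : R) :
  preserves (@dA R) (shear2 a : mR * mR -> mR * mR).
Proof.
apply: (@preserves_skew2 _ _ mR mR R la la (fun (x y : R) => y + a * x)).
  by apply: measurable_funD => //; apply: measurable_funM.
by move=> y; exact: preserves_translation.
Qed.

Lemma shear_rot (a c s : R) (x : R * R) : a * s = c - 1 -> a + a * c = - s ->
  shear1 a (shear2 s (shear1 a x)) = rot c s x.
Proof.
case: x => x y as1 ac; rewrite /shear1 /shear2 /rot /=; congr pair.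
  have -> : x + a * y + a * (y + s * (x + a * y)) =
    (1 + a * s) * x + (a + a * (1 + a * s)) * y by ring.
  by rewrite as1 (addrC 1) subrK ac mulNr.
have -> : y + s * (x + a * y) = s * x + (1 + a * s) * y by ring.
by rewrite as1 (addrC 1) subrK.
Qed.

Lemma rot_id (x : R * R) : x = rot 1 0 x.
Proof. by case: x => x y; rewrite /rot/= !mul1r !mul0r subr0 add0r. Qed.

Lemma rot_half (x : R * R) : rot 0 1 (rot 0 1 x) = rot (- 1) 0 x.
Proof. by case: x => x y; rewrite /rot/=; congr pair; ring. Qed.

(** A rotation other than [1] and [-1] is a product of three shears, and a
shear translates each line parallel to an axis; [-1] is the square of the
quarter turn. *)
Lemma preserves_rot (c s : R) : c ^+ 2 + s ^+ 2 = 1 -> preserves (@dA R) (rot c s : mR * mR -> mR * mR).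
Proof.
have gen c' s' : c' ^+ 2 + s' ^+ 2 = 1 -> s' != 0 -> preserves (@dA R) (rot c' s' : mR * mR -> mR * mR).
  move=> cs s0; pose a := (c' - 1) / s'.
  have as1 : a * s' = c' - 1 by rewrite /a divfK.
  have ac : a + a * c' = - s'.
    apply: (mulIf s0); have -> : (a + a * c') * s' = a * s' * (1 + c') by ring.
    by rewrite as1; lra.
  have := preserves_comp (preserves_shear1 a)
    (preserves_comp (preserves_shear2 s') (preserves_shear1 a)).
  congr preserves; apply/funext => x /=; exact: shear_rot.
move=> cs; have [s0|s0] := eqVneq s 0; last exact: gen.
have : (c - 1) * (c + 1) = 0 by rewrite s0 in cs; lra.
move=> /eqP; rewrite mulf_eq0 => /orP[|]; rewrite ?subr_eq0 ?addr_eq0 => /eqP c1.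
  have := preserves_id (@dA R); congr preserves; apply/funext => x.
  by rewrite s0 c1; exact: rot_id.
have j : preserves (@dA R) (rot 0 1 : mR * mR -> mR * mR).
  by apply: gen; rewrite ?oner_eq0// expr1n expr0n add0r.
have := preserves_comp j j; congr preserves; apply/funext => x.
by rewrite s0 c1; exact: rot_half.
Qed.

Definition rot1 (t : R) (x : mR4 R) : mR4 R := (rot (cos t) (sin t) x.1, x.2).
Definition rot2 (t : R) (x : mR4 R) : mR4 R := (x.1, rot (cos t) (sin t) x.2).

Lemma measurable_rot d (T : measurableType d) (f : T -> R) (g : T -> mR * mR) :
  measurable_fun setT f -> measurable_fun setT g ->
  measurable_fun setT (fun t => rot (cos (f t)) (sin (f t)) (g t)).
Proof.
move=> mf mg.
have mc : measurable_fun [set: T] (fun t => cos (f t)).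
  by apply: measurableT_comp => //; apply: continuous_measurable_fun; exact: continuous_cos.
have ms : measurable_fun [set: T] (fun t => sin (f t)).
  by apply: measurableT_comp => //; apply: continuous_measurable_fun; exact: continuous_sin.
have m1 : measurable_fun [set: T] (fun t => (g t).1) by exact: measurableT_comp.
have m2 : measurable_fun [set: T] (fun t => (g t).2) by exact: measurableT_comp.
by apply: measurable_fun_pair; [apply: measurable_funB|apply: measurable_funD];
  apply: measurable_funM.
Qed.

Lemma measurable_rot1 :
  measurable_fun setT (fun p : mR4 R * mR => rot1 p.2 p.1).
Proof.
by apply: measurable_fun_pair; [apply: measurable_rot => //|]; exact: measurableT_comp.
Qed.

Lemma measurable_rot2 :
  measurable_fun setT (fun p : mR4 R * mR => rot2 p.2 p.1).
Proof.
by apply: measurable_fun_pair; [|apply: measurable_rot => //]; exact: measurableT_comp.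
Qed.

Lemma preserves_rot1 t : preserves (@dV R) (rot1 t).
Proof.
have pr := preserves_rot (cos2Dsin2 t).
apply: (@preserves_skew1 _ _ _ _ R (@dA R) (@dA R) (fun _ => rot (cos t) (sin t))) => //.
by apply: measurableT_comp => //; exact: pr.1.
Qed.

Lemma preserves_rot2 t : preserves (@dV R) (rot2 t).
Proof.
have pr := preserves_rot (cos2Dsin2 t).
apply: (@preserves_skew2 _ _ _ _ R (@dA R) (@dA R) (fun _ => rot (cos t) (sin t))) => //.
by apply: measurableT_comp => //; exact: pr.1.
Qed.

End Rotation.

(** * Circle means of functions of one complex variable *)

Section ComplexBasics.
Variable R : realType.
Implicit Types (z w : R[i]) (x y r t : R).
Local Notation Re := (@complex.Re R).
Local Notation Im := (@complex.Im R).
Local Open Scope complex_scope.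

Lemma cmodE z : `|z| = (cmod z)%:C.
Proof. by rewrite /cmod normc_def. Qed.

Lemma cmod_def z : cmod z = Num.sqrt (Re z ^+ 2 + Im z ^+ 2).
Proof. by rewrite /cmod normc_def. Qed.

Lemma cmod_ge0 z : 0 <= cmod z.
Proof. by rewrite cmod_def sqrtr_ge0. Qed.

Lemma cmod_sqr z : cmod z ^+ 2 = Re z ^+ 2 + Im z ^+ 2.
Proof. by rewrite cmod_def sqr_sqrtr// addr_ge0// sqr_ge0. Qed.

Lemma cmodM z w : cmod (z * w) = cmod z * cmod w.
Proof. by apply/(@complexI R); rewrite -cmodE normrM !cmodE -rmorphM. Qed.

Lemma cmodX z k : cmod (z ^+ k) = cmod z ^+ k.
Proof. by apply/(@complexI R); rewrite -cmodE normrX !cmodE -rmorphXn. Qed.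

Lemma cmodV z : cmod z^-1 = (cmod z)^-1.
Proof. by apply/(@complexI R); rewrite -cmodE normfV !cmodE -fmorphV. Qed.

Lemma cmodN z : cmod (- z) = cmod z.
Proof. by apply/(@complexI R); rewrite -!cmodE normrN. Qed.

Lemma cmod_conj z : cmod z^* = cmod z.
Proof. by rewrite !cmod_def; case: z => a b /=; rewrite sqrrN. Qed.

Lemma cmodD z w : cmod (z + w) <= cmod z + cmod w.
Proof. by rewrite -lecR rmorphD -!cmodE ler_normD. Qed.

Lemma cmod_real x : cmod (x%:C) = `|x|.
Proof. by rewrite cmod_def /= expr0n addr0 sqrtr_sqr. Qed.

Lemma cmod_gt0 z : (0 < cmod z) = (z != 0).
Proof. by rewrite -ltcR -cmodE normr_gt0. Qed.

Lemma cmod0 : cmod (0 : R[i]) = 0.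
Proof. by rewrite (cmod_real 0) normr0. Qed.

Lemma cmod_eq0 z : (cmod z == 0) = (z == 0).
Proof. by apply/negb_inj; rewrite -cmod_gt0 lt_def cmod_ge0 andbT. Qed.

Lemma ler_Re_cmod z : `|Re z| <= cmod z.
Proof.
by rewrite -[leRHS]ger0_norm ?cmod_ge0// -ler_sqr ?normr_nneg// !real_normK ?num_real// cmod_sqr lerDl sqr_ge0.
Qed.

Lemma ler_Im_cmod z : `|Im z| <= cmod z.
Proof.
by rewrite -[leRHS]ger0_norm ?cmod_ge0// -ler_sqr ?normr_nneg// !real_normK ?num_real// cmod_sqr lerDr sqr_ge0.
Qed.

Lemma cmod_le z : cmod z <= `|Re z| + `|Im z|.
Proof.
rewrite -ler_sqr ?nnegrE ?cmod_ge0 ?addr_ge0// cmod_sqr sqrrD !real_normK ?num_real//.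
by rewrite lerD2r lerDl mulrn_wge0 // mulr_ge0.
Qed.

Lemma mulcJ z : z * z^* = (cmod z ^+ 2)%:C.
Proof. by case: z => a b; rewrite cmod_sqr /=; simpc; congr (_ +i* _); ring. Qed.

(** [r e^{it}] *)
Definition polar r t : R[i] := (r * cos t) +i* (r * sin t).

Lemma polarM r t r' t' : polar r t * polar r' t' = polar (r * r') (t + t').
Proof.
by rewrite /polar cosD sinD; simpc; congr (_ +i* _); ring.
Qed.

Lemma polar10 : polar 1 0 = 1.
Proof. by rewrite /polar cos0 sin0 mulr1 mulr0. Qed.

Lemma cmod_polar r t : cmod (polar r t) = `|r|.
Proof.
rewrite cmod_def /= !exprMn -mulrDr cos2Dsin2 mulr1 sqrtr_sqr//.
Qed.

Lemma polar_neq0 r t : r != 0 -> polar r t != 0.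
Proof. by move=> r0; rewrite -cmod_gt0 cmod_polar normr_gt0. Qed.

Lemma circle_angle x y : x ^+ 2 + y ^+ 2 = 1 -> exists t, cos t = x /\ sin t = y.
Proof.
move=> xy.
have x1 : -1 <= x <= 1.
  by rewrite -ler_norml -ler_sqr ?nnegrE// expr1n real_normK ?num_real// -xy lerDl sqr_ge0.
have y2 : Num.sqrt (1 - x ^+ 2) = `|y| by rewrite -xy addrC addKr sqrtr_sqr.
have [y0|y0] := leP 0 y.
  by exists (acos x); rewrite acosK// sin_acos// y2 ger0_norm.
exists (- acos x); rewrite cosN sinN acosK// sin_acos// y2 ltr0_norm//.
by rewrite opprK.
Qed.

(** A logarithm: every nonzero complex number is [e^{s + it}]. *)
Lemma polar_repr z : z != 0 -> exists s t, z = polar (expR s) t.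
Proof.
move=> z0; have r0 : 0 < cmod z by rewrite cmod_gt0.
have [|t [ct st]] := @circle_angle (Re z / cmod z) (Im z / cmod z).
  by rewrite !expr_div_n -mulrDl -cmod_sqr mulfV// gt_eqF// exprn_gt0.
exists (ln (cmod z)), t; rewrite lnK ?posrE// /polar ct st !mulrA.
by rewrite ![cmod z * _]mulrC !mulfK ?gt_eqF//; case: (z).
Qed.

End ComplexBasics.

Section Approx.

(** Stated over any base field, for real and complex derivatives alike. *)
Lemma derivable_approx (K : numFieldType) (V : normedModType K) (f : V -> K^o)
    (x v : V) : derivable f x v ->
  forall e : K, 0 < e -> exists2 d : K, 0 < d & forall h, `|h| <= d ->
    `|f (h *: v + x) - f x - h * 'D_v f x| <= e * `|h|.
Proof.
move=> df e e0; have /eqaddoP/(_ e e0) := derivable_nbhs df.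
rewrite nearE => /nbhs_ballP[d /= d0 dP].
exists (d / 2); first by rewrite divr_gt0.
move=> h hd; have := dP h; rewrite /ball/= sub0r normrN => /(_ _).
rewrite !fctE/= opprD addrA; apply.
by rewrite (le_lt_trans hd)// ltr_pdivrMr// ltr_pMr// ltr1n.
Qed.

Lemma is_derive_approx (R : realType) (f : R -> R) (x l : R) :
  is_derive x 1 f l ->
  forall e : R, 0 < e -> exists2 d : R, 0 < d & forall h, `|h| <= d ->
    `|f (x + h) - f x - l * h| <= e * `|h|.
Proof.
move=> [df dl] e e0; have [d d0 dP] := derivable_approx df e0.
exists d => // h hd; have := dP h hd.
by rewrite -[h *: 1]/(h * 1) mulr1 (addrC h) -dl (mulrC h).
Qed.

Section polar.
Variable R : realType.
Local Open Scope complex_scope.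

(** The derivative of the exponential at [0] is [1]: to first order
[e^{a + ib}] is [1 + a + ib]. *)
Lemma polar_approx (e : R) : 0 < e -> exists2 d : R, 0 < d &
  forall a b : R, `|a| <= d -> `|b| <= d ->
    cmod (polar (expR a) b - 1 - (a +i* b)) <= e * (`|a| + `|b|).
Proof.
move=> e0; pose e1 := Num.min (e / 8) 1.
have e10 : 0 < e1 by rewrite /e1 lt_min ltr01 divr_gt0.
have e11 : e1 <= 1 by rewrite /e1 ge_min lexx orbT.
have e18 : 8 * e1 <= e by rewrite mulrC -ler_pdivlMr// /e1 ge_min lexx.
clearbody e1.
have [d1 d10 H1] := is_derive_approx (is_derive_expR (0 : R)) e10.
have [d2 d20 H2] := is_derive_approx (is_derive_sin (0 : R)) e10.
have [d3 d30 H3] := is_derive_approx (is_derive_cos (0 : R)) e10.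
pose d := Num.min (Num.min d1 d2) (Num.min d3 e1).
exists d; first by rewrite /d !lt_min d10 d20 d30 e10.
move=> a b; rewrite /d !le_min => /andP[/andP[a1 a2] /andP[a3 a4]].
move=> /andP[/andP[b1 b2] /andP[b3 b4]].
have {H1} := H1 a a1; rewrite add0r expR0 mul1r => H1.
have {H2} := H2 b b2; rewrite add0r sin0 subr0 cos0 mul1r => H2.
have {H3} := H3 b b3; rewrite add0r cos0 sin0 oppr0 mul0r subr0 => H3.
apply: le_trans (cmod_le _) _; rewrite /polar /=.
have A0 := normr_ge0 a; have B0 := normr_ge0 b.
have c1 : `|cos b| <= 1 by rewrite ler_norml cos_geN1 cos_le1.
have s1 : `|sin b| <= 2 * `|b|.
  rewrite (_ : sin b = (sin b - b) + b); last by rewrite subrK.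
  by rewrite (le_trans (ler_normD _ _))//; nra.
have E1 : `|expR a - 1| <= 2 * `|a|.
  rewrite (_ : expR a - 1 = (expR a - 1 - a) + a); last by rewrite subrK.
  by rewrite (le_trans (ler_normD _ _))//; nra.
have -> : expR a * cos b - 1 - a =
   (expR a - 1 - a) * cos b + (cos b - 1) + a * (cos b - 1) by ring.
have -> : expR a * sin b - 0 - b = (expR a - 1) * sin b + (sin b - b) by ring.
have F1 : `|(expR a - 1 - a) * cos b| <= e1 * `|a|.
  by rewrite normrM (le_trans (ler_wpM2l (normr_ge0 _) c1))// mulr1.
have F2 : `|a * (cos b - 1)| <= e1 * `|b|.
  by rewrite normrM -[leRHS]mul1r ler_pM// (le_trans a4).
have F3 : `|(expR a - 1) * sin b| <= 4 * e1 * `|b|.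
  rewrite normrM (le_trans (ler_pM _ _ E1 s1))//.
  rewrite [leLHS](_ : _ = 4 * `|a| * `|b|); last by ring.
  by rewrite ler_wpM2r// ler_wpM2l.
have G1 := ler_normD ((expR a - 1 - a) * cos b + (cos b - 1)) (a * (cos b - 1)).
have G2 := ler_normD ((expR a - 1 - a) * cos b) (cos b - 1).
have G3 := ler_normD ((expR a - 1) * sin b) (sin b - b).
have : 8 * e1 * (`|a| + `|b|) <= e * (`|a| + `|b|).
  by rewrite ler_wpM2r// addr_ge0.
have : 0 <= e1 * `|a| by rewrite mulr_ge0// ltW.
have : 0 <= e1 * `|b| by rewrite mulr_ge0// ltW.
lra.
Qed.

(** The errors are measured with the real-valued modulus, to be compared
with the real estimates of [closed_form_at]. *)
Definition cdiff (g : R[i] -> R[i]) (z : R[i]) := exists L : R[i],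
  forall e, 0 < e -> exists2 d, 0 < d & forall h, cmod h <= d ->
    cmod (g (z + h) - g z - L * h) <= e * cmod h.

(** [z0 e^{(sigma + i tau) s + it}]: for [s = 0] and [s = 1] two circles,
through [z0] and through [z0 e^{sigma + i tau}]; a rectangle in [(s, t)] covers
the annulus between them. *)
Definition spiral (z0 : R[i]) (sigma tau s t : R) : R[i] :=
  z0 * polar (expR (sigma * s)) (tau * s + t).

Lemma spiral_approx z0 sigma tau s t e : 0 < e ->
  let w := spiral z0 sigma tau in
  exists2 d, 0 < d & forall ds dt, `|ds| <= d -> `|dt| <= d ->
    cmod (w (s + ds) (t + dt) - w s t -
      w s t * ((sigma * ds) +i* (tau * ds + dt))) <= e * (`|ds| + `|dt|).
Proof.
move=> e0 w; set w0 := w s t.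
pose K := `|sigma| + `|tau| + 1.
have K0 : 0 < K by rewrite /K ltr_wpDl// addr_ge0.
have W0 : 0 < cmod w0 + 1 by rewrite ltr_wpDl// cmod_ge0.
(* The factor [cmod w0 + 1] and not [cmod w0], which may vanish. *)
pose e2 := e / ((cmod w0 + 1) * (2 * K)).
have e20 : 0 < e2 by rewrite /e2 divr_gt0// !mulr_gt0.
have [d2 d20 H2] := polar_approx e20.
exists (d2 / (2 * K)); first by rewrite divr_gt0// mulr_gt0.
move=> ds dt; rewrite !ler_pdivlMr ?mulr_gt0// => sd td.
pose a := sigma * ds; pose b := tau * ds + dt.
have S0 := normr_ge0 ds; have T0 := normr_ge0 dt.
have aK : `|a| <= K * (`|ds| + `|dt|).
  rewrite normrM /K; have := normr_ge0 sigma; have := normr_ge0 tau; nra.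
have bK : `|b| <= K * (`|ds| + `|dt|).
  rewrite (le_trans (ler_normD _ _))// normrM /K.
  have := normr_ge0 sigma; have := normr_ge0 tau; nra.
have {H2} := H2 a b ltac:(lra) ltac:(lra) => H2.
have -> : w (s + ds) (t + dt) = w0 * polar (expR a) b.
  rewrite /w0 /w /spiral -mulrA polarM -expRD /a /b.
  by congr (_ * polar (expR _) _); ring.
have -> : w0 * polar (expR a) b - w0 - w0 * (a +i* b) =
  w0 * (polar (expR a) b - 1 - (a +i* b)) by ring.
rewrite cmodM (le_trans (ler_pM _ _ (_ : _ <= cmod w0 + 1) H2))//.
- exact: cmod_ge0.
- exact: cmod_ge0.
- by rewrite lerDl.
apply: (@le_trans _ _ ((cmod w0 + 1) * (e2 * (2 * K * (`|ds| + `|dt|))))).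
  by rewrite ler_pM2l// ler_pM2l//; lra.
rewrite /e2 le_eqVlt; apply/orP; left; apply/eqP.
by field; rewrite !gt_eqF.
Qed.

(** The chain rule for [g] along a spiral. *)
Lemma cdiff_spiral g z0 sigma tau s t :
  let w := spiral z0 sigma tau in
  cdiff g (w s t) -> exists L, forall e, 0 < e ->
  exists2 d, 0 < d & forall ds dt, `|ds| <= d -> `|dt| <= d ->
    cmod (g (w (s + ds) (t + dt)) - g (w s t) -
      L * ((sigma * ds) +i* (tau * ds + dt))) <= e * (`|ds| + `|dt|).
Proof.
move=> w [L HL]; set w0 := w s t; exists (L * w0) => e e0.
pose K := cmod w0 * (`|sigma| + `|tau| + 1) + 1.
have K0 : 0 < K by rewrite /K ltr_wpDl// mulr_ge0 ?cmod_ge0// !addr_ge0.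
have L0 : 0 <= cmod L := cmod_ge0 L.
have L1 : 0 < cmod L + 1 by rewrite ltr_wpDl.
have e10 : 0 < e / (2 * K) by rewrite divr_gt0// mulr_gt0.
have [d1 d10 H1] := HL _ e10.
have e20 : 0 < Num.min 1 (e / (2 * (cmod L + 1))).
  by rewrite lt_min ltr01 divr_gt0// mulr_gt0.
have [d2 d20 H2] := @spiral_approx z0 sigma tau s t _ e20.
exists (Num.min d2 (d1 / (2 * K))).
  by rewrite lt_min d20 divr_gt0// mulr_gt0.
move=> ds dt; rewrite !le_min => /andP[sd2 sd1] /andP[td2 td1].
have {H2} := H2 ds dt sd2 td2; rewrite -/w -/w0.
set h := w (s + ds) (t + dt) - w0; set l := (sigma * ds) +i* _ => H2.
pose N := `|ds| + `|dt|; rewrite -/N in H2 *.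
have N0 : 0 <= N by rewrite /N addr_ge0.
have lN : cmod l <= (`|sigma| + `|tau| + 1) * N.
  rewrite (le_trans (cmod_le _))//= /N.
  have := ler_normD (tau * ds) dt; rewrite !normrM.
  have := normr_ge0 sigma; have := normr_ge0 tau.
  have := normr_ge0 ds; have := normr_ge0 dt; nra.
have lN' : cmod (w0 * l) <= cmod w0 * ((`|sigma| + `|tau| + 1) * N).
  by rewrite cmodM ler_wpM2l// cmod_ge0.
have m1 : Num.min 1 (e / (2 * (cmod L + 1))) * N <= 1 * N.
  by rewrite ler_wpM2r// ge_min lexx.
have m2 : (2 * (cmod L + 1)) * (Num.min 1 (e / (2 * (cmod L + 1))) * N) <= e * N.
  rewrite mulrA ler_wpM2r// mulrC -ler_pdivlMr ?mulr_gt0//.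
  by rewrite ge_min lexx orbT.
set mn := Num.min 1 _ * N in m1 m2 H2.
have hN : cmod h <= K * N.
  rewrite (_ : h = (h - w0 * l) + w0 * l); last by rewrite subrK.
  by rewrite (le_trans (cmodD _ _))// /K mulrDl mul1r -mulrA; lra.
have hd : cmod h <= d1.
  apply: (le_trans hN); rewrite ler_pdivlMr ?mulr_gt0// in sd1.
  rewrite ler_pdivlMr ?mulr_gt0// in td1.
  by rewrite /N; lra.
have {H1} := H1 h hd; rewrite {1}/h (addrC w0) subrK => H1.
rewrite (_ : _ - _ = (g (w (s + ds) (t + dt)) - g w0 - L * h) + L * (h - w0 * l));
  last by ring.
rewrite (le_trans (cmodD _ _))// cmodM.
have A1 : e / (2 * K) * cmod h <= e / 2 * N.
  rewrite (le_trans (ler_wpM2l (ltW e10) hN))//.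
  by rewrite (_ : _ / _ * _ = e / 2 * N)//; field; rewrite gt_eqF.
have A2 : cmod L * cmod (h - w0 * l) <= e / 2 * N.
  rewrite (le_trans (ler_wpM2l L0 H2))//.
  have mn0 : 0 <= mn by apply: le_trans H2; exact: cmod_ge0.
  nra.
lra.
Qed.

(** Along a spiral [dz / (i z) = (tau - i sigma) ds + dt], and the form below
is [Re (g dz / (i z))]; its cross derivatives agree by the Cauchy-Riemann
equations. *)
Lemma closed_form_spiral g z0 sigma tau s t :
  let w := spiral z0 sigma tau in
  cdiff g (w s t) ->
  closed_form_at
    (fun s t => tau * complex.Re (g (w s t)) + sigma * complex.Im (g (w s t)))
    (fun s t => complex.Re (g (w s t))) s t.
Proof.
move=> w /cdiff_spiral[[A B] HL].
exists (tau * (A * sigma - B * tau) + sigma * (B * sigma + A * tau)).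
exists (A * sigma - B * tau), (- B) => e e0.
pose K := `|sigma| + `|tau| + 1.
have K0 : 0 < K by rewrite /K ltr_wpDl// addr_ge0.
have [d d0 H] := HL (e / K) (divr_gt0 e0 K0).
exists d => // s' t' sd td.
have := H _ _ sd td; rewrite (addrC s) subrK (addrC t) subrK -/w.
set ds := s' - s; set dt := t' - t.
case: (g (w s' t')) => u' v'; case: (g (w s t)) => u v /=.
set r := _ - _; rewrite mulrAC => {}H.
have H' : K * cmod r <= e * (`|ds| + `|dt|).
  by rewrite mulrC -ler_pdivlMr.
have r1 : u' - (u + (A * sigma - B * tau) * ds + - B * dt) = complex.Re r.
  by rewrite /r; simpc => /=; ring.
have r2 : v' - (v + (B * sigma + A * tau) * ds + A * dt) = complex.Im r.
  by rewrite /r; simpc => /=; ring.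
have R1 := ler_Re_cmod r; have R2 := ler_Im_cmod r; have R0 := cmod_ge0 r.
have S0 := normr_ge0 sigma; have T0 := normr_ge0 tau.
split.
  rewrite (_ : _ - _ = tau * complex.Re r + sigma * complex.Im r); last first.
    by rewrite -r1 -r2; ring.
  rewrite (le_trans (ler_normD _ _))// (le_trans _ H')// !normrM /K.
  have := normr_ge0 (complex.Re r); have := normr_ge0 (complex.Im r); nra.
by rewrite r1 (le_trans _ H')// /K; nra.
Qed.

Lemma spiral_2pi z0 sigma tau s t :
  spiral z0 sigma tau s (t + pi *+ 2) = spiral z0 sigma tau s t.
Proof. by rewrite /spiral /polar addrA cosD2pi sinD2pi. Qed.

(** Goursat's theorem on the annulus, cut open along a spiral: the two cuts
cancel by periodicity, so the circle mean of [Re g] does not change. *)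
Lemma circle_mean_spiral g z0 sigma tau :
  (forall s t, 0 <= s <= 1 -> cdiff g (spiral z0 sigma tau s t)) ->
  itg 0 (pi *+ 2) (fun t => complex.Re (g (spiral z0 sigma tau 1 t))) =
  itg 0 (pi *+ 2) (fun t => complex.Re (g (spiral z0 sigma tau 0 t))).
Proof.
move=> dg.
pose P s t := tau * complex.Re (g (spiral z0 sigma tau s t)) +
  sigma * complex.Im (g (spiral z0 sigma tau s t)).
(* The two components of [Re (g dz / (i z))]. *)
pose Q s t := complex.Re (g (spiral z0 sigma tau s t)).
have cl s t : 0 <= s <= 1 -> 0 <= t <= pi *+ 2 -> closed_form_at P Q s t.
  by move=> s01 _; apply: closed_form_spiral; exact: dg.
have pi2 : 0 <= pi *+ 2 :> R by rewrite mulrn_wge0// pi_ge0.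
have := goursat cl ler01 pi2.
rewrite (circE cl); last by split => //; split.
rewrite (_ : P^~ (pi *+ 2) = P^~ 0); last first.
  by apply/funext => s; rewrite /P -[pi *+ 2]add0r !spiral_2pi.
by rewrite subrr add0r => /eqP; rewrite subr_eq0 => /eqP.
Qed.
End polar.

End Approx.

(** * Continuous functions are measurable for the product of the Borel sigma-algebras *)

Section ContinuousMeasurable.
Variable R : realType.
Local Notation mR := (measurableTypeR R).

Lemma measurable_countable_comp d (T : measurableType d) (C : countType)
    (k : T -> C) (F : C -> R) :
  (forall c, measurable (k @^-1` [set c])) -> measurable_fun setT (F \o k).
Proof.
move=> mk _ B mB; rewrite setTI.
rewrite (_ : _ @^-1` _ = \bigcup_c (if F c \in B then k @^-1` [set c] else set0)).
  apply: countable_bigcupT_measurable => [|c]; first exact: countableP.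
  by case: ifPn.
apply/seteqP; split => [x Bx|x [c _]] /=.
  by exists (k x) => //; rewrite mem_set.
by case: ifPn => // /set_mem Bc ->.
Qed.

Definition grid (n : nat) (x : R) : R := (Num.floor (n.+1%:R * x))%:~R / n.+1%:R.

Lemma grid_near n x : `|grid n x - x| <= n.+1%:R^-1.
Proof.
have n0 : 0 < n.+1%:R :> R by rewrite ltr0n.
rewrite -(ler_pM2r n0) -[X in _ * X](gtr0_norm n0) -normrM mulrBl mulVf ?gt_eqF//.
rewrite /grid divfK ?gt_eqF// ler_norml.
have /andP[h1 h2] := floor_itv (n.+1%:R * x).
by rewrite (mulrC x); rewrite intrD in h2; lra.
Qed.

Lemma grid_cvg x : (grid n x) @[n --> \oo] --> x.
Proof.
apply/cvgrPdist_lt => e e0; near=> n.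
rewrite distrC (le_lt_trans (grid_near _ _))//; near: n.
exact: near_infty_natSinv_lt (PosNum e0).
Unshelve. all: by end_near. Qed.

Lemma measurable_grid_fiber d (T : measurableType d) n (f : T -> R) (k : int) :
  measurable_fun setT f -> measurable [set x | Num.floor (n.+1%:R * f x) = k].
Proof.
move=> mf.
rewrite (_ : [set _ | _] = (fun x => n.+1%:R * f x) @^-1` `[k%:~R, (k + 1)%:~R[%classic).
  rewrite -[X in measurable X]setTI; have : measurable_fun setT (fun x => n.+1%:R * f x).
    exact: measurable_funM.
  by apply => //; exact: measurable_itv.
apply/seteqP; split => x /=; rewrite in_itv/=.
  by move=> <-; exact: floor_itv.
exact: floor_def.
Qed.

(** The sigma-algebra of the product is not by definition generated by the
open sets, so a continuous function is reached as the pointwise limit of its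
compositions with the roundings to finer and finer grids. *)
Lemma continuous_measurable4 (f : R4 R -> R) : continuous f ->
  measurable_fun setT (f : mR4 R -> R).
Proof.
move=> cf.
pose q n (x : R4 R) : R4 R :=
  ((grid n x.1.1, grid n x.1.2), (grid n x.2.1, grid n x.2.2)).
apply: (@measurable_fun_cvg _ _ _ _ (fun n => f \o q n)).
  move=> n.
  pose fl x := Num.floor (n.+1%:R * x : R).
  pose k (x : mR4 R) := ((fl x.1.1, fl x.1.2), (fl x.2.1, fl x.2.2)).
  pose g (i : int) : R := i%:~R / n.+1%:R.
  have -> : f \o q n = (fun i : (int * int) * (int * int) =>
    f ((g i.1.1, g i.1.2), (g i.2.1, g i.2.2))) \o k by [].
  apply: measurable_countable_comp => -[[i1 i2] [i3 i4]].
  rewrite (_ : _ @^-1` _ =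
    ([set x : mR4 R | fl x.1.1 = i1] `&` [set x : mR4 R | fl x.1.2 = i2]) `&`
    ([set x : mR4 R | fl x.2.1 = i3] `&` [set x : mR4 R | fl x.2.2 = i4])); last first.
    apply/seteqP; split => x /=; rewrite /k; first by move=> [<- <- <- <-].
    by move=> [[<- <-] [<- <-]].
  by apply: measurableI; apply: measurableI; apply: measurable_grid_fiber;
    do 2?[apply: measurableT_comp => //].
move=> x _; have qx : q n x @[n --> \oo] --> x.
  case: x => -[a b] [c d].
  exact (cvg_pair (cvg_pair (@grid_cvg a) (@grid_cvg b))
    (cvg_pair (@grid_cvg c) (@grid_cvg d))).
exact: cvg_comp qx (cf x).
Qed.

Lemma continuous_measurable2 (f : R * R -> R) : continuous f ->
  measurable_fun setT (f : mR * mR -> R).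
Proof.
move=> cf.
have : measurable_fun setT ((fun x => f x.1) : mR4 R -> R).
  by apply: continuous_measurable4 => x; apply: (continuous_comp (f := fst) (g := f)); [exact: cvg_fst|exact: cf].
move=> mf; have : measurable_fun setT (fun y : mR * mR => (y, y) : mR4 R).
  exact: measurable_fun_pair.
exact: (measurableT_comp mf).
Qed.

End ContinuousMeasurable.

(** * Exchanging two integrals of a continuous function *)

Section Swap.
Variable R : realType.
Local Notation la := (@lebesgue_measure R).
Local Notation mR := (measurableTypeR R).

(** The indicator turns the integral over a segment into one over the line,
where Fubini's theorem applies. *)
Lemma itgE a b (f : R -> R) :
  itg a b f = fine (\int[la]_t ((\1_(`[a, b]%classic : set mR) t * f t)%:E))%E.
Proof.
rewrite /itg /Rintegral integral_mkcond; congr fine; apply: eq_integral => t _.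
by rewrite patchE /= indicE; case: ifPn => tI; rewrite ?mul1r ?mul0r.
Qed.

Lemma cont_itg_fin a b (f : R -> R) : cont_on a b f ->
  (\int[la]_t ((\1_(`[a, b]%classic : set mR) t * f t)%:E))%E \is a fin_num.
Proof.
move=> cf; have := integrable_fin_num _ (cont_on_integrable cf).
move=> /(_ (measurable_itv _)).
rewrite integral_mkcond; congr (_ \is a fin_num); apply: eq_integral => t _.
by rewrite patchE /= indicE; case: ifPn => tI; rewrite ?mul1r ?mul0r.
Qed.

Section double_integral.
Variables (a b c d : R) (f : R -> R -> R).
Hypothesis cf : continuous (fun p : R * R => f p.1 p.2).

Let c2 s : continuous (f s).
Proof.
move=> t; apply: (continuous_comp (f := pair s) (g := fun p => f p.1 p.2)); last exact: cf.
exact: (cvg_pair (cvg_cst _) cvg_id).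
Qed.

Let c1 t : continuous (f^~ t).
Proof.
move=> s; apply: (continuous_comp (f := pair^~ t) (g := fun p => f p.1 p.2)); last exact: cf.
exact: (cvg_pair cvg_id (cvg_cst _)).
Qed.

Let A : set mR := `[a, b]%classic.
Let B : set mR := `[c, d]%classic.

Let mA : measurable A. Proof. exact: measurable_itv. Qed.
Let mB : measurable B. Proof. exact: measurable_itv. Qed.

Let F (p : mR * mR) : \bar R := (\1_A p.1 * \1_B p.2 * f p.1 p.2)%:E.

Let iF : (la \x la)%E.-integrable setT F.
Proof.
have mf := continuous_measurable2 cf.
have mF : measurable_fun setT F.
  apply/measurable_EFinP; apply: measurable_funM => //.
  by apply: measurable_funM; exact: measurableT_comp.
have finI u v : (la (`[u, v]%classic : set mR) < +oo)%E.
  by rewrite [ltLHS](lebesgue_measure_itv `[u, v])/=; case: ifP => // _; rewrite -EFinB ltry.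
have [M HM] : exists M, forall p, p.1 \in A -> p.2 \in B -> `|f p.1 p.2| <= M.
  have kAB : compact (A `*` B : set (R * R)).
    by apply: compact_setX; exact: segment_compact.
  have : compact ((fun p : R * R => f p.1 p.2) @` (A `*` B)).
    by apply: continuous_compact => //; exact: continuous_subspaceT.
  move=> /compact_bounded [M [_ HM]]; exists (M + 1) => p /set_mem pA /set_mem pB.
  by apply: (HM (M + 1)); [rewrite ltrDl|exists p].
  apply/(integrable12ltyP _ _ mF).
  apply: (@le_lt_trans _ _ (\int[la]_x ((`|M|%:E * la B) * (\1_A x)%:E))%E).
    apply: ge0_le_integral => //.
    - by move=> x _; exact: integral_ge0.
    - apply: (measurable_fun_fubini_tonelli_F (abse \o F)) => //.
      - exact: measurableT_comp.
      - by move=> p; exact: abse_ge0.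
    - by apply: measurable_funeM; apply/measurable_EFinP; exact: measurable_indic.
    move=> x _; apply: (@le_trans _ _ (\int[la]_y ((`|M| * \1_A x)%:E * (\1_B y)%:E))%E).
      apply: ge0_le_integral => //.
      - by apply: measurableT_comp => //; apply: measurableT_comp => //.
      - by apply: measurable_funeM; apply/measurable_EFinP; exact: measurable_indic.
      move=> y _; rewrite /F /= lee_fin !indicE /=.
      have [xA|] := boolP (x \in A); have [yB|] := boolP (y \in B); rewrite ?(mulr0, mul0r, mulr1, mul1r) ?normr0//.
      by rewrite (le_trans (HM (x, y) xA yB))// ler_norm.
    rewrite ge0_integralZl//; last by apply/measurable_EFinP; exact: measurable_indic.
    by rewrite integral_indic// setIT EFinM -!muleA (muleC (la B)).
  rewrite ge0_integralZl//; last 2 first.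
  - by apply/measurable_EFinP; exact: measurable_indic.
  - by rewrite mule_ge0.
  rewrite integral_indic// setIT lte_mul_pinfty ?mule_ge0//; last exact: finI.
  by rewrite fin_numM// ge0_fin_numE//; exact: finI.
Qed.

Let E1 x : (\int[la]_y F (x, y))%E = (\1_A x * itg c d (f x))%:E.
Proof.
rewrite itgE EFinM fineK; last by apply: cont_itg_fin => ? _; exact: c2.
rewrite -integralZl//; last first.
  rewrite (_ : (fun _ => _) = (EFin \o f x) \_ B); last first.
    by apply/funext => y; rewrite patchE indicE; case: ifPn => _ /=; rewrite ?mul1r ?mul0r.
  apply/integrable_restrict => //; rewrite setTI.
  by apply: cont_on_integrable => ? _; exact: c2.
by apply: eq_integral => y _; rewrite /F /= -EFinM mulrA.
Qed.

Let E2 y : (\int[la]_x F (x, y))%E = (\1_B y * itg a b (f^~ y))%:E.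
Proof.
rewrite itgE EFinM fineK; last by apply: cont_itg_fin => ? _; exact: c1.
rewrite -integralZl//; last first.
  rewrite (_ : (fun _ => _) = (EFin \o (f^~ y)) \_ A); last first.
    by apply/funext => x; rewrite patchE indicE; case: ifPn => _ /=; rewrite ?mul1r ?mul0r.
  apply/integrable_restrict => //; rewrite setTI.
  by apply: cont_on_integrable => ? _; exact: c1.
by apply: eq_integral => x _; rewrite /F /= -EFinM mulrCA mulrA.
Qed.

Lemma itg_swap :
  itg a b (fun s => itg c d (f s)) = itg c d (fun t => itg a b (f^~ t)).
Proof.
have := Fubini iF.
under eq_integral do rewrite E1.
under [X in _ = X]eq_integral do rewrite E2.
by move=> /(congr1 fine); rewrite -!itgE.
Qed.

Lemma integrable_itg_inner :
  la.-integrable `[a, b] (fun s => (itg c d (f s))%:E).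
Proof.
have iFF := integrable_fubini_F iF.
apply: (eq_integrable _ (fubini_F la F)) => //; last exact: integrableS iFF.
by move=> x xA; rewrite /fubini_F E1 indicE xA mul1r.
Qed.

Lemma itgZ2 (k : R) : itg a b (fun s => itg c d (fun t => k * f s t)) =
  k * itg a b (fun s => itg c d (f s)).
Proof.
rewrite -RintegralZl//; last exact: integrable_itg_inner.
apply: eq_Rintegral => s _; rewrite -RintegralZl//.
by apply: cont_on_integrable => t _; exact: c2.
Qed.

End double_integral.

End Swap.

(** * Torus means *)

(** A copy of [dV] declared as a sigma-finite measure, for type inference. *)
Definition dVs (R : realType) : set (mR4 R) -> \bar R := (@dA R \x @dA R)%E.
HB.instance Definition _ (R : realType) := Measure.on (@dVs R).

Lemma dVs_sigma_finite (R : realType) : sigma_finite setT (@dVs R).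
Proof.
have /sigma_finiteP[F [TF ndF Foo]] := sigma_finiteT (@dA R).
exists (fun n => F n `*` F n).
  rewrite -setXTT TF predeqE => -[x y]; split.
    move=> [/= [n _ Fnx] [k _ Gky]]; exists (maxn n k) => //; split.
    - by move: x Fnx; exact/subsetPset/ndF/leq_maxl.
    - by move: y Gky; exact/subsetPset/ndF/leq_maxr.
  by move=> [n _ []/= ? ?]; split; exists n.
move=> k; have [? ?] := Foo k.
split; first exact: measurableX.
by rewrite /dVs [ltLHS](product_measure1E (@dA R) (@dA R))// lte_mul_pinfty// ge0_fin_numE.
Qed.
HB.instance Definition _ (R : realType) :=
  Measure_isSigmaFinite.Build _ _ _ (@dVs R) (@dVs_sigma_finite R).

Section TorusMean.
Variable R : realType.
Variable gamma : R.
Hypothesis gamma_gt0 : 0 < gamma.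
Local Notation H := (Hgamma gamma).
Implicit Types (z w : R[i]) (t : R).

Definition torus (t1 t2 : R) (z : C2 R) : C2 R :=
  (polar 1 t1 * z.1, polar 1 t2 * z.2).

Lemma cmod_rot t z : cmod (polar 1 t * z) = cmod z.
Proof. by rewrite cmodM cmod_polar normr1 mul1r. Qed.

Lemma Hgamma_torus t1 t2 (z : C2 R) : H (torus t1 t2 z) <-> H z.
Proof. by rewrite /Hgamma/= !cmod_rot. Qed.

Lemma powR_mono (a b : R) : 0 <= a -> a <= b -> a `^ gamma <= b `^ gamma.
Proof.
move=> a0 ab; apply: ge0_ler_powR => //; rewrite ?nnegrE//.
  exact: ltW.
exact: le_trans a0 ab.
Qed.

Lemma Hgamma_le1 z1 w1 z2 : cmod w1 <= cmod z1 -> H (z1, z2) -> H (w1, z2).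
Proof.
move=> wz [/= h1 h2]; split => //=; apply: le_lt_trans h1.
by apply: powR_mono => //; exact: cmod_ge0.
Qed.

(** For a fixed [z1] the domain is an annulus in [z2]. *)
Lemma Hgamma_between z1 z2 z2' (r : R[i]) : H (z1, z2) -> H (z1, z2') ->
  Num.min (cmod z2) (cmod z2') <= cmod r <= Num.max (cmod z2) (cmod z2') ->
  H (z1, r).
Proof.
move=> [/= h1 h2] [/= h1' h2'] /andP[r1 r2]; split => /=.
  by apply: lt_le_trans r1; rewrite lt_min h1 h1'.
by apply: le_lt_trans r2 _; rewrite gt_max h2 h2'.
Qed.

Lemma cmod_spiral (z : R[i]) (sigma tau s t : R) :
  cmod (spiral z sigma tau s t) = cmod z * expR (sigma * s).
Proof. by rewrite /spiral cmodM cmod_polar ger0_norm ?expR_ge0. Qed.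

(** The modulus is monotone along a spiral, which therefore stays in the
annulus between its end circles. *)
Lemma spiral_between z w sigma tau s t : w = z * polar (expR sigma) tau ->
  0 <= s <= 1 ->
  Num.min (cmod z) (cmod w) <= cmod (spiral z sigma tau s t)
    <= Num.max (cmod z) (cmod w).
Proof.
move=> -> /andP[s0 s1]; rewrite cmod_spiral cmodM cmod_polar ger0_norm ?expR_ge0//.
have z0 := cmod_ge0 z; rewrite ge_min le_max.
have [sg|/ltW sg] := leP 0 sigma.
  have e1 : 1 <= expR (sigma * s) by rewrite -expR0 ler_expR mulr_ge0.
  have e2 : expR (sigma * s) <= expR sigma by rewrite ler_expR ler_piMr.
  by rewrite ler_peMr//= (ler_wpM2l z0 e2) orbT.
have e1 : expR (sigma * s) <= 1 by rewrite -expR0 ler_expR mulr_le0_ge0.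
have e2 : expR sigma <= expR (sigma * s) by rewrite ler_expR ler_niMr.
by rewrite (ler_wpM2l z0 e2) orbT/= ler_piMr.
Qed.

Lemma spiral0 z sigma tau t : spiral z sigma tau 0 t = polar 1 t * z.
Proof. by rewrite /spiral !mulr0 expR0 add0r mulrC. Qed.

Lemma spiral1 z sigma tau t :
  spiral z sigma tau 1 t = polar 1 t * (z * polar (expR sigma) tau).
Proof. by rewrite mulrCA polarM mul1r /spiral !mulr1 (addrC t). Qed.

Lemma polar_ratio z w : z != 0 -> w != 0 ->
  exists sigma tau, w = z * polar (expR sigma) tau.
Proof.
move=> z0 w0; have [|s [t e]] := @polar_repr R (w / z); first by rewrite mulf_neq0// invr_eq0.
by exists s, t; rewrite -e mulrCA mulfV// mulr1.
Qed.

Variable G : C2 R -> R[i].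
Hypothesis G1 : forall z : C2 R, H z -> z.1 != 0 -> cdiff (fun w => G (w, z.2)) z.1.
Hypothesis G2 : forall z : C2 R, H z -> z.1 != 0 -> cdiff (fun w => G (z.1, w)) z.2.
Hypothesis Gc : forall z : C2 R, H z -> z.1 != 0 ->
  forall e, 0 < e -> exists2 d, 0 < d & forall z' : C2 R,
    cmod (z'.1 - z.1) <= d -> cmod (z'.2 - z.2) <= d -> cmod (G z' - G z) <= e.

Definition torus_mean (z : C2 R) : R :=
  itg 0 (pi *+ 2) (fun t1 => itg 0 (pi *+ 2) (fun t2 =>
    complex.Re (G (torus t1 t2 z)))).

Lemma Hgamma_neq0 (z : C2 R) : H z -> z.2 != 0.
Proof.
by move=> [h1 h2]; rewrite -cmod_gt0; apply: le_lt_trans h1; exact: powR_ge0.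
Qed.

(** Cauchy's theorem on an annulus, in the form of the mean value over its
circles. *)
Lemma circle_mean_cst (g : R[i] -> R[i]) z w : z != 0 -> w != 0 ->
  (forall r, Num.min (cmod z) (cmod w) <= cmod r <= Num.max (cmod z) (cmod w) ->
    cdiff g r) ->
  itg 0 (pi *+ 2) (fun t => complex.Re (g (polar 1 t * z))) =
  itg 0 (pi *+ 2) (fun t => complex.Re (g (polar 1 t * w))).
Proof.
move=> z0 w0 gd; have [s [t wE]] := polar_ratio z0 w0.
have := @circle_mean_spiral R g z s t.
have -> : (fun u => complex.Re (g (spiral z s t 1 u))) =
    (fun u => complex.Re (g (polar 1 u * w))).
  by apply/funext => u; rewrite spiral1 -wE.
have -> : (fun u => complex.Re (g (spiral z s t 0 u))) =
    (fun u => complex.Re (g (polar 1 u * z))).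
  by apply/funext => u; rewrite spiral0.
move=> -> // u v u01; apply: gd; exact: spiral_between wE u01.
Qed.

Lemma torus_mean2 z1 z2 z2' : z1 != 0 -> H (z1, z2) -> H (z1, z2') ->
  torus_mean (z1, z2) = torus_mean (z1, z2').
Proof.
move=> z10 h h'; congr itg; apply/funext => t1.
apply: (circle_mean_cst (g := fun w => G (polar 1 t1 * z1, w))).
- exact: (Hgamma_neq0 h).
- exact: (Hgamma_neq0 h').
move=> r hr; apply: (G2 (z := (polar 1 t1 * z1, r))) => /=.
  have := Hgamma_between h h' hr; rewrite /Hgamma /=.
  by rewrite cmod_rot.
by rewrite mulf_neq0// polar_neq0// oner_eq0.
Qed.

Lemma polar_cont : exists2 d : R, 0 < d &
  forall t t', `|t' - t| <= d -> cmod (polar 1 t' - polar 1 t) <= 2 * `|t' - t|.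
Proof.
have [d d0 dP] := polar_approx (ltr01 : 0 < (1 : R)).
exists d => // t t' td.
have -> : polar 1 t' - polar 1 t = polar 1 t * (polar 1 (t' - t) - 1).
  by rewrite mulrBr mulr1 polarM mulr1 (addrC t) subrK.
rewrite cmod_rot; have := dP 0 (t' - t); rewrite normr0 (ltW d0) => /(_ isT td).
rewrite expR0 add0r mul1r; set u := polar _ _ - 1; set b := (t' - t) in td *.
move=> ub; have -> : u = (u - Complex 0 b) + Complex 0 b by rewrite subrK.
rewrite (le_trans (cmodD _ _))// mulr2n mulrDl mul1r lerD//.
by rewrite (le_trans (cmod_le _))//= normr0 add0r.
Qed.

Lemma torus_cont (z : C2 R) : H z -> z.1 != 0 ->
  continuous (fun p : R * R => complex.Re (G (torus p.1 p.2 z))).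
Proof.
move=> hz z10 [u v].
have [d d0 dP] := polar_cont.
have hz' : H (torus u v z) by apply/Hgamma_torus.
have z10' : (torus u v z).1 != 0 by rewrite /= mulf_neq0// polar_neq0// oner_eq0.
apply/cvgrPdist_le => e e0; have [r r0 rP] := Gc hz' z10' e0.
have near0 (c : R[i]) : exists2 k : R, 0 < k & forall t t', `|t' - t| < k ->
    cmod (polar 1 t' * c - polar 1 t * c) <= r.
  have c0 : 0 < cmod c + 1 by rewrite ltr_wpDl// cmod_ge0.
  exists (Num.min d (r / (2 * (cmod c + 1)))).
    by rewrite lt_min d0 divr_gt0// mulr_gt0.
  move=> t t'; rewrite lt_min => /andP[/ltW h1].
  rewrite ltr_pdivlMr ?mulr_gt0// => /ltW h2.
  rewrite -mulrBl cmodM (le_trans (ler_wpM2r (cmod_ge0 c) (dP _ _ h1)))//.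
  have := normr_ge0 (t' - t); have := cmod_ge0 c; nra.
have [k1 k10 K1] := near0 z.1; have [k2 k20 K2] := near0 z.2.
near=> p; rewrite distrC; apply: (@le_trans _ _ (cmod (G (torus p.1 p.2 z) - G (torus u v z)))).
  by rewrite (le_trans _ (ler_Re_cmod _))//; case: (G _) => ? ?; case: (G _).
apply: rP; [apply: K1|apply: K2].
- rewrite distrC; near: p.
  have cf : x.1 @[x --> (u, v)] --> u by exact: cvg_fst.
  by have /cvgrPdist_lt/(_ _ k10) := cf.
- rewrite distrC; near: p.
  have cf : x.2 @[x --> (u, v)] --> v by exact: cvg_snd.
  by have /cvgrPdist_lt/(_ _ k20) := cf.
Unshelve. all: by end_near. Qed.

(** Same argument in the first coordinate, after exchanging the two
integrals. For a fixed [z2] the domain is a punctured disc in [z1], as points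
with [z1 = 0] are avoided. *)
Lemma torus_mean1 z1 z1' z2 : z1 != 0 -> z1' != 0 -> H (z1, z2) -> H (z1', z2) ->
  torus_mean (z1, z2) = torus_mean (z1', z2).
Proof.
move=> z10 z10' h h'.
apply: (etrans (itg_swap 0 (pi *+ 2) 0 (pi *+ 2) (torus_cont h z10))).
apply/esym; apply: (etrans (itg_swap 0 (pi *+ 2) 0 (pi *+ 2) (torus_cont h' z10'))).
apply/esym; congr itg; apply/funext => t2.
apply: (circle_mean_cst (g := fun w => G (w, polar 1 t2 * z2))) => //.
move=> r hr.
have hr2 : H (r, polar 1 t2 * z2).
  rewrite /Hgamma/= cmod_rot; case/andP: hr => _; rewrite le_max.
  by move=> /orP[hr|hr]; [have := Hgamma_le1 hr h|have := Hgamma_le1 hr h'].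
apply: (G1 hr2) => /=; case/andP: hr => + _; rewrite ge_min.
by rewrite -cmod_gt0 => /orP[|]; apply: lt_le_trans; rewrite cmod_gt0.
Qed.

(** Any two points of the domain off the axis [z1 = 0] are joined by moving
one coordinate at a time, provided that [z2] is moved while [|z1|] is the
smaller of the two moduli. *)
Lemma torus_mean_cst (z w : C2 R) : H z -> H w -> z.1 != 0 -> w.1 != 0 ->
  torus_mean z = torus_mean w.
Proof.
have gen (a b : C2 R) : H a -> H b -> a.1 != 0 -> b.1 != 0 ->
    cmod a.1 <= cmod b.1 -> torus_mean a = torus_mean b.
  case: a b => [a1 a2] [b1 b2] ha hb /= a0 b0 ab.
  (* The corner [(a1, b2)] is in the domain because [|a1| <= |b1|]. *)
  have hab : H (a1, b2) := Hgamma_le1 ab hb.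
  by rewrite (torus_mean2 a0 ha hab) (torus_mean1 a0 b0 hab hb).
move=> hz hw z0 w0; have [zw|/ltW wz] := leP (cmod z.1) (cmod w.1); first exact: gen.
by apply/esym/gen.
Qed.

Variable kappa : C2 R -> R.
Hypothesis kappa_torus : forall t1 t2 (z : C2 R), kappa (torus t1 t2 z) = kappa z.
Hypothesis kappa_supp : forall z : C2 R, kappa z != 0 -> H z /\ z.1 != 0.
Hypothesis kappa_int :
  (@dV R).-integrable setT (fun x => (kappa (toC2 x))%:E).
Hypothesis kappaG_int : (@dV R).-integrable setT
  (fun x => (kappa (toC2 x) * complex.Re (G (toC2 x)))%:E).

Lemma toC2_rot1 t (x : R4 R) : toC2 (rot1 t x) = torus t 0 (toC2 x).
Proof.
case: x => -[a b] [c d]; rewrite /toC2 /torus /rot1 /rot /= polar10 mul1r.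
congr pair; rewrite /polar !mul1r; simpc; congr Complex; ring.
Qed.

Lemma toC2_rot2 t (x : R4 R) : toC2 (rot2 t x) = torus 0 t (toC2 x).
Proof.
case: x => -[a b] [c d]; rewrite /toC2 /torus /rot2 /rot /= polar10 mul1r.
congr pair; rewrite /polar !mul1r; simpc; congr Complex; ring.
Qed.

Lemma torus_comp s1 s2 t1 t2 (z : C2 R) :
  torus s1 s2 (torus t1 t2 z) = torus (s1 + t1) (s2 + t2) z.
Proof. by rewrite /torus /= !mulrA !polarM mulr1. Qed.

(** Averaging over the rotations leaves [kappa] alone and replaces [Re G] by
its torus mean, which is constant. *)
Lemma integral_torus (z0 : C2 R) : H z0 -> z0.1 != 0 ->
  (\int[@dV R]_x (kappa (toC2 x) * complex.Re (G (toC2 x)))%:E *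
     ((pi *+ 2) ^+ 2)%:E =
   (torus_mean z0)%:E * \int[@dV R]_x (kappa (toC2 x))%:E)%E.
Proof.
move=> hz0 z00.
have p2 : 0 <= pi *+ 2 :> R by rewrite mulrn_wge0// pi_ge0.
have I2 := integrable_average (mu := @dVs R) (@measurable_rot2 R) (@preserves_rot2 R) p2 kappaG_int.
have := integral_average (mu := @dVs R) (@measurable_rot1 R) (@preserves_rot1 R) p2 I2.
rewrite (integral_average (mu := @dVs R) (@measurable_rot2 R) (@preserves_rot2 R) p2 kappaG_int).
rewrite subr0 muleA -EFinM -expr2 muleC => <-.
rewrite -integralZl//; apply: eq_integral => x _; rewrite -EFinM; congr _%:E.
set z := toC2 x.
transitivity (itg 0 (pi *+ 2) (fun t1 => itg 0 (pi *+ 2) (fun t2 =>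
    kappa z * complex.Re (G (torus t1 t2 z))))).
  congr itg; apply/funext => t1; congr itg; apply/funext => t2.
  by rewrite toC2_rot2 toC2_rot1 torus_comp addr0 add0r kappa_torus.
have [k0|k0] := eqVneq (kappa z) 0.
  rewrite k0 mulr0 -[RHS](mul0r (pi *+ 2 - 0)) -itg_cst//; congr itg.
  apply/funext => t1; rewrite -[RHS](mul0r (pi *+ 2 - 0)) -itg_cst//; congr itg.
  by apply/funext => t2; rewrite mul0r.
have [hz z10] := kappa_supp k0.
rewrite (itgZ2 _ _ _ _ (torus_cont hz z10)) mulrC; congr (_ * _).
exact: torus_mean_cst.
Qed.

Lemma integral_torus0 (z0 : C2 R) : H z0 -> z0.1 != 0 ->
  (\int[@dV R]_x (kappa (toC2 x))%:E = 0 ->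
   \int[@dV R]_x (kappa (toC2 x) * complex.Re (G (toC2 x)))%:E = 0)%E.
Proof.
move=> hz0 z00 k0; have := integral_torus hz0 z00.
rewrite k0 mule0 => /eqP; rewrite mule_eq0 => /orP[/eqP//|].
by rewrite eqe expf_eq0/= mulrn_eq0/= gt_eqF// pi_gt0.
Qed.

End TorusMean.

(** * Integration by parts *)

Section BoundedSupport.
Local Open Scope ereal_scope.

Lemma integrable_bounded_supp d (X : measurableType d) (R : realType)
    (mu : {measure set X -> \bar R}) (f : X -> R) (A : set X) (B : R) :
  measurable_fun setT f -> measurable A -> mu A < +oo ->
  (forall x, `|f x| <= B)%R -> (forall x, ~ A x -> f x = 0%R) ->
  mu.-integrable setT (EFin \o f).
Proof.
move=> mf mA Afin fB fA.
rewrite (_ : EFin \o f = (EFin \o f) \_ A); last first.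
  apply/funext => x; rewrite patchE; case: ifPn => //= xA.
  by rewrite fA//; move: xA; rewrite notin_setE.
apply/integrable_restrict => //; rewrite setTI.
apply: measurable_bounded_integrable => //; first exact: measurable_funTS.
exists B; split; first exact: num_real.
by move=> M BM x _ /=; rewrite (le_trans (fB x))// ltW.
Qed.

Section slices.
Context d1 d2 (X : measurableType d1) (Y : measurableType d2) (R : realType).
Variable m1 : {sigma_finite_measure set X -> \bar R}.
Variable m2 : {sigma_finite_measure set Y -> \bar R}.
Variables (f : X * Y -> R).
Hypothesis fi : (m1 \x m2).-integrable setT (EFin \o f).

Lemma integral_slice1_eq0 : (forall y, \int[m1]_x (f (x, y))%:E = 0) ->
  \int[m1 \x m2]_p (f p)%:E = 0.
Proof.
move=> f0; rewrite -(integral21_prod_meas1 fi) /fubini_G.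
by under eq_integral do rewrite f0; rewrite integral0.
Qed.

Lemma integral_slice2_eq0 : (forall x, \int[m2]_y (f (x, y))%:E = 0) ->
  \int[m1 \x m2]_p (f p)%:E = 0.
Proof.
move=> f0; rewrite -(integral12_prod_meas1 fi) /fubini_F.
by under eq_integral do rewrite f0; rewrite integral0.
Qed.
End slices.
End BoundedSupport.

Section IBP.
Variable R : realType.
Local Notation la := (@lebesgue_measure R).
Local Notation mR := (measurableTypeR R).

(** The fundamental theorem of calculus on an interval that contains the
support. *)
Lemma integral_derive_eq0 (g dg : R -> R) (M : R) :
  (forall t : R, is_derive t 1 g (dg t)) -> continuous dg ->
  (forall t, M < `|t| -> g t = 0) -> (forall t, M < `|t| -> dg t = 0) ->
  (\int[la]_t (dg t)%:E = 0)%E.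
Proof.
move=> dgE cdg g0 dg0; pose N : R := `|M| + 1.
pose I : set mR := `[- N, N]%classic.
have MN : M < N by rewrite (le_lt_trans (ler_norm M))// ltrDl.
have N0 : 0 < N by rewrite ltr_wpDl.
have NN : - N < N by rewrite gtrN.
have -> : (\int[la]_t (dg t)%:E = \int[la]_(t in I) (dg t)%:E)%E.
  rewrite [RHS]integral_mkcond; apply: eq_integral => t _; rewrite patchE.
  case: ifPn => //; rewrite notin_setE/I/= in_itv/= => /negP.
  rewrite -ler_norml -ltNge => Nt.
  by rewrite dg0// (lt_trans MN).
have gd t : derivable g t 1 by have [] := dgE t.
have gc : continuous g.
  by move=> t; apply: differentiable_continuous; apply/derivable1_diffP; exact: gd.
rewrite (continuous_FTC2 (F := g)) //.
- by rewrite !g0 ?subee// ?normrN gtr0_norm.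
- exact: continuous_subspaceT.
- split; first by move=> x _; exact: gd.
  + by apply: cvg_at_right_filter; exact: gc.
  + by apply: cvg_at_left_filter; exact: gc.
- by move=> t _; rewrite derive1E; have [_ ->] := dgE t.
Qed.

Definition box4 (M : R) : set (mR4 R) :=
  (`[- M, M]%classic `*` `[- M, M]%classic) `*` (`[- M, M]%classic `*` `[- M, M]%classic).

(** The line through [x] parallel to the [i]-th axis, parametrized by the
[i]-th coordinate, so that Fubini's theorem can be applied along it. *)
Definition line4 (i : 'I_4) (x : R4 R) (t : R) : R4 R :=
  match val i with
  | 0%N => ((t, x.1.2), x.2)
  | 1%N => ((x.1.1, t), x.2)
  | 2%N => (x.1, (t, x.2.2))
  | _ => (x.1, (x.2.1, t)) end.

Lemma line4D i x h t : line4 i x (h + t) = h *: e4 R i + line4 i x t.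
Proof.
case: x => -[a b] [c d]; case: i => -[|[|[|[|//]]]] i4;
  rewrite /line4 /e4 (tnth_nth 0) /=; congr pair; try congr pair => /=;
  by rewrite ?scaler0 ?add0r// [h%:A]mulr1.
Qed.

Lemma line4_derive (psi : R4 R -> R) i x t :
  derivable psi (line4 i x t) (e4 R i) ->
  is_derive t 1 (psi \o line4 i x) ('D_(e4 R i) psi (line4 i x t)).
Proof.
move=> dpsi.
have E : (fun h : R => h^-1 *: (((psi \o line4 i x) \o shift t) (h *: 1) - (psi \o line4 i x) t)) =
    (fun h : R => h^-1 *: ((psi \o shift (line4 i x t)) (h *: e4 R i) - psi (line4 i x t))).
  apply/funext => h /=; congr (_ *: (psi _ - _)).
  by rewrite -line4D; congr line4; rewrite [h *: 1]mulr1.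
by split; [rewrite /derivable E|rewrite /derive E].
Qed.

Lemma line4_cont i x : continuous (line4 i x).
Proof.
move=> t; case: x => -[a b] [c d]; rewrite /line4; case: i => -[|[|[|[|//]]]] i4 /=.
- exact: (cvg_pair (cvg_pair cvg_id (cvg_cst _)) (cvg_cst _)).
- exact: (cvg_pair (cvg_pair (cvg_cst _) cvg_id) (cvg_cst _)).
- exact: (cvg_pair (cvg_cst _) (cvg_pair cvg_id (cvg_cst _))).
- exact: (cvg_pair (cvg_cst _) (cvg_pair (cvg_cst _) cvg_id)).
Qed.

Lemma dA_itvX (a b c d : R) : a <= b -> c <= d ->
  (@dA R) ((`[a, b]%classic : set mR) `*` (`[c, d]%classic : set mR)) =
    ((b - a) * (d - c))%:E.
Proof.
have I (u v : R) : u <= v -> la (`[u, v]%classic : set mR) = (v - u)%:E.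
  move=> uv; rewrite [LHS](lebesgue_measure_itv `[u, v])/= lte_fin.
  case: ifPn => //; rewrite -leNgt => vu.
  by rewrite (le_anti (introT andP (conj uv vu))) subrr.
move=> ab cd; rewrite /dA.
by rewrite [LHS](product_measure1E la la) ?measurable_itv//= !I.
Qed.

Lemma dV_box (a1 b1 a2 b2 a3 b3 a4 b4 : R) :
  a1 <= b1 -> a2 <= b2 -> a3 <= b3 -> a4 <= b4 ->
  (@dV R) (((`[a1, b1]%classic : set mR) `*` (`[a2, b2]%classic : set mR)) `*`
    ((`[a3, b3]%classic : set mR) `*` (`[a4, b4]%classic : set mR))) =
    ((b1 - a1) * (b2 - a2) * ((b3 - a3) * (b4 - a4)))%:E.
Proof.
move=> h1 h2 h3 h4; rewrite /dV.
rewrite [LHS](product_measure1E (@dA R) (@dA R)); last 2 first.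
- by apply: measurableX; exact: measurable_itv.
- by apply: measurableX; exact: measurable_itv.
by rewrite [X in (X * _)%E](dA_itvX h1 h2) [X in (_ * X)%E](dA_itvX h3 h4).
Qed.

Lemma integrable_compact_supp (f : R4 R -> R) (K : set (R4 R)) :
  continuous f -> compact K -> (forall x, ~ K x -> f x = 0) ->
  (@dV R).-integrable setT (EFin \o f) /\
  exists M B, [/\ forall x, `|f x| <= B & forall x, M < `|x| -> f x = 0].
Proof.
move=> cf cK f0.
have [M MK] : exists M : R, forall x, K x -> `|x| <= M.
  have [M [_ HM]] := compact_bounded cK; exists (M + 1) => x Kx.
  by apply: (HM (M + 1)) => //; rewrite ltrDl.
have [B BK] : exists B : R, forall x, `|f x| <= B.
  have : compact (f @` K).
    by apply: continuous_compact => //; exact: continuous_subspaceT.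
  move=> /compact_bounded[B [_ HB]]; exists (Num.max 0 (B + 1)) => x.
  have [Kx|nKx] := pselect (K x); last by rewrite f0// normr0 le_max lexx.
  rewrite le_max; apply/orP; right.
  by apply: (HB (B + 1)); [rewrite ltrDl|exists x].
have M0 : 0 <= Num.max 0 M by rewrite le_max lexx.
have fM x : M < `|x| -> f x = 0.
  by move=> Mx; apply: f0 => /MK; rewrite leNgt Mx.
split; last by exists M, B.
have mI : measurable (`[- Num.max 0 M, Num.max 0 M]%classic : set mR) by exact: measurable_itv.
apply: (@integrable_bounded_supp _ _ _ (@dV R) f (box4 (Num.max 0 M)) B).
- exact: continuous_measurable4.
- by apply: measurableX; apply: measurableX.
- by rewrite /box4 [ltLHS](dV_box) ?ltry// ge0_cp.
- exact: BK.
- move=> x bx; apply: fM; rewrite ltNge; apply/negP => xM; apply: bx.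
  have xM' : `|x| <= Num.max 0 M by rewrite le_max xM orbT.
  move: xM'; rewrite !prod_normE !ge_max => /andP[/andP[h1 h2] /andP[h3 h4]].
  by split; split; rewrite /= in_itv/= -ler_norml.
Qed.

Lemma compact_setC_nbhs (K : set (R4 R)) x : compact K -> ~ K x ->
  \forall y \near x, ~ K y.
Proof.
move=> cK Kx; have : open (~` K).
  by apply: closed_openC; apply: compact_closed cK; exact: norm_hausdorff.
by rewrite openE => /(_ x Kx).
Qed.

(** The complement of a compact set is open, so that the function vanishes
near the point. *)
Lemma derive_off_supp (psi : R4 R -> R) (K : set (R4 R)) (e x : R4 R) :
  compact K -> (forall x, ~ K x -> psi x = 0) -> ~ K x ->
  is_derive x e psi 0.
Proof.
move=> cK psi0 Kx.
have h : is_derive x e (cst (0 : R)) 0 by exact: is_derive_cst.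
apply: near_eq_is_derive h.
by apply: filterS (compact_setC_nbhs cK Kx) => y Ky; rewrite psi0.
Qed.

Lemma ler_norm4 (x : R4 R) : [/\ `|x.1.1| <= `|x|, `|x.1.2| <= `|x|,
  `|x.2.1| <= `|x| & `|x.2.2| <= `|x|].
Proof. by rewrite !prod_normE !le_max !lexx !orbT. Qed.

Lemma integral_line4_eq0 (f : R4 R -> R) (i : 'I_4) :
  (@dV R).-integrable setT (EFin \o f) -> continuous f ->
  (exists M B, [/\ forall x, `|f x| <= B & forall x, M < `|x| -> f x = 0]) ->
  (forall x, \int[la]_t (f (line4 i x t))%:E = 0)%E ->
  (\int[@dV R]_x (f x)%:E = 0)%E.
Proof.
move=> fi cf [M0 [B [fB fM0]]] f0.
pose M : R := Num.max 0 M0.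
have fM x : M < `|x| -> f x = 0.
  by move=> Mx; apply: fM0; apply: le_lt_trans Mx; rewrite le_max lexx orbT.
have MM : - M <= M by rewrite ge0_cp ?le_max ?lexx.
have mf := continuous_measurable4 cf.
have mI : measurable (`[- M, M]%classic : set mR) by exact: measurable_itv.
pose I2 : set (mR * mR) := `[- M, M]%classic `*` `[- M, M]%classic.
have fin2 : (@dA R I2 < +oo)%E.
  by rewrite [ltLHS](dA_itvX MM MM) ltry.
have out (x1 x2 : R) : ~ I2 (x1, x2) ->
    M < `|x1| \/ M < `|x2|.
  move=> nx; apply/orP; rewrite !ltNge -negb_and; apply/negP => /andP[h1 h2].
  by apply: nx; split; rewrite /= in_itv/= -ler_norml.
have s1 y : (@dA R).-integrable setT (EFin \o (fun x : mR * mR => f (x, y))).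
  apply: (@integrable_bounded_supp _ _ _ (@dA R) _ I2 B) => //.
  - exact: (measurable_fun_pair1 (f := f : mR4 R -> mR)).
  - exact: measurableX.
  move=> [x1 x2] /out nx; apply: fM; have [n1 n2 _ _] := ler_norm4 ((x1, x2), y).
  by case: nx => nx; apply: (lt_le_trans nx).
have s2 x : (@dA R).-integrable setT (EFin \o (fun y : mR * mR => f (x, y))).
  apply: (@integrable_bounded_supp _ _ _ (@dA R) _ I2 B) => //.
  - exact: (measurable_fun_pair2 (f := f : mR4 R -> mR)).
  - exact: measurableX.
  move=> [y1 y2] /out nx; apply: fM; have [_ _ n1 n2] := ler_norm4 (x, (y1, y2)).
  by case: nx => nx; apply: (lt_le_trans nx).
case: i f0 => -[|[|[|[|//]]]] i4 f0.
- apply: (integral_slice1_eq0 (m1 := @dA R) (m2 := @dA R) fi) => y.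
  apply: (integral_slice1_eq0 (m1 := la) (m2 := la) (s1 y)) => x2.
  exact: (f0 ((0, x2), y)).
- apply: (integral_slice1_eq0 (m1 := @dA R) (m2 := @dA R) fi) => y.
  apply: (integral_slice2_eq0 (m1 := la) (m2 := la) (s1 y)) => x1.
  exact: (f0 ((x1, 0), y)).
- apply: (integral_slice2_eq0 (m1 := @dA R) (m2 := @dA R) fi) => x.
  apply: (integral_slice1_eq0 (m1 := la) (m2 := la) (s2 x)) => y2.
  exact: (f0 (x, (0, y2))).
- apply: (integral_slice2_eq0 (m1 := @dA R) (m2 := @dA R) fi) => x.
  apply: (integral_slice2_eq0 (m1 := la) (m2 := la) (s2 x)) => y1.
  exact: (f0 (x, (y1, 0))).
Qed.

Lemma integral_derive4_eq0 (psi : R4 R -> R) (K : set (R4 R)) (i : 'I_4) :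
  compact K -> (forall x, ~ K x -> psi x = 0) ->
  (forall x, derivable psi x (e4 R i)) -> continuous ('D_(e4 R i) psi) ->
  (@dV R).-integrable setT (EFin \o 'D_(e4 R i) psi) /\
  (\int[@dV R]_x ('D_(e4 R i) psi x)%:E = 0)%E.
Proof.
move=> cK psi0 dpsi cD.
have D0 x : ~ K x -> 'D_(e4 R i) psi x = 0.
  by move=> Kx; have [_ ->] := derive_off_supp (e4 R i) cK psi0 Kx.
have [fi [M [B [fB fM]]]] := integrable_compact_supp cD cK D0.
split => //; apply: (integral_line4_eq0 (i := i) fi cD); first by exists M, B.
move=> x.
have [M' MK] : exists M : R, forall x, K x -> `|x| <= M.
  have [M' [_ HM]] := compact_bounded cK; exists (M' + 1) => y Ky.
  by apply: (HM (M' + 1)) => //; rewrite ltrDl.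
have tle t : `|t| <= `|line4 i x t|.
  have [h1 h2 h3 h4] := ler_norm4 (line4 i x t).
  by case: i h1 h2 h3 h4 {dpsi cD D0 fi fB fM} => -[|[|[|[|//]]]] i4.
apply: (integral_derive_eq0 (g := psi \o line4 i x) (M := M')).
- by move=> t; exact: line4_derive.
- move=> t; exact: (continuous_comp (@line4_cont i x t) (cD (line4 i x t))).
- by move=> t Mt; apply: psi0 => /MK; rewrite leNgt (lt_le_trans Mt).
- by move=> t Mt; apply: D0 => /MK; rewrite leNgt (lt_le_trans Mt).
Qed.

(** The derivative of [u phi] has integral zero, along each line parallel to
the axis and hence on the whole space. The function [u] is only differentiated
in a neighbourhood [U] of the support, so it may blow up at the boundary of a
domain. *)
Lemma ibp4 (u du phi : R4 R -> R) (K U : set (R4 R)) (i : 'I_4) :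
  open U -> compact K -> K `<=` U -> (forall x, ~ K x -> phi x = 0) ->
  continuous phi -> (forall x, derivable phi x (e4 R i)) ->
  continuous ('D_(e4 R i) phi) ->
  (forall x, U x -> {for x, continuous u}) ->
  (forall x, U x -> is_derive x (e4 R i) u (du x)) ->
  (forall x, U x -> {for x, continuous du}) ->
  \int[@dV R]_x (u x * 'D_(e4 R i) phi x) = - \int[@dV R]_x (du x * phi x).
Proof.
move=> oU cK KU phi0 cphi dphi cD cu udu cdu.
set e := e4 R i in dphi cD udu *.
have D0 x : ~ K x -> 'D_e phi x = 0.
  by move=> Kx; have [_ ->] := derive_off_supp e cK phi0 Kx.
have cprod (v w : R4 R -> R) : (forall x, U x -> {for x, continuous v}) ->
    continuous w -> (forall x, ~ K x -> w x = 0) -> continuous (fun x => v x * w x).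
  move=> cv cw w0 x; have [Kx|Kx] := pselect (K x).
    exact: (cvgM (cv _ (KU _ Kx)) (cw x)).
  rewrite /continuous_at w0// mulr0; apply: cvg_near_cst.
  by apply: filterS (compact_setC_nbhs cK Kx) => y Ky; rewrite w0// mulr0.
pose psi x := u x * phi x.
have dpsi x : is_derive x e psi (u x * 'D_e phi x + du x * phi x).
  have [Kx|Kx] := pselect (K x).
    have h1 := udu x (KU _ Kx).
    have h2 : is_derive x e phi ('D_e phi x) by split => //; exact: dphi.
    by have := is_deriveM h1 h2; rewrite [phi x *: _]mulrC.
  rewrite D0// phi0// !mulr0 addr0.
  by apply: (derive_off_supp e cK) => // y Ky; rewrite /psi phi0// mulr0.
have c1 := cprod u _ cu cD D0.
have c2 := cprod du _ cdu cphi phi0.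
have Dpsi : 'D_e psi = fun x => u x * 'D_e phi x + du x * phi x.
  by apply/funext => x; have [_ ->] := dpsi x.
have [] := @integral_derive4_eq0 psi K i cK.
- by move=> x Kx; rewrite /psi phi0// mulr0.
- by move=> x; have [] := dpsi x.
- by rewrite -/e Dpsi => x; apply: cvgD; [exact: c1|exact: c2].
have z1 x : ~ K x -> u x * 'D_e phi x = 0 by move=> Kx; rewrite D0// mulr0.
have z2 x : ~ K x -> du x * phi x = 0 by move=> Kx; rewrite phi0// mulr0.
have [i1 _] := integrable_compact_supp c1 cK z1.
have [i2 _] := integrable_compact_supp c2 cK z2.
rewrite -/e => _ /(congr1 fine) I0.
apply/eqP; rewrite -addr_eq0 -RintegralD//; apply/eqP.
rewrite -[RHS]I0; congr fine; apply: eq_integral => x _.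
by congr EFin; have [_ ->] := dpsi x.
Qed.

End IBP.

(** * Smooth functions and bumps *)

Section SmoothClass.
Variable R : realType.

Definition coord4 (i : 'I_4) (x : R4 R) : R :=
  match val i with
  | 0%N => x.1.1 | 1%N => x.1.2 | 2%N => x.2.1 | _ => x.2.2 end.

Lemma coord4D i j t (x : R4 R) :
  coord4 i (t *: e4 R j + x) = (if i == j then t else 0) + coord4 i x.
Proof.
have E (a b : R) : t *: a + b = t * a + b by [].
by case: x => -[a b] [c d]; case: i => -[|[|[|[|//]]]] i4; case: j => -[|[|[|[|//]]]] j4;
  rewrite /coord4 /e4 (tnth_nth 0) /= E ?mulr0 ?mulr1.
Qed.

Lemma coord_cont i : continuous (coord4 i).
Proof.
move=> x; case: i => -[|[|[|[|//]]]] i4; rewrite /coord4 /=.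
- exact: (cvg_comp _ _ cvg_fst cvg_fst).
- exact: (cvg_comp _ _ cvg_fst cvg_snd).
- exact: (cvg_comp _ _ cvg_snd cvg_fst).
- exact: (cvg_comp _ _ cvg_snd cvg_snd).
Qed.

(** A smooth function [h 0] comes with all its derivatives, so that
differentiating it is a shift. *)
Definition tower (h : nat -> R -> R) :=
  forall k (t : R), is_derive t 1 (h k) (h k.+1 t).

(** An explicit class of smooth functions on [R^4], visibly closed under
partial derivatives; it contains the coordinates and the bumps below. *)
Inductive smc : (R4 R -> R) -> Prop :=
| smc_cst c : smc (fun=> c)
| smc_coord i h : tower h -> smc (fun x => h 0%N (coord4 i x))
| smc_add f g : smc f -> smc g -> smc (fun x => f x + g x)
| smc_mul f g : smc f -> smc g -> smc (fun x => f x * g x).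

Lemma tower_shift h : tower h -> tower (fun k => h k.+1).
Proof. by move=> th k; exact: th. Qed.

Lemma tower_affine h (a b : R) : tower h ->
  tower (fun k t => a ^+ k * h k (a * t + b)).
Proof.
move=> th k t.
have h1 : is_derive t 1 (fun t : R => a * t + b) a.
  have -> : (fun t : R => a * t + b) = (a \*: id) + cst b by apply/funext.
  apply: is_derive_eq; by rewrite addr0 /GRing.scale /= mulr1.
have h2 := @is_derive1_comp R (h k) (fun t : R => a * t + b) t _ _ (th k (a * t + b)) h1.
have -> : (fun t => a ^+ k * h k (a * t + b)) = (a ^+ k) \*: (h k \o (fun t : R => a * t + b)).
  by apply/funext.
apply: is_derive_eq; rewrite /GRing.scale /= exprS; ring.
Qed.

(** Along the [i]-th axis the difference quotient is that of [h], along the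
other axes it is zero. *)
Lemma is_derive_coord (h : R -> R) (dh : R) i j (x : R4 R) :
  is_derive (coord4 i x) 1 h dh ->
  is_derive x (e4 R j) (h \o coord4 i) (if i == j then dh else 0).
Proof.
move=> [dh1 dh2].
case: (eqVneq i j) => [<-|ij].
  have E : (fun t : R => t^-1 *: (((h \o coord4 i) \o shift x) (t *: e4 R i) - (h \o coord4 i) x)) =
      (fun t : R => t^-1 *: ((h \o shift (coord4 i x)) (t *: 1) - h (coord4 i x))).
    apply/funext => t /=; congr (_ *: (h _ - _)).
    by rewrite coord4D eqxx [t *: 1]mulr1.
  by split; [rewrite /derivable E|rewrite /derive E].
have E : (fun t : R => t^-1 *: (((h \o coord4 i) \o shift x) (t *: e4 R j) - (h \o coord4 i) x)) =
    (fun t : R => t^-1 *: ((cst (0 : R) \o shift x) (t *: e4 R j) - cst (0 : R) x)).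
  apply/funext => t /=; congr (_ *: _).
  by rewrite coord4D (negPf ij) add0r !subrr.
have [d1 d2] : is_derive x (e4 R j) (cst (0 : R)) 0 by exact: is_derive_cst.
by split; [rewrite /derivable E|rewrite /derive E].
Qed.

Lemma smc_continuous f : smc f -> continuous f.
Proof.
elim=> [c|i h th|f1 g1 _ cf _ cg|f1 g1 _ cf _ cg] x.
- exact: cvg_cst.
- have hc : {for coord4 i x, continuous (h 0%N)}.
    apply: differentiable_continuous; apply/derivable1_diffP.
    by have [] := th 0%N (coord4 i x).
  exact: (cvg_comp _ _ (@coord_cont i x) hc).
- exact: (cvgD (cf x) (cg x)).
- exact: (cvgM (cf x) (cg x)).
Qed.

Lemma smc_derive f i : smc f ->
  exists2 g, smc g & forall x, is_derive x (e4 R i) f (g x).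
Proof.
elim=> [c|j h th|f1 g1 sf [df sdf dfE] sg [dg sdg dgE]|f1 g1 sf [df sdf dfE] sg [dg sdg dgE]].
- by exists (fun=> 0); [exact: smc_cst|move=> x; exact: is_derive_cst].
- case: (eqVneq j i) => [<-|ji].
    exists (fun x => h 1%N (coord4 j x)); first exact: (smc_coord j (tower_shift th)).
    by move=> x; have := is_derive_coord j (th 0%N (coord4 j x)); rewrite eqxx.
  exists (fun=> 0); first exact: smc_cst.
  by move=> x; have := is_derive_coord i (th 0%N (coord4 j x)); rewrite (negPf ji).
- exists (fun x => df x + dg x); first exact: smc_add.
  by move=> x; exact: is_deriveD (dfE x) (dgE x).
- exists (fun x => f1 x * dg x + g1 x * df x).
    by apply: smc_add; exact: smc_mul.
  by move=> x; exact: is_deriveM (dfE x) (dgE x).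
Qed.

Lemma smc_partials f s : smc f -> smc (partials s f).
Proof.
move=> sf; elim: s => [//|i s IH] /=.
have [g sg gE] := smc_derive i IH.
by rewrite (_ : (fun _ => _) = g)//; apply/funext => x; have [_ ->] := gE x.
Qed.

Lemma smc_smooth f : smc f -> smooth f.
Proof.
move=> sf s; have ss := smc_partials s sf; split; first exact: smc_continuous.
by move=> i x; have [g _ gE] := smc_derive i ss; have [] := gE x.
Qed.

Lemma tower_id : tower (fun k t => match k with 0%N => t | 1%N => 1 | _ => 0 end).
Proof.
move=> [|[|k]] t.
- exact: is_derive_id.
- exact: is_derive_cst.
- exact: is_derive_cst.
Qed.

Lemma smc_coordinate i : smc (coord4 i).
Proof. exact: (smc_coord i tower_id). Qed.

Lemma smc_bounded f (M : R) : smc f ->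
  exists B : R, forall x, `|x| <= M -> `|f x| <= B.
Proof.
move=> sf; have cf := smc_continuous sf.
pose K : set (R4 R) := (`[- M, M]%classic `*` `[- M, M]%classic) `*` (`[- M, M]%classic `*` `[- M, M]%classic).
have cK : compact K.
  by apply: compact_setX; apply: compact_setX; exact: segment_compact.
have : compact (f @` K).
  by apply: continuous_compact => //; exact: continuous_subspaceT.
move=> /compact_bounded[B [_ HB]]; exists (B + 1) => x xM.
apply: (HB (B + 1)); first by rewrite ltrDl.
exists x => //; have [h1 h2 h3 h4] := ler_norm4 x.
by split; split; rewrite /= in_itv/= -ler_norml (le_trans _ xM).
Qed.

Lemma smc_measurable f : smc f -> measurable_fun setT (f : mR4 R -> R).
Proof. by move=> /smc_continuous; exact: continuous_measurable4. Qed.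

End SmoothClass.

Section Bump.
Variable R : realType.
Implicit Types (p q : {poly R}) (x y t : R).

(** All derivatives of [e^{-1/x}], extended by [0] to [x <= 0], have this
form for some polynomial [p]. *)
Definition flat p x : R := if 0 < x then p.[x^-1] * expR (- x^-1) else 0.

(** [y / n <= e^{y / n}], raised to the [n]-th power. *)
Lemma powx_expN n y : 0 <= y -> y ^+ n * expR (- y) <= n%:R ^+ n.
Proof.
move=> y0; rewrite expRN ler_pdivrMr ?expR_gt0//.
case: n => [|n]; first by rewrite !expr0 mul1r -expR0 ler_expR.
have -> : expR y = expR (y / n.+1%:R) ^+ n.+1.
  by rewrite -expRM_natl mulrCA mulfV ?mulr1// pnatr_eq0.
rewrite -exprMn lerXn2r// ?nnegrE ?mulr_ge0 ?expR_ge0//.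
rewrite -ler_pdivrMl// mulrC (le_trans _ (expR_ge1Dx _))//.
by rewrite lerDr.
Qed.

Lemma poly_expN_bound p n : exists C : R, forall y, 0 <= y ->
  `|p.[y]| * (y ^+ n * expR (- y)) <= C.
Proof.
elim/poly_ind: p n => [|p c IH] n.
  by exists 0 => y _; rewrite horner0 normr0 mul0r.
have [C CP] := IH n.+1.
exists (C + `|c| * n%:R ^+ n) => y y0.
have A0 : 0 <= y ^+ n * expR (- y) by rewrite mulr_ge0 ?exprn_ge0 ?expR_ge0.
rewrite hornerMXaddC (le_trans (ler_wpM2r A0 (ler_normD _ _)))// mulrDl lerD//.
  by rewrite normrM (ger0_norm y0) (le_trans _ (CP y y0))// exprS !mulrA.
by rewrite ler_wpM2l// powx_expN.
Qed.

(** A function bounded by [C h^2] is flat at [0]; this gives the derivatives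
of [flat p] at its only delicate point. *)
Lemma is_derive_quadratic (f : R -> R) (C : R) :
  (forall h : R, `|h| <= 1 -> `|f h| <= C * h ^+ 2) -> is_derive (0 : R) 1 f 0.
Proof.
move=> fC.
have f0 : f 0 = 0.
  have := fC 0; rewrite normr0 ler01 expr0n mulr0 => /(_ isT) h.
  by apply/eqP; rewrite -normr_le0.
have C0 : 0 <= C.
  by have := fC 1; rewrite normr1 lexx expr1n mulr1 => /(_ isT); exact: le_trans.
have cf : h^-1 *: ((f \o shift 0) (h *: (1 : R)) - f 0) @[h --> (0 : R)^'] --> (0 : R).
  apply/cvgrPdist_le => e e0; near=> h.
  rewrite sub0r normrN f0 subr0 /= addr0 [h *: 1]mulr1 [_ *: _]/(_ * _) normrM.
  have h0 : h != 0 by near: h; exact: nbhs_dnbhs_neq.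
  have h1 : `|h| <= 1.
    by near: h; exact: dnbhs0_le.
  have h2 : `|h| <= e / (C + 1).
    by near: h; apply: dnbhs0_le; rewrite divr_gt0// ltr_wpDl.
  rewrite normfV ler_pdivrMl ?normr_gt0// (le_trans (fC h h1))//.
  rewrite -(real_normK (num_real h)) ler_pdivlMr ?ltr_wpDl// in h2 *.
  have := normr_ge0 h; nra.
by split; [exact: cvgP cf|exact: cvg_lim cf].
Unshelve. all: by end_near. Qed.

Lemma flat_le0 p x : x <= 0 -> flat p x = 0.
Proof. by rewrite /flat leNgt => /negPf ->. Qed.

Lemma flat_quadratic p : exists C : R, forall h : R, `|h| <= 1 -> `|flat p h| <= C * h ^+ 2.
Proof.
have [C CP] := poly_expN_bound p 2.
exists C => h _; rewrite /flat; case: ifPn => [h0|_].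
  have hi : 0 <= h^-1 by rewrite invr_ge0 ltW.
  have := CP _ hi; rewrite mulrCA mulrC exprVn ler_pdivrMr ?exprn_gt0//.
  by rewrite normrM (ger0_norm (expR_ge0 _)).
rewrite normr0 mulr_ge0 ?sqr_ge0//.
by apply: le_trans (CP 0 (lexx _)); rewrite mulr_ge0// mulr_ge0 ?expR_ge0// sqr_ge0.
Qed.

(** With [y = 1/x]: the derivative of [p(y) e^{-y}] in [x] is
[- y^2 (p'(y) - p(y)) e^{-y}]. *)
Definition dflat p := 'X^2 * (p - p^`()).

Lemma is_derive_flat p x : is_derive x 1 (flat p) (flat (dflat p) x).
Proof.
have [x0|x0|->] := ltgtP x 0.
- rewrite flat_le0 ?ltW//.
  have h : is_derive x 1 (cst (0 : R)) 0 by exact: is_derive_cst.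
  apply: near_eq_is_derive h; near=> y; rewrite flat_le0//.
  near: y; exact: (cvgr_le x cvg_id _ x0).
- have h : is_derive x 1 (fun y : R => p.[y^-1] * expR (- y^-1)) (flat (dflat p) x).
    have xn0 : x != 0 by rewrite gt_eqF.
    have dV : is_derive x 1 (fun y : R => y^-1) (- x ^- 2).
      have di : derivable (id : R -> R) x 1 by exact: derivable_id.
      split; first exact: (derivableV xn0 di).
      by rewrite (deriveV xn0 di) derive_id [_ *: _]mulr1.
    have dp : is_derive x 1 (fun y : R => p.[y^-1]) (p^`().[x^-1] * - x ^- 2).
      have := @is_derive1_comp R (horner p) (fun y => y^-1) x _ _ (is_derive_poly p x^-1) dV.
      exact.
    have dN : is_derive x 1 (fun y : R => - y^-1) (x ^- 2).
      by have := is_deriveN dV; rewrite opprK.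
    have de := @is_derive1_comp R expR (fun y => - y^-1) x _ _ (is_derive_expR _) dN.
    have H : is_derive x 1 (fun y : R => p.[y^-1] * expR (- y^-1)) _ := is_deriveM dp de.
    have E v w : v = w -> is_derive x 1 (fun y : R => p.[y^-1] * expR (- y^-1)) v ->
      is_derive x 1 (fun y : R => p.[y^-1] * expR (- y^-1)) w by move=> ->.
    apply: E H => /=.
    rewrite /flat x0 /dflat hornerM hornerXn hornerD hornerN /GRing.scale /= exprVn.
    ring.
  apply: near_eq_is_derive h; near=> y; rewrite /flat ifT//.
  near: y; exact: (cvgr_gt x cvg_id _ x0).
- rewrite flat_le0//; have [C CP] := flat_quadratic p.
  exact: is_derive_quadratic CP.
Unshelve. all: by end_near. Qed.

Definition flat_tower (k : nat) := flat (iter k dflat 1).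

Lemma tower_flat : tower flat_tower.
Proof. by move=> k t; exact: is_derive_flat. Qed.

(** [e^{-1/x}] for [x > 0], and [0] for [x <= 0]; the two factors of a bump. *)
Definition eps := flat 1.

Lemma eps_ge0 x : 0 <= eps x.
Proof.
by rewrite /eps /flat; case: ifP => // _; rewrite hornerC mul1r expR_ge0.
Qed.

Lemma eps_le1 x : eps x <= 1.
Proof.
rewrite /eps /flat; case: ifP => // x0; rewrite hornerC mul1r -expR0 ler_expR.
by rewrite oppr_le0 invr_ge0 ltW.
Qed.

Lemma eps_gt0 x : 0 < x -> 0 < eps x.
Proof. by rewrite /eps /flat => ->; rewrite hornerC mul1r expR_gt0. Qed.

Lemma eps_mono x y : 0 < x -> x <= y -> eps x <= eps y.
Proof.
move=> x0 xy; have y0 := lt_le_trans x0 xy.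
by rewrite /eps /flat x0 y0 !hornerC !mul1r ler_expR lerN2 lef_pV2.
Qed.

Lemma eps_le0 x : x <= 0 -> eps x = 0.
Proof. exact: flat_le0. Qed.

Definition bump1 (a w : R) (t : R) := eps ((t - a) / w) * eps ((a + w - t) / w).

Lemma smc_bump1 (a w : R) i : smc (fun x : R4 R => bump1 a w (coord4 i x)).
Proof.
apply: smc_mul.
  have -> : (fun x : R4 R => eps ((coord4 i x - a) / w)) =
      (fun x : R4 R => (fun k t => w^-1 ^+ k * flat_tower k (w^-1 * t + - a / w)) 0%N (coord4 i x)).
    by apply/funext => x; rewrite expr0 mul1r /eps; congr flat; ring.
  exact: (smc_coord i (tower_affine _ _ tower_flat)).
have -> : (fun x : R4 R => eps ((a + w - coord4 i x) / w)) =
    (fun x : R4 R => (fun k t => (- w^-1) ^+ k * flat_tower k (- w^-1 * t + (a + w) / w)) 0%N (coord4 i x)).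
  by apply/funext => x; rewrite expr0 mul1r /eps; congr flat; ring.
exact: (smc_coord i (tower_affine _ _ tower_flat)).
Qed.

Lemma bump1_ge0 a w t : 0 <= bump1 a w t.
Proof. by rewrite mulr_ge0 ?eps_ge0. Qed.

Lemma bump1_le1 a w t : bump1 a w t <= 1.
Proof. by rewrite -[leRHS]mulr1 ler_pM ?eps_ge0 ?eps_le1. Qed.

Lemma bump1_supp a w t : 0 < w -> bump1 a w t != 0 -> a <= t <= a + w.
Proof.
move=> w0; rewrite mulf_eq0 negb_or => /andP[h1 h2].
rewrite !leNgt; apply/andP; split; apply/negP => h.
  by move/eqP: h1; apply; rewrite eps_le0// pmulr_lle0 ?invr_gt0// subr_le0 ltW.
by move/eqP: h2; apply; rewrite eps_le0// pmulr_lle0 ?invr_gt0// subr_le0 ltW.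
Qed.

Lemma bump1_ge a w t : 0 < w -> a + w / 4 <= t <= a + w - w / 4 ->
  eps 4^-1 ^+ 2 <= bump1 a w t.
Proof.
move=> w0 /andP[h1 h2]; rewrite expr2 ler_pM ?eps_ge0//; apply: eps_mono => //;
  rewrite ler_pdivlMr//; lra.
Qed.

End Bump.

(** * Geometry of the domain and size of the monomials *)

Section Geometry.
Variable R : realType.
Variables (m n : nat).
Hypotheses (m_gt0 : (0 < m)%N) (n_gt0 : (0 < n)%N).
Local Notation H := (Hgamma (m%:R / n%:R : R)).
Local Notation mR := (measurableTypeR R).

Lemma gamma_gt0 : 0 < m%:R / n%:R :> R.
Proof. by rewrite divr_gt0// ltr0n. Qed.

(** The rational power is removed by raising to the [n]-th power. *)
Lemma HgammaP (z : C2 R) :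
  H z <-> cmod z.1 ^+ m < cmod z.2 ^+ n /\ cmod z.2 < 1.
Proof.
have a0 := cmod_ge0 z.1; have b0 := cmod_ge0 z.2.
have E : (cmod z.1 `^ (m%:R / n%:R)) ^+ n = cmod z.1 ^+ m.
  rewrite -powR_mulrn ?powR_ge0// -powRrM divfK ?pnatr_eq0 ?lt0n_neq0//.
  by rewrite powR_mulrn.
by rewrite /Hgamma/= -(ltr_pXn2r n_gt0) ?nnegrE ?powR_ge0// E.
Qed.

(** Bezout's identity for the coprime pair [(n, m)], to which multiples of
[(m, n)] are added to make [p] large. *)
Lemma bezout_exponents (j : nat) : coprime m n ->
  exists p N : nat, [/\ (0 < p)%N, (j <= p)%N, (0 < N)%N &
    (n * p.+1 + m = m * N + 1)%N].
Proof.
move=> mn; have nm : coprime n m by rewrite coprime_sym.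
case: (egcdnP m n_gt0) => u v E _; rewrite (eqP nm) in E.
(* The shift by [j.+2] leaves room for the predecessor and for [j <= p]. *)
exists (u + m * j.+2).-1, (v + n * j.+2).+1.
have u0 : (0 < u)%N by rewrite lt0n; apply/eqP => u0; rewrite u0 mul0n addn1 in E.
have mj : (j.+2 <= m * j.+2)%N by rewrite leq_pmull.
rewrite prednK ?addn_gt0 ?u0//; split => //.
- rewrite -subn1 subn_gt0; apply: (@leq_trans (1 + j.+2)) => //.
  by rewrite leq_add.
- rewrite -ltnS prednK ?addn_gt0 ?u0//; apply: (@leq_trans j.+2) => //.
  by rewrite (leq_trans mj)// leq_addl.
- rewrite mulnDr mulnC E mulnS mulnDr (mulnCA n); ring.
Qed.

(** [t^k] for [t = 2^-i]. *)
Definition rho (k i : nat) : R := (2^-1) ^+ (k * i).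

Lemma rho_gt0 k i : 0 < rho k i.
Proof. by rewrite exprn_gt0// invr_gt0. Qed.

Lemma rho_le1 k i : rho k i <= 1.
Proof. by rewrite exprn_ile1// ?invr_ge0// invf_le1// ler1n. Qed.

(** The map [(z1, z2) |-> (t^n z1, t^m z2)] with [t = 2^-i]; the weights [n]
and [m] are those for which [|z1|^m] and [|z2|^n] scale alike. *)
Definition dil (i : nat) (x : R4 R) : R4 R :=
  ((rho n i * x.1.1, rho n i * x.1.2), (rho m i * x.2.1, rho m i * x.2.2)).

Lemma toC2_dil i x :
  toC2 (dil i x) = ((rho n i)%:C%C * (toC2 x).1, (rho m i)%:C%C * (toC2 x).2).
Proof.
by case: x => -[a b] [c d]; rewrite /toC2 /dil /=; simpc.
Qed.

Lemma rho_swap i : rho n i ^+ m = rho m i ^+ n.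
Proof. by rewrite /rho -!exprM; congr (_ ^+ _); rewrite mulnAC (mulnC n) mulnAC. Qed.

Lemma H_dil i x : H (toC2 x) -> H (toC2 (dil i x)).
Proof.
rewrite !HgammaP toC2_dil /= !cmodM !cmod_real !gtr0_norm ?rho_gt0// => -[h1 h2].
split; first by rewrite !exprMn rho_swap ltr_pM2l// exprn_gt0// rho_gt0.
rewrite (le_lt_trans _ h2)// ler_piMl ?cmod_ge0//; exact: rho_le1.
Qed.

(** With this abscissa the base point below satisfies
[x0^m <= x0 < (1/2)^n], whatever [m] is. *)
Definition x0 : R := (2^-1) ^+ n.+1.

Definition base : R4 R := ((x0, 0), (2^-1, 0)).

(** The image of a box around the base point under the [i]-th dilation. The
boxes tend to the singular boundary point [0]; the growth of a monomial is
measured on them. *)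
Definition boxS (w : R) (i : nat) : set (mR4 R) :=
  ((`[rho n i * (x0 - w), rho n i * (x0 + w)]%classic : set mR) `*`
   (`[rho n i * (- w), rho n i * w]%classic : set mR)) `*`
  ((`[rho m i * (2^-1 - w), rho m i * (2^-1 + w)]%classic : set mR) `*`
   (`[rho m i * (- w), rho m i * w]%classic : set mR)).

Lemma measurable_boxS w i : measurable (boxS w i).
Proof. by apply: measurableX; apply: measurableX; exact: measurable_itv. Qed.

Lemma boxS_dil w i x : boxS w i x <-> exists2 y, boxS w 0 y & x = dil i y.
Proof.
have r0 k : rho k 0 = 1 by rewrite /rho muln0 expr0.
case: x => -[a b] [c d]; split.
  move=> [[/= h1 h2] [/= h3 h4]].
  exists ((a / rho n i, b / rho n i), (c / rho m i, d / rho m i)).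
    move: h1 h2 h3 h4; rewrite /= !in_itv/= => h1 h2 h3 h4.
    by split; split; rewrite /= in_itv/= !r0 !mul1r ler_pdivlMr ?rho_gt0// ler_pdivrMr ?rho_gt0// ![_ * rho _ _]mulrC.
  by rewrite /dil /= ![rho _ _ * (_ / _)]mulrCA !mulfV ?mulr1// gt_eqF// rho_gt0.
move=> [[[a' b'] [c' d']] [[/= h1 h2] [/= h3 h4]] [-> -> -> ->]].
move: h1 h2 h3 h4; rewrite /= !in_itv/= !r0 !mul1r => h1 h2 h3 h4.
by split; split; rewrite /= in_itv/= !ler_pM2l ?rho_gt0.
Qed.

Lemma dV_boxS w i : 0 <= w ->
  dV R (boxS w i) = (16 * w ^+ 4 * (rho n i ^+ 2 * rho m i ^+ 2))%:E.
Proof.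
move=> w0; have p k := ltW (rho_gt0 k i).
rewrite /boxS [LHS]dV_box; last 4 first.
- by rewrite ler_wpM2l ?p//; lra.
- by rewrite ler_wpM2l ?p//; lra.
- by rewrite ler_wpM2l ?p//; lra.
- by rewrite ler_wpM2l ?p//; lra.
by congr _%:E; ring.
Qed.

Lemma boxS_near w x : boxS w 0 x -> `|x - base| <= w.
Proof.
case: x => -[a b] [c d] [[/= h1 h2] [/= h3 h4]]; move: h1 h2 h3 h4.
rewrite !in_itv/= /rho !muln0 !expr0 !mul1r => h1 h2 h3 h4.
rewrite !prod_normE /= !ge_max !ler_norml.
by apply/andP; split; apply/andP; split; apply/andP; lra.
Qed.

(** The real parts of [z2] are in the interval
[[2^(-m i) 3/8, 2^(-m i) 5/8]], and these are disjoint. *)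
Lemma boxS_disjoint w : 0 < w -> w <= 8^-1 -> trivIset setT (boxS w).
Proof.
move=> w0 w8; apply: ltn_trivIset => i j ij; rewrite -subset0 => -[[? ?] [c d]].
move=> [[_ [/= h1 _]] [_ [/= h2 _]]]; move: h1 h2; rewrite !in_itv/=.
move=> /andP[h1 h1'] /andP[h2 h2'].
have H1 u v : (u < v)%N -> rho m v * 2 <= rho m u.
  move=> uv; rewrite -ler_pdivlMr// /rho -exprSr ler_wiXn2l ?invr_ge0//.
    by rewrite invf_le1// ler1n.
  by rewrite -addn1 (leq_trans (leq_add (leqnn _) m_gt0))// -mulnSr leq_pmul2l.
have /H1 := ij; have := rho_gt0 m i; have := rho_gt0 m j; nra.
Qed.

Lemma base_in_H : H (toC2 base).
Proof.
have h2 : 2^-1 < (1 : R) by rewrite invf_lt1// ltr1n.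
have x00 : 0 < x0 by rewrite exprn_gt0// invr_gt0.
rewrite HgammaP /toC2 /base /= !complexr0 !cmod_real !gtr0_norm ?invr_gt0//.
split => //; apply: (@le_lt_trans _ _ x0).
  have x01 : x0 <= 1 by rewrite exprn_ile1 ?invr_ge0// ltW.
  by rewrite -[leRHS]expr1 ler_wiXn2l// ltW.
by rewrite /x0 ltr_iXn2l ?invr_gt0.
Qed.

(** The boxes are disjoint, so the integral is at least [eta] times their
number. *)
Lemma integral_boxS_pinfty (w eta : R) (g : mR4 R -> \bar R) :
  0 < w -> w <= 8^-1 -> 0 < eta ->
  (forall i, boxS w i `<=` real_domain H) ->
  measurable (real_domain H : set (mR4 R)) ->
  measurable_fun (real_domain H) g -> (forall x, 0 <= g x)%E ->
  (forall i, eta%:E <= \int[@dV R]_(x in boxS w i) g x)%E ->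
  (\int[@dV R]_(x in real_domain H) g x = +oo)%E.
Proof.
move=> w0 w8 eta0 SH mH mg g0 geta.
apply/eqP; rewrite eq_le leey /=.
have mU : measurable (\bigcup_i boxS w i).
  by apply: bigcupT_measurable => i; exact: measurable_boxS.
have UH : \bigcup_i boxS w i `<=` real_domain H by move=> x [i _] /SH.
apply: (@le_trans _ _ (\int[@dV R]_(x in \bigcup_i boxS w i) g x)%E); last first.
  exact: ge0_subset_integral.
rewrite ge0_integral_bigcup//; last 3 first.
- exact: measurable_boxS.
- exact: measurable_funS mg.
- exact: boxS_disjoint.
rewrite (_ : (\sum_(0 <= i <oo) _)%E = +oo%E)//; apply: eq_infty => A.
pose k := (Num.truncn (A / eta)).+1.
apply: le_trans (nneseries_lim_ge k _); last first.
  by move=> i _ _; exact: integral_ge0.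
apply: (@le_trans _ _ (\sum_(0 <= i < k) eta%:E)%E); last exact: lee_sum.
rewrite sumEFin lee_fin big_const_nat subn0 iter_addr addr0 -mulr_natl.
by rewrite -ler_pdivrMr// ltW// /k truncnS_gt.
Qed.

Lemma cmod_measurable (f : mR4 R -> R[i]) :
  measurable_fun setT (fun x => complex.Re (f x)) ->
  measurable_fun setT (fun x => complex.Im (f x)) ->
  measurable_fun setT (fun x => cmod (f x)).
Proof.
move=> mr mi; under eq_fun do rewrite cmod_def.
apply: measurableT_comp; last by apply: measurable_funD; exact: measurable_funX.
by apply: continuous_measurable_fun; exact: sqrt_continuous.
Qed.

Lemma measurable_H : measurable (real_domain H : set (mR4 R)).
Proof.
have m1 : measurable_fun setT (fun x : mR4 R => cmod (toC2 x).1).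
  by apply: cmod_measurable => /=; do 2?[apply: measurableT_comp => //].
have m2 : measurable_fun setT (fun x : mR4 R => cmod (toC2 x).2).
  by apply: cmod_measurable => /=; do 2?[apply: measurableT_comp => //].
rewrite (_ : real_domain H =
  (fun x : mR4 R => cmod (toC2 x).1 `^ (m%:R / n%:R) < cmod (toC2 x).2) @^-1` [set true] `&`
  (fun x : mR4 R => cmod (toC2 x).2 < 1) @^-1` [set true]).
  have mf : measurable_fun setT (fun x : mR4 R => cmod (toC2 x).1 `^ (m%:R / n%:R)).
    exact: (measurableT_comp (@measurable_powR R _) m1).
  apply: measurableI; rewrite -[X in measurable X]setTI.
    by apply: (measurable_fun_ltr mf m2).
  have m1' : measurable_fun [set: mR4 R] (fun _ => 1 : R) by exact: measurable_cst.
  by apply: (measurable_fun_ltr m2 m1').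
by apply/seteqP; split => x /=; rewrite /real_domain /Hgamma /=.
Qed.

Definition mono (a b : nat) (z : C2 R) : R[i] := z.1 ^+ a * (z.2^-1) ^+ b.

Definition cmeasurable (f : mR4 R -> R[i]) :=
  measurable_fun setT (fun x => complex.Re (f x)) /\
  measurable_fun setT (fun x => complex.Im (f x)).

Lemma cmeasurableM f g : cmeasurable f -> cmeasurable g ->
  cmeasurable (fun x => f x * g x).
Proof.
move=> [f1 f2] [g1 g2]; split.
  rewrite (_ : (fun _ => _) = fun x => complex.Re (f x) * complex.Re (g x) -
    complex.Im (f x) * complex.Im (g x)).
    by apply: measurable_funB; exact: measurable_funM.
  by apply/funext => x; case: (f x) => a b; case: (g x).
rewrite (_ : (fun _ => _) = fun x => complex.Re (f x) * complex.Im (g x) +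
  complex.Im (f x) * complex.Re (g x)).
  by apply: measurable_funD; exact: measurable_funM.
by apply/funext => x; case: (f x) => a b; case: (g x).
Qed.

Lemma cmeasurable_cst c : cmeasurable (fun=> c).
Proof. by split; exact: measurable_cst. Qed.

Lemma cmeasurableX f k : cmeasurable f -> cmeasurable (fun x => f x ^+ k).
Proof.
move=> mf; elim: k => [|k IH]; first exact: cmeasurable_cst.
by under eq_fun do rewrite exprS; exact: cmeasurableM.
Qed.

Lemma measurable_inv (g : mR4 R -> R) : measurable_fun setT g ->
  measurable_fun setT (fun x => (g x)^-1).
Proof.
move=> mg; rewrite (_ : (fun _ => _) = fun x => g x * ((g x ^+ 2) `^ (-1))).
  apply: measurable_funM => //.
  exact: (measurableT_comp (@measurable_powR R _) (measurable_funX 2 mg)).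
apply/funext => x; rewrite powR_inv1 ?sqr_ge0//.
have [->|g0] := eqVneq (g x) 0; first by rewrite invr0 mul0r.
by rewrite expr2 invfM mulVKf.
Qed.

Lemma cmeasurableV f : cmeasurable f -> cmeasurable (fun x => (f x)^-1).
Proof.
move=> [f1 f2].
have mn : measurable_fun setT (fun x => (complex.Re (f x) ^+ 2 + complex.Im (f x) ^+ 2)^-1).
  by apply: measurable_inv; apply: measurable_funD; exact: measurable_funX.
split.
  rewrite (_ : (fun _ => _) = fun x => complex.Re (f x) *
    (complex.Re (f x) ^+ 2 + complex.Im (f x) ^+ 2)^-1).
    exact: measurable_funM.
  by apply/funext => x; case: (f x).
rewrite (_ : (fun _ => _) = fun x => - complex.Im (f x) *
  (complex.Re (f x) ^+ 2 + complex.Im (f x) ^+ 2)^-1).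
  by apply: measurable_funM => //; exact: measurable_funN.
by apply/funext => x; case: (f x) => a b /=; rewrite mulNr.
Qed.

Lemma cmeasurable_z1 : cmeasurable (fun x => (toC2 x).1).
Proof. by split => /=; do 2?[apply: measurableT_comp => //]. Qed.

Lemma cmeasurable_z2 : cmeasurable (fun x => (toC2 x).2).
Proof. by split => /=; do 2?[apply: measurableT_comp => //]. Qed.

Lemma cmeasurable_mono a b : cmeasurable (fun x => mono a b (toC2 x)).
Proof.
apply: cmeasurableM; apply: cmeasurableX; first exact: cmeasurable_z1.
exact/cmeasurableV/cmeasurable_z2.
Qed.

Lemma mono_measurable a b : measurable_fun setT (fun x : mR4 R => cmod (mono a b (toC2 x))).
Proof. by have [h1 h2] := cmeasurable_mono a b; exact: cmod_measurable. Qed.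

Lemma cmod_mono a b z : cmod (mono a b z) = cmod z.1 ^+ a * (cmod z.2)^-1 ^+ b.
Proof. by rewrite /mono cmodM !cmodX cmodV. Qed.

Lemma mono_dil a b i x :
  mono a b (toC2 (dil i x)) = (rho n i ^+ a * (rho m i)^-1 ^+ b)%:C%C * mono a b (toC2 x).
Proof.
rewrite toC2_dil /mono /= !exprMn invfM exprMn -fmorphV -!rmorphXn rmorphM.
by rewrite /= mulrACA.
Qed.

Lemma H_bounds z : H z -> cmod z.1 < 1 /\ 0 < cmod z.2 < 1.
Proof.
move=> hz; have [h1 h2] := (HgammaP z).1 hz.
have z0 : 0 < cmod z.2 by rewrite cmod_gt0; exact: (Hgamma_neq0 hz).
split; last by rewrite z0.
rewrite -(@ltr_pXn2r _ m)// ?nnegrE ?cmod_ge0// expr1n (lt_le_trans h1)//.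
by rewrite exprn_ile1// ltW.
Qed.

(** The index of the dyadic shell [2^(-m (i + 1)) <= |z2| <= 2^(-m i)]; the
bound on [|z1|] then comes from [|z1|^m < |z2|^n]. *)
Lemma H_dyadic z : H z -> exists i,
  [/\ cmod z.1 <= rho n i, cmod z.2 <= rho m i & rho m i.+1 <= cmod z.2].
Proof.
move=> hz; have [h1 h2] := (HgammaP z).1 hz.
have [_ /andP[z0 z1]] := H_bounds hz.
have ex : exists k, rho m k <= cmod z.2.
  exists (Num.truncn (cmod z.2)^-1).+1; rewrite /rho exprVn.
  rewrite -[leRHS]invrK lef_pV2 ?posrE ?invr_gt0 ?exprn_gt0//.
  rewrite (le_trans (ltW (truncnS_gt _)))// -natrX ler_nat.
  by rewrite (leq_trans _ (ltnW (ltn_expl _ _)))// leq_pmull.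
case: (ex_minnP ex) => -[|k] kz kmin.
  by move: kz; rewrite /rho muln0 expr0 leNgt z1.
exists k; have zk : cmod z.2 < rho m k.
  by rewrite ltNge; apply/negP => /kmin; rewrite ltnn.
split => //; last exact: ltW.
have r0 k' i : 0 <= rho k' i by exact: ltW (rho_gt0 _ _).
rewrite -(@ler_pXn2r _ m)// ?nnegrE ?cmod_ge0//.
rewrite (le_trans (ltW h1))// rho_swap ler_pXn2r// ?nnegrE ?cmod_ge0//.
exact: ltW.
Qed.

(** A box that contains the [i]-th dyadic shell of the domain. *)
Definition boxB (i : nat) : set (mR4 R) :=
  ((`[- rho n i, rho n i]%classic : set mR) `*`
   (`[- rho n i, rho n i]%classic : set mR)) `*`
  ((`[- rho m i, rho m i]%classic : set mR) `*`
   (`[- rho m i, rho m i]%classic : set mR)).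

Lemma dV_boxB i : dV R (boxB i) = (16 * (rho n i ^+ 2 * rho m i ^+ 2))%:E.
Proof.
have p k := ltW (rho_gt0 k i).
rewrite /boxB [LHS]dV_box; try by rewrite ge0_cp.
by congr _%:E; ring.
Qed.

Lemma boxB_mem i (x : mR4 R) : cmod (toC2 x).1 <= rho n i ->
  cmod (toC2 x).2 <= rho m i -> boxB i x.
Proof.
case: x => -[a b] [c d]; rewrite /toC2 /= => h1 h2.
have [h3 h4] := (ler_Re_cmod (Complex a b), ler_Im_cmod (Complex a b)).
have [h5 h6] := (ler_Re_cmod (Complex c d), ler_Im_cmod (Complex c d)).
move: h3 h4 h5 h6 => /= h3 h4 h5 h6.
by split; split; rewrite /= in_itv/= -ler_norml ?(le_trans _ h1)// (le_trans _ h2).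
Qed.

Variables (p N : nat).
Hypothesis pN : (n * p.+1 + m = m * N + 1)%N.

(** The square of the largest modulus of the monomial on the [i]-th shell,
times the volume of the box around the shell. The relation between the
exponents makes it geometric with ratio [1/4]. *)
Lemma shell_estimate i :
  (rho n i ^+ p * (rho m i.+1)^-1 ^+ N) ^+ 2 * (16 * (rho n i ^+ 2 * rho m i ^+ 2)) =
  (16 * (2 ^+ (m * N)) ^+ 2) * 4^-1 ^+ i.
Proof.
have E : rho n i ^+ p * rho n i * rho m i * (rho m i.+1)^-1 ^+ N =
    2 ^+ (m * N) * 2^-1 ^+ i.
  rewrite -exprSr /rho -!exprM -exprD !exprVn invrK -exprM.
  rewrite (_ : (n * i * p.+1 + m * i = m * N * i + i)%N); last first.
    by transitivity (i * (n * p.+1 + m))%N; [ring|rewrite pN; ring].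
  rewrite (_ : (m * i.+1 * N = m * N * i + m * N)%N); last by rewrite mulnS; ring.
  by rewrite !exprD; field; rewrite !expf_neq0 ?pnatr_eq0.
have -> : (4 : R)^-1 ^+ i = (2^-1 ^+ i) ^+ 2.
  by rewrite exprAC; congr (_ ^+ _); field.
transitivity (16 * (2 ^+ (m * N) * 2^-1 ^+ i) ^+ 2 : R); last by ring.
by rewrite -E; ring.
Qed.

Lemma le_nneseries_term (u : nat -> \bar R) i : (forall k, 0 <= u k)%E ->
  (u i <= \sum_(0 <= k <oo) u k)%E.
Proof.
move=> u0; apply: le_trans (nneseries_lim_ge i.+1 _); last by move=> *; exact: u0.
by rewrite big_nat_recr//= leeDr// sume_ge0.
Qed.

Lemma geometric_fin (K : R) : 0 <= K -> (\sum_(0 <= i <oo) (K * 4^-1 ^+ i)%:E < +oo)%E.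
Proof.
move=> K0; apply: (@le_lt_trans _ _ (K * 2)%:E); last by rewrite ltry.
apply: lime_le.
  by apply: is_cvg_nneseries => i _ _; rewrite lee_fin mulr_ge0// exprn_ge0.
near=> k; rewrite sumEFin lee_fin -mulr_sumr ler_wpM2l//.
suff : \sum_(0 <= i < k) (4^-1 : R) ^+ i <= 2 - 2 * 4^-1 ^+ k.
  by move=> /le_trans; apply; rewrite lerBlDr lerDl mulr_ge0// exprn_ge0.
elim: (k) => [|l IH]; first by rewrite big_nil expr0; lra.
rewrite big_nat_recr//= exprSr; have : 0 <= (4^-1 : R) ^+ l by rewrite exprn_ge0.
lra.
Unshelve. all: by end_near. Qed.

Lemma mono_L2 :
  (\int[@dV R]_(x in real_domain H) (cmod (mono p N (toC2 x)) ^+ 2)%:E < +oo)%E.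
Proof.
pose c i := (rho n i ^+ p * (rho m i.+1)^-1 ^+ N) ^+ 2.
have c0 i : 0 <= c i by exact: sqr_ge0.
have mB i : measurable (boxB i).
  by apply: measurableX; apply: measurableX; exact: measurable_itv.
have mcB i : measurable_fun setT (fun x => (c i * \1_(boxB i) x)%:E).
  by apply/measurable_EFinP/measurable_funM => //; exact: measurable_indic.
apply: (@le_lt_trans _ _ (\int[@dV R]_x \sum_(0 <= i <oo) (c i * \1_(boxB i) x)%:E)%E).
  rewrite integral_mkcond; apply: ge0_le_integral => //.
  - by move=> x _; rewrite patchE; case: ifP => // _; rewrite lee_fin sqr_ge0.
  - apply/(measurable_restrictT _ measurable_H)/measurable_EFinP.
    by apply: measurable_funX; apply: measurable_funTS; exact: mono_measurable.
  - by apply: ge0_emeasurable_sum => // i x _ _; rewrite lee_fin mulr_ge0.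
  - move=> x _; rewrite patchE; case: ifPn => [/set_mem xH|_]; last first.
      by apply: nneseries_ge0 => i _ _; rewrite lee_fin mulr_ge0.
    have [i [h1 h2 h3]] := H_dyadic xH.
    apply: (@le_trans _ _ (c i * \1_(boxB i) x)%:E); last first.
      apply: (le_nneseries_term (u := fun i => (c i * \1_(boxB i) x)%:E)) => k.
      by rewrite lee_fin mulr_ge0.
    rewrite indicE mem_set ?mulr1; last exact: boxB_mem.
    rewrite lee_fin ler_sqr ?nnegrE ?cmod_ge0//; last first.
      by rewrite mulr_ge0// exprn_ge0// ?invr_ge0 ltW// rho_gt0.
    rewrite cmod_mono; apply: ler_pM; rewrite ?exprn_ge0 ?invr_ge0 ?cmod_ge0//.
      by rewrite lerXn2r ?nnegrE ?cmod_ge0// ltW// rho_gt0.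
    rewrite lerXn2r ?nnegrE ?invr_ge0 ?cmod_ge0 ?(ltW (rho_gt0 _ _))//.
    by rewrite lef_pV2 ?posrE ?rho_gt0// (lt_le_trans _ h3)// rho_gt0.
rewrite integral_nneseries//; last by move=> i x _; rewrite lee_fin mulr_ge0.
rewrite (eq_eseriesr (g := fun i => ((16 * (2 ^+ (m * N)) ^+ 2) * 4^-1 ^+ i)%:E)).
  by apply: geometric_fin; rewrite mulr_ge0// sqr_ge0.
move=> i _; rewrite -shell_estimate -/(c i).
under eq_integral do rewrite EFinM.
rewrite ge0_integralZl//; last 2 first.
- by apply/measurable_EFinP; exact: measurable_indic.
- by rewrite lee_fin.
by rewrite integral_indic// setIT [X in (_ * X)%E](dV_boxB i).
Qed.

End Geometry.

(** * Neighbourhoods in the two models of complex 2-space *)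

Section Near.
Variable R : realType.
Local Notation mR := (measurableTypeR R).

Definition fromC2 (z : C2 R) : R4 R :=
  ((complex.Re z.1, complex.Im z.1), (complex.Re z.2, complex.Im z.2)).

Lemma fromC2K z : toC2 (fromC2 z) = z.
Proof. by case: z => -[a b] [c d]. Qed.

Lemma toC2K x : fromC2 (toC2 x) = x.
Proof. by case: x => -[a b] [c d]. Qed.

(** The norm of [C2] takes its values in the complex field, and so do the
radii of its balls; real radii are recovered here. *)
Lemma near_C2P (z : C2 R) (P : C2 R -> Prop) :
  (\forall z' \near z, P z') <-> exists2 d : R, 0 < d &
    forall z' : C2 R, cmod (z'.1 - z.1) < d -> cmod (z'.2 - z.2) < d -> P z'.
Proof.
split.
  move=> /nbhs_ballP[e /= e0 eP].
  have [r eE] : exists r : R, e = (r%:C)%C.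
    by exists (cmod e); rewrite -cmodE gtr0_norm.
  rewrite {}eE ltcR in e0 eP; exists r => // z' h1 h2; apply: eP.
  by split; rewrite /ball/= cmodE ltcR -opprB cmodN.
move=> [d d0 dP]; apply/nbhs_ballP; exists (d%:C)%C; first by rewrite /= ltcR.
move=> z' [/= h1 h2]; apply: dP.
  by move: h1; rewrite /ball/= cmodE ltcR -opprB cmodN.
by move: h2; rewrite /ball/= cmodE ltcR -opprB cmodN.
Qed.

Lemma near_R4P (x : R4 R) (P : R4 R -> Prop) :
  (\forall y \near x, P y) -> exists2 d : R, 0 < d &
    forall y : R4 R, `|y - x| <= d -> P y.
Proof.
move=> /nbhs_ballP[e /= e0 eP]; exists (e / 2); first by rewrite divr_gt0.
move=> y yx; apply: eP; rewrite -ball_normE /= distrC (le_lt_trans yx)//.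
by rewrite ltr_pdivrMr// ltr_pMr// ltr1n.
Qed.

Lemma near_R4_C2 (x : R4 R) (P : C2 R -> Prop) :
  (\forall y \near x, P (toC2 y)) -> \forall z \near toC2 x, P z.
Proof.
move=> /near_R4P[d d0 dP]; apply/near_C2P; exists d => // z h1 h2.
rewrite -(fromC2K z); apply: dP; rewrite -[in leLHS](toC2K x).
rewrite !prod_normE /= !ge_max.
have E1 := ler_Re_cmod (z.1 - (toC2 x).1); have E2 := ler_Im_cmod (z.1 - (toC2 x).1).
have E3 := ler_Re_cmod (z.2 - (toC2 x).2); have E4 := ler_Im_cmod (z.2 - (toC2 x).2).
case: z h1 h2 E1 E2 E3 E4 => -[a b] [c e'] /= h1 h2 E1 E2 E3 E4.
by rewrite !(le_trans E1, le_trans E2, le_trans E3, le_trans E4)//; apply: ltW.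
Qed.

Lemma near_C2_R4 (x : R4 R) (P : C2 R -> Prop) :
  (\forall z \near toC2 x, P z) -> \forall y \near x, P (toC2 y).
Proof.
move=> /near_C2P[d d0 dP]; apply/nbhs_ballP; exists (d / 4); first by rewrite /= divr_gt0.
move=> y; rewrite -ball_normE /= => xy; have [h1 h2 h3 h4] := ler_norm4 (x - y).
apply: dP.
  rewrite -opprB cmodN (le_lt_trans (cmod_le _))//.
  by move: h1 h2; case: (x) (y) xy => -[? ?] [? ?] [[? ?] [? ?]] /=; lra.
rewrite -opprB cmodN (le_lt_trans (cmod_le _))//.
by move: h3 h4; case: (x) (y) xy => -[? ?] [? ?] [[? ?] [? ?]] /=; lra.
Qed.

Lemma integral_gt0 (D : set (mR4 R)) (g : mR4 R -> R) (x : R4 R) (c : R) :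
  measurable D -> measurable_fun D g -> (forall y, D y -> 0 <= g y) ->
  0 < c -> (\forall y \near x, D y /\ c <= g y) ->
  (0 < \int[@dV R]_(y in D) (g y)%:E)%E.
Proof.
move=> mD mg g0 c0 /near_R4P[w w0 wP].
pose I (a : R) : set mR := `[a - w, a + w]%classic.
pose B : set (mR4 R) := (I x.1.1 `*` I x.1.2) `*` (I x.2.1 `*` I x.2.2).
have mB : measurable B by apply: measurableX; apply: measurableX; exact: measurable_itv.
have Bx y : B y -> D y /\ c <= g y.
  move=> [[/= h1 h2] [/= h3 h4]]; apply: wP.
  move: h1 h2 h3 h4; rewrite /I /= !in_itv/= => h1 h2 h3 h4.
  by rewrite !prod_normE /= !ge_max !ler_norml; apply/andP; split; apply/andP; split; apply/andP; lra.
have BD : B `<=` D by move=> y /Bx[].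
apply: (@lt_le_trans _ _ (\int[@dV R]_(y in B) (cst c%:E) y)%E).
  have le a : a - w <= a + w by lra.
  rewrite integral_cst// /B [X in (_ * X)%E](dV_box (le _) (le _) (le _) (le _)).
  by rewrite -EFinM lte_fin !mulr_gt0//; lra.
apply: (@le_trans _ _ (\int[@dV R]_(y in B) (g y)%:E)%E).
  apply: ge0_le_integral => //.
  - by move=> y _; rewrite lee_fin ltW.
  - by apply/measurable_EFinP; exact: measurable_funS mg.
  - by move=> y /Bx[_ cg]; rewrite lee_fin.
by apply: ge0_subset_integral => //; exact/measurable_EFinP.
Qed.

Lemma cmod_continuous_z1 : continuous (fun x : R4 R => cmod (toC2 x).1).
Proof.
move=> x; rewrite /continuous_at.
have E (y : R4 R) : cmod (toC2 y).1 = Num.sqrt (coord4 (@Ordinal 4 0 isT) y ^+ 2 + coord4 (@Ordinal 4 1 isT) y ^+ 2).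
  by rewrite cmod_def.
under eq_fun do rewrite E; rewrite E.
have c (i : 'I_4) : {for x, continuous (fun y => coord4 i y ^+ 2)}.
  by apply: (@smc_continuous R); apply: smc_mul; exact: smc_coordinate.
exact: (cvg_comp _ _ (cvgD (c _) (c _)) (@sqrt_continuous R _)).
Qed.

Lemma cmod_continuous_z2 : continuous (fun x : R4 R => cmod (toC2 x).2).
Proof.
move=> x; rewrite /continuous_at.
have E (y : R4 R) : cmod (toC2 y).2 = Num.sqrt (coord4 (@Ordinal 4 2 isT) y ^+ 2 + coord4 (@Ordinal 4 3 isT) y ^+ 2).
  by rewrite cmod_def.
under eq_fun do rewrite E; rewrite E.
have c (i : 'I_4) : {for x, continuous (fun y => coord4 i y ^+ 2)}.
  by apply: (@smc_continuous R); apply: smc_mul; exact: smc_coordinate.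
exact: (cvg_comp _ _ (cvgD (c _) (c _)) (@sqrt_continuous R _)).
Qed.

End Near.

Section NearH.
Variable R : realType.
Variables (m n : nat).
Hypotheses (m_gt0 : (0 < m)%N) (n_gt0 : (0 < n)%N).
Local Notation H := (Hgamma (m%:R / n%:R : R)).

Lemma open_H4 : open (real_domain H : set (R4 R)).
Proof.
rewrite openE => x /=; rewrite /real_domain/= => /(HgammaP m n_gt0)[h1 h2].
have a1 : {for x, continuous (fun y : R4 R => cmod (toC2 y).1 ^+ m)}.
  by apply: (continuous_comp (f := fun y : R4 R => cmod (toC2 y).1) (g := fun a => a ^+ m));
    [exact: cmod_continuous_z1|exact: exprn_continuous].
have a2 : {for x, continuous (fun y : R4 R => cmod (toC2 y).2 ^+ n)}.
  by apply: (continuous_comp (f := fun y : R4 R => cmod (toC2 y).2) (g := fun a => a ^+ n));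
    [exact: cmod_continuous_z2|exact: exprn_continuous].
have c1 : {for x, continuous (fun y : R4 R => cmod (toC2 y).2 ^+ n - cmod (toC2 y).1 ^+ m)}.
  exact: cvgB a2 a1.
rewrite -subr_gt0 in h1; near=> y; apply/(HgammaP m n_gt0); split.
  by rewrite -subr_gt0; near: y; exact: (cvgr_gt _ c1 _ h1).
by near: y; exact: (cvgr_lt _ (@cmod_continuous_z2 R x) _ h2).
Unshelve. all: by end_near. Qed.

Lemma near_H4 (x : R4 R) : H (toC2 x) -> \forall y \near x, H (toC2 y).
Proof. by have := open_H4; rewrite openE => /(_ x); exact. Qed.

Lemma near_H2 (z : C2 R) : H z -> \forall z' \near z, H z'.
Proof.
by move=> hz; rewrite -(fromC2K z); apply: near_R4_C2; apply: near_H4; rewrite fromC2K.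
Qed.

(** A property that holds near the base point holds on a small box, whose
dilations are all in the domain. *)
Lemma boxS_nearP (P : R4 R -> Prop) : (\forall x \near base R n, P x) ->
  exists w, [/\ 0 < w, w <= 8^-1,
    forall x, boxS m n w 0 x -> P x & forall i, boxS m n w i `<=` real_domain H].
Proof.
move=> Pb; have nb : \forall x \near base R n, P x /\ H (toC2 x).
  by apply: filterI => //; apply: near_H4; exact: base_in_H.
have [d d0 dP] := near_R4P nb.
have w0 : 0 < Num.min d 8^-1 by rewrite lt_min d0 invr_gt0 ltr0n.
exists (Num.min d 8^-1); split => //; first by rewrite ge_min lexx orbT.
  by move=> x /boxS_near xw; apply: (dP x _).1; rewrite (le_trans xw)// ge_min lexx.
move=> i x /boxS_dil[y /boxS_near yw ->]; apply: H_dil => //.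
by apply: (dP y _).2; rewrite (le_trans yw)// ge_min lexx.
Qed.

End NearH.

(** * Derivatives and non-integrability of the monomials *)

Section Projections.
Variables (K : numFieldType) (U V : normedModType K).

Lemma is_derive_fst (z v : U * V) : is_derive z v fst v.1.
Proof.
have c : h^-1 *: ((fst \o shift z) (h *: v) - fst z) @[h --> (0 : K)^'] --> v.1.
  apply: cvg_near_cst; near=> h.
  rewrite /= addrK scalerA mulVf ?scale1r//.
  by near: h; exact: nbhs_dnbhs_neq.
by split; [exact: cvgP c|exact: cvg_lim c].
Unshelve. all: by end_near. Qed.

Lemma is_derive_snd (z v : U * V) : is_derive z v snd v.2.
Proof.
have c : h^-1 *: ((snd \o shift z) (h *: v) - snd z) @[h --> (0 : K)^'] --> v.2.
  apply: cvg_near_cst; near=> h.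
  rewrite /= addrK scalerA mulVf ?scale1r//.
  by near: h; exact: nbhs_dnbhs_neq.
by split; [exact: cvgP c|exact: cvg_lim c].
Unshelve. all: by end_near. Qed.

Lemma differentiable_fst (z : U * V) : differentiable (fst : U * V -> U) z.
Proof. by apply: linear_differentiable => w; exact: cvg_fst. Qed.

Lemma differentiable_snd (z : U * V) : differentiable (snd : U * V -> V) z.
Proof. by apply: linear_differentiable => w; exact: cvg_snd. Qed.
End Projections.

Section Mono.
Variable R : realType.
Variables (m n : nat).
Hypotheses (m_gt0 : (0 < m)%N) (n_gt0 : (0 < n)%N).
Local Notation H := (Hgamma (m%:R / n%:R : R)).

(** The growth exponent of the monomial [z1^a z2^-b] under the dilations is
[D = m b - n a]. *)
Lemma rho_scale (a b D i : nat) : (m * b = n * a + D)%N ->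
  rho R n i ^+ a * (rho R m i)^-1 ^+ b = 2 ^+ (i * D).
Proof.
move=> E; rewrite /rho -exprM !exprVn invrK -exprM.
rewrite (_ : (m * i * b = n * i * a + i * D)%N); last first.
  by transitivity (i * (m * b))%N; [ring|rewrite E; ring].
by rewrite exprD mulKf// expf_neq0// pnatr_eq0.
Qed.

Lemma cmod_mono_dil (a b D i : nat) (x : R4 R) : (m * b = n * a + D)%N ->
  cmod (mono a b (toC2 (dil m n i x))) = 2 ^+ (i * D) * cmod (mono a b (toC2 x)).
Proof.
move=> E; rewrite mono_dil cmodM cmod_real (rho_scale i E) ger0_norm//.
Qed.

Lemma cmod_mono_cont a b (x : R4 R) : (toC2 x).2 != 0 ->
  {for x, continuous (fun y : R4 R => cmod (mono a b (toC2 y)))}.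
Proof.
move=> x0.
have E : (fun y : R4 R => cmod (mono a b (toC2 y))) =
    (fun y : R4 R => cmod (toC2 y).1 ^+ a * (cmod (toC2 y).2)^-1 ^+ b).
  by apply/funext => y; rewrite cmod_mono.
have a1 : {for x, continuous (fun y : R4 R => cmod (toC2 y).1 ^+ a)}.
  by apply: (continuous_comp (f := fun y : R4 R => cmod (toC2 y).1) (g := fun c => c ^+ a));
    [exact: cmod_continuous_z1|exact: exprn_continuous].
have a2 : {for x, continuous (fun y : R4 R => (cmod (toC2 y).2)^-1 ^+ b)}.
  apply: (continuous_comp (f := fun y : R4 R => (cmod (toC2 y).2)^-1) (g := fun c => c ^+ b));
    last exact: exprn_continuous.
  by apply: cvgV; [rewrite cmod_eq0|exact: cmod_continuous_z2].
by rewrite E; exact: cvgM a1 a2.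
Qed.

(** On the [i]-th box the [q]-th power of the monomial is at least
[2^(i D q)] times a constant, and the volume of the box is a constant times
[2^(-i (2 m + 2 n))]. *)
Lemma mono_not_Lp (a b D : nat) (c : R[i]) (q : R) (g : C2 R -> R[i]) :
  (m * b = n * a + D)%N -> c != 0 -> 0 < q ->
  (2 * m + 2 * n)%:R <= D%:R * q ->
  (forall z, H z -> g z = c * mono a b z) -> ~ Lp q H g.
Proof.
move=> E c0 q0 Dq gE [_ _]; apply/negP; rewrite -leNgt leye_eq; apply/eqP.
pose G (x : R4 R) := cmod (c * mono a b (toC2 x)).
have GE x : G x = cmod c * cmod (mono a b (toC2 x)) by rewrite /G cmodM.
have hb := base_in_H R m_gt0 n_gt0.
have Gb : 0 < G (base R n).
  rewrite /G cmod_gt0 mulf_neq0// /mono mulf_neq0// expf_neq0//.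
    rewrite -cmod_gt0 /toC2 /base /= complexr0 cmod_real gtr0_norm ?exprn_gt0 ?invr_gt0//.
  by rewrite invr_eq0 (Hgamma_neq0 hb).
have nG : \forall x \near base R n, G (base R n) / 2 <= G x.
  have cG : {for base R n, continuous G}.
    have -> : G = fun x => cmod c * cmod (mono a b (toC2 x)) by apply/funext => x; rewrite GE.
    have b0 : {for base R n, continuous (fun _ : R4 R => cmod c)} by exact: cvg_cst.
    have b1 := @cmod_mono_cont a b (base R n) (Hgamma_neq0 hb).
    exact: cvgM b0 b1.
  near=> x; apply: ltW; near: x.
  by apply: (cvgr_gt _ cG); rewrite ltr_pdivrMr// ltr_pMr// ltr1n.
have [w [w0 w8 wP SH]] := boxS_nearP m_gt0 n_gt0 nG.
set k := G (base R n) / 2 in wP.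
have k0 : 0 < k by rewrite divr_gt0.
rewrite (eq_integral (fun x : mR4 R => ((G x) `^ q)%:E)); last first.
  by move=> x /set_mem xH; rewrite gE.
have mG : measurable_fun setT (fun x : mR4 R => (G x) `^ q).
  apply: (measurableT_comp (@measurable_powR R q)).
  have -> : G = fun x => cmod c * cmod (mono a b (toC2 x)) by apply/funext => x; rewrite GE.
  by apply: measurable_funM => //; exact: mono_measurable.
apply: (@integral_boxS_pinfty R m n m_gt0 w (k `^ q * (16 * w ^+ 4))) => //.
- by rewrite !mulr_gt0 ?powR_gt0 ?exprn_gt0.
- exact: measurable_H.
- by apply/measurable_EFinP; exact: measurable_funTS.
- by move=> x; rewrite lee_fin powR_ge0.
move=> i; pose M := (2 ^+ (i * D) * k) `^ q.
apply: (@le_trans _ _ (\int[@dV R]_(x in boxS m n w i) (cst M%:E) x)%E).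
  rewrite integral_cst; last exact: measurable_boxS.
  rewrite [X in (_ * X)%E](dV_boxS m n i (ltW w0)) -EFinM lee_fin.
  rewrite /M powRM ?exprn_ge0 ?(ltW k0)// mulrAC mulrC.
  have V : rho R n i ^+ 2 * rho R m i ^+ 2 = (2 ^+ (i * (2 * m + 2 * n)))^-1.
    by rewrite /rho -!exprM -exprD exprVn; congr (_ ^+ _)^-1; ring.
  rewrite V; set A := (2 ^+ (i * D)) `^ q; set B := 2 ^+ _.
  have B0 : 0 < B by exact: exprn_gt0.
  suff AB : B <= A.
    rewrite [leRHS](_ : _ = (A / B) * (16 * w ^+ 4 * k `^ q)); last by ring.
    rewrite [leLHS](_ : _ = 1 * (16 * w ^+ 4 * k `^ q)); last by ring.
    by rewrite ler_wpM2r ?ler_pdivlMr ?mul1r// !mulr_ge0 ?powR_ge0 ?exprn_ge0// ltW.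
  rewrite /A /B -!powR_mulrn// -powRrM ler_powR ?ler1n// !natrM -mulrA ler_wpM2l//.
apply: ge0_le_integral.
- exact: measurable_boxS.
- by move=> x _; rewrite lee_fin powR_ge0.
- exact: measurable_cst.
- by apply/measurable_EFinP; exact: measurable_funTS.
move=> x /boxS_dil[y yS xy]; rewrite /M /cst lee_fin.
have kG : 2 ^+ (i * D) * k <= G x.
  rewrite xy GE (cmod_mono_dil _ _ E) (mulrCA (cmod c)) -GE.
  by apply: ler_wpM2l; [exact: exprn_ge0|exact: wP].
have k1 : 0 <= 2 ^+ (i * D) * k by apply: mulr_ge0; [exact: exprn_ge0|exact: ltW].
apply: ge0_ler_powR kG; rewrite ?nnegrE; [exact: ltW|exact: k1|exact: cmod_ge0].
Unshelve. all: by end_near. Qed.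

Lemma is_derive_z1 (z v : C2 R) : is_derive z v (fun w : C2 R => w.1 : R[i]^o) v.1.
Proof. exact: is_derive_fst. Qed.

Lemma is_derive_z2 (z v : C2 R) : is_derive z v (fun w : C2 R => w.2 : R[i]^o) v.2.
Proof. exact: is_derive_snd. Qed.

Lemma is_derive_mono (a b : nat) (z v : C2 R) : z.2 != 0 ->
  is_derive z v (mono a b : C2 R -> R[i]^o)
    (a%:R * v.1 * mono a.-1 b z - b%:R * v.2 * mono a b.+1 z).
Proof.
move=> z0.
have h1 := @is_deriveX _ _ _ a z v _ (is_derive_z1 z v).
have hV : is_derive z v (fun w : C2 R => (w.2^-1 : R[i]^o)) (- z.2 ^- 2 * v.2).
  have [d1 d2] := is_derive_z2 z v.
  by split; [exact: derivableV|rewrite (deriveV z0 d1) d2].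
have h2 := @is_deriveX _ _ _ b z v _ hV.
have h12 := is_deriveM h1 h2.
have M : (mono a b : C2 R -> R[i]^o) =
    ((fun w : C2 R => w.1 : R[i]^o) ^+ a : C2 R -> R[i]^o) *
    ((fun w : C2 R => w.2^-1 : R[i]^o) ^+ b : C2 R -> R[i]^o).
  by apply/funext => w; rewrite /mono !fctE.
have E (f : C2 R -> R[i]^o) x y : x = y -> is_derive z v f x -> is_derive z v f y by move=> ->.
rewrite M; apply: E h12; rewrite /GRing.scale /= !fctE /mono.
rewrite [X in X + _]mulrC; case: b {h2 M} => [|b] /=.
  by rewrite !mul0r !expr0 subr0; ring.
rewrite -(exprVn z.2 2); set y := z.2^-1; rewrite !exprS; ring.
Qed.

Lemma differentiable_z1 (z : C2 R) : differentiable (fun w : C2 R => w.1 : R[i]^o) z.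
Proof. exact: differentiable_fst. Qed.

Lemma differentiable_z2 (z : C2 R) : differentiable (fun w : C2 R => w.2 : R[i]^o) z.
Proof. exact: differentiable_snd. Qed.

Lemma differentiable_pow (f : C2 R -> R[i]) k (z : C2 R) :
  differentiable (f : C2 R -> R[i]^o) z ->
  differentiable (fun w => f w ^+ k : R[i]^o) z.
Proof.
case: k => [|k] df.
  by rewrite (_ : (fun _ => _) = cst 1)//; exact: differentiable_cst.
have -> : (fun w => f w ^+ k.+1 : R[i]^o) = (f : C2 R -> R[i]^o) ^+ k.+1.
  by apply/funext => w; rewrite fctE.
exact: differentiableX.
Qed.

Lemma differentiable_mul (f g : C2 R -> R[i]) (z : C2 R) :
  differentiable (f : C2 R -> R[i]^o) z -> differentiable (g : C2 R -> R[i]^o) z ->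
  differentiable (fun w => f w * g w : R[i]^o) z.
Proof. by move=> df dg; exact: (@differentiableM _ _ f g z df dg). Qed.

Lemma differentiable_mono a b (z : C2 R) : z.2 != 0 ->
  differentiable (mono a b : C2 R -> R[i]^o) z.
Proof.
move=> z0; apply: differentiable_mul; apply: differentiable_pow.
  exact: differentiable_z1.
by apply: (@differentiableV _ _ (fun w : C2 R => w.2)) => //; exact: differentiable_z2.
Qed.

Lemma shift_z1 (h : R[i]) (z : C2 R) : h *: ((1, 0) : C2 R) + z = (z.1 + h, z.2).
Proof.
case: z => a b; have -> : h *: ((1, 0) : C2 R) = (h *: (1 : R[i]^o), h *: (0 : R[i]^o)) by [].
by rewrite scaler0 [h *: _]mulr1; congr pair => /=; rewrite ?add0r// addrC.
Qed.

Lemma shift_z2 (h : R[i]) (z : C2 R) : h *: ((0, 1) : C2 R) + z = (z.1, z.2 + h).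
Proof.
case: z => a b; have -> : h *: ((0, 1) : C2 R) = (h *: (0 : R[i]^o), h *: (1 : R[i]^o)) by [].
by rewrite scaler0 [h *: _]mulr1; congr pair => /=; rewrite ?add0r// addrC.
Qed.

Lemma derivable_approxC (G : C2 R -> R[i]) (z v : C2 R) :
  derivable (G : C2 R -> R[i]^o) z v -> forall e, 0 < e ->
  exists2 d, 0 < d & forall h, cmod h <= d ->
    cmod (G (h *: v + z) - G z - 'D_v (G : C2 R -> R[i]^o) z * h) <= e * cmod h.
Proof.
move=> dG e e0; have e0C : 0 < (e%:C)%C :> R[i] by rewrite ltcR.
have [d d0 dP] := derivable_approx dG e0C.
have [r dE] : exists r : R, d = (r%:C)%C by exists (cmod d); rewrite -cmodE gtr0_norm.
rewrite {}dE ltcR in d0 dP; exists r => // h hd.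
by have := dP h; rewrite !cmodE lecR => /(_ hd); rewrite -rmorphM lecR (mulrC h).
Qed.

Lemma differentiable_cdiff1 (G : C2 R -> R[i]) (z : C2 R) :
  differentiable (G : C2 R -> R[i]^o) z -> cdiff (fun w => G (w, z.2)) z.1.
Proof.
move=> dG; have d1 : derivable (G : C2 R -> R[i]^o) z (1, 0) by exact: diff_derivable.
exists ('D_((1, 0) : C2 R) (G : C2 R -> R[i]^o) z) => e /(derivable_approxC d1)[d d0 dP].
by exists d => // h /dP; rewrite shift_z1; case: (z).
Qed.

Lemma differentiable_cdiff2 (G : C2 R -> R[i]) (z : C2 R) :
  differentiable (G : C2 R -> R[i]^o) z -> cdiff (fun w => G (z.1, w)) z.2.
Proof.
move=> dG; have d1 : derivable (G : C2 R -> R[i]^o) z (0, 1) by exact: diff_derivable.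
exists ('D_((0, 1) : C2 R) (G : C2 R -> R[i]^o) z) => e /(derivable_approxC d1)[d d0 dP].
by exists d => // h /dP; rewrite shift_z2; case: (z).
Qed.

Lemma differentiable_cont (G : C2 R -> R[i]) (z : C2 R) :
  differentiable (G : C2 R -> R[i]^o) z ->
  forall e : R, 0 < e -> \forall z' \near z, cmod (G z' - G z) < e.
Proof.
move=> /differentiable_continuous cG e e0.
have e0C : 0 < (e%:C)%C :> R[i] by rewrite ltcR.
have /cvgrPdist_lt/(_ _ e0C) := cG.
by apply: filterS => z'; rewrite cmodE ltcR -opprB cmodN.
Qed.

(** The values of [g] off the domain are arbitrary; as the domain is open
they do not affect the derivatives in it. *)
Lemma derive_eq_mono (g : C2 R -> R[i]) (c : R[i]) a b (v z : C2 R) :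
  (forall z, H z -> g z = c * mono a b z) -> H z ->
  'D_v (g : C2 R -> R[i]^o) z =
    c * (a%:R * v.1 * mono a.-1 b z - b%:R * v.2 * mono a b.+1 z).
Proof.
move=> gE hz.
have gn : \near z, (g : C2 R -> R[i]^o) z = (fun w => c * mono a b w : R[i]^o) z.
  by near=> w; apply: gE; near: w; exact: (near_H2 n_gt0 hz).
rewrite (near_eq_derive v gn).
have h := is_derive_mono a b v (Hgamma_neq0 hz).
have [_ ->] : is_derive z v (fun w => c * mono a b w : R[i]^o) _ := is_deriveZ c h.
by [].
Unshelve. all: by end_near. Qed.

Lemma dz1_mono g c a b : (forall z, H z -> g z = c * mono a b z) ->
  forall z, H z -> dz1 g z = (c * a%:R) * mono a.-1 b z.
Proof.
by move=> gE z hz; rewrite /dz1 (derive_eq_mono _ gE hz) /= mulr0 mul0r subr0 mulr1 mulrA.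
Qed.

Lemma dz2_mono g c a b : (forall z, H z -> g z = c * mono a b z) ->
  forall z, H z -> dz2 g z = (c * - b%:R) * mono a b.+1 z.
Proof.
by move=> gE z hz; rewrite /dz2 (derive_eq_mono _ gE hz) /= mulr0 mul0r sub0r mulr1 -mulNr mulrA.
Qed.

Lemma iter_dz_mono (g : C2 R -> R[i]) (c : R[i]) a b j l :
  c != 0 -> (j <= a)%N -> (0 < b)%N ->
  (forall z, H z -> g z = c * mono a b z) ->
  exists2 c' : R[i], c' != 0 & forall z, H z ->
    iter j (@dz1 R) (iter l (@dz2 R) g) z = c' * mono (a - j) (b + l) z.
Proof.
move=> c0 ja b0 gE.
have [c1 c10 E1] : exists2 c' : R[i], c' != 0 & forall z, H z ->
    iter l (@dz2 R) g z = c' * mono a (b + l) z.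
  elim: l => [|l [c' c'0 IH]]; first by exists c => // z; rewrite addn0; exact: gE.
  exists (c' * - (b + l)%:R).
    by rewrite mulf_neq0// oppr_eq0 pnatr_eq0 -lt0n addn_gt0 b0.
  by move=> z hz; rewrite iterS (dz2_mono IH hz) addnS.
elim: j ja => [|j IH] ja; first by exists c1 => // z; rewrite subn0; exact: E1.
have [c' c'0 E] := IH (ltnW ja).
exists (c' * (a - j)%:R).
  by rewrite mulf_neq0// pnatr_eq0 subn_eq0 -ltnNge.
by move=> z hz; rewrite iterS (dz1_mono E hz) subnS.
Qed.

End Mono.

(** * The Bergman projection of z1^p conj(z2)^N *)

Lemma cmod_near_sqr (R : realType) (a b : R[i]) :
  cmod (b - a) < cmod a / 2 -> (cmod a / 2) ^+ 2 <= cmod b ^+ 2.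
Proof.
move=> ba; have := cmodD b (a - b); rewrite addrC subrK -opprB cmodN => ab.
have ha := cmod_ge0 a; have hb := cmod_ge0 b.
have l : cmod a / 2 <= cmod b by lra.
by apply: lerXn2r l; rewrite nnegrE//; lra.
Qed.

Section L2.
Variable R : realType.
Variables (m n : nat).
Hypotheses (m_gt0 : (0 < m)%N) (n_gt0 : (0 < n)%N).
Local Notation H := (Hgamma (m%:R / n%:R : R)).
Local Notation D := (real_domain H : set (mR4 R)).
Local Notation mR := (measurableTypeR R).

Let mD : measurable D. Proof. exact: measurable_H. Qed.

Lemma dV_H_fin : (dV R D < +oo)%E.
Proof.
apply: (@le_lt_trans _ _ (dV R (boxB m n 0 : set (mR4 R)))); last by rewrite [ltLHS](dV_boxB R m n 0) ltry.
apply: le_measure; rewrite ?inE//.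
  by apply: measurableX; apply: measurableX; exact: measurable_itv.
move=> x /(H_bounds m_gt0 n_gt0)[h1 /andP[_ h2]].
by apply: boxB_mem; rewrite /rho muln0 expr0 ltW.
Qed.

(** The exponent of [Lp] is a real power; in [L^2] the square is the natural
power, for which algebra is available. *)
Lemma Lp2P (F : C2 R -> R[i]) : Lp 2 H F <->
  [/\ measurable_fun D (fun x => complex.Re (F (toC2 x))),
      measurable_fun D (fun x => complex.Im (F (toC2 x))) &
      (@dV R).-integrable D (fun x => (cmod (F (toC2 x)) ^+ 2)%:E)].
Proof.
have E : (\int[@dV R]_(x in D) (cmod (F (toC2 x)) `^ 2)%:E =
    \int[@dV R]_(x in D) (cmod (F (toC2 x)) ^+ 2)%:E)%E.
  by apply: eq_integral => x _; rewrite powR_mulrn ?cmod_ge0.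
have A : (\int[@dV R]_(x in D) `|(cmod (F (toC2 x)) ^+ 2)%:E| =
    \int[@dV R]_(x in D) (cmod (F (toC2 x)) ^+ 2)%:E)%E.
  by apply: eq_integral => x _; rewrite gee0_abs// lee_fin sqr_ge0.
split=> [[m1 m2 fi]|[m1 m2 /integrableP[_ fi]]]; split => //; last first.
  by rewrite E -A.
apply/integrableP; split; last by rewrite A -E.
apply/measurable_EFinP; under eq_fun do rewrite cmod_sqr.
by apply: measurable_funD; exact: measurable_funX.
Qed.

(** [2 |F G| <= |F|^2 + |G|^2]. *)
Lemma Lp2_prod (F G : C2 R -> R[i]) : Lp 2 H F -> Lp 2 H G ->
  (@dV R).-integrable D (fun x => (complex.Re (F (toC2 x) * ((G (toC2 x))^*)%C))%:E) /\
  (@dV R).-integrable D (fun x => (complex.Im (F (toC2 x) * ((G (toC2 x))^*)%C))%:E).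
Proof.
move=> /Lp2P[f1 f2 fi] /Lp2P[g1 g2 gi].
have i2 := integrableD mD fi gi.
have bnd x : cmod (F (toC2 x) * ((G (toC2 x))^*)%C) <=
    cmod (F (toC2 x)) ^+ 2 + cmod (G (toC2 x)) ^+ 2.
  rewrite cmodM cmod_conj; have := cmod_ge0 (F (toC2 x)); have := cmod_ge0 (G (toC2 x)).
  by have := sqr_ge0 (cmod (F (toC2 x)) - cmod (G (toC2 x))); nra.
have fin (x : R4 R) : (`|((cmod (F (toC2 x)) ^+ 2)%:E + (cmod (G (toC2 x)) ^+ 2)%:E)|%E) =
    (cmod (F (toC2 x)) ^+ 2 + cmod (G (toC2 x)) ^+ 2)%:E.
  by rewrite gee0_abs// lee_fin addr_ge0// sqr_ge0.
split; apply: (le_integrable _ _ _ i2) => //.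
- apply/measurable_EFinP.
  rewrite (_ : (fun _ => _) = fun x => complex.Re (F (toC2 x)) * complex.Re (G (toC2 x)) +
    complex.Im (F (toC2 x)) * complex.Im (G (toC2 x))).
    by apply: measurable_funD; exact: measurable_funM.
  by apply/funext => x; case: (F _) => a b; case: (G _) => c d /=; ring.
- by move=> x _; rewrite fin lee_fin (le_trans (ler_Re_cmod _)).
- apply/measurable_EFinP.
  rewrite (_ : (fun _ => _) = fun x => complex.Im (F (toC2 x)) * complex.Re (G (toC2 x)) -
    complex.Re (F (toC2 x)) * complex.Im (G (toC2 x))).
    by apply: measurable_funB; exact: measurable_funM.
  by apply/funext => x; case: (F _) => a b; case: (G _) => c d /=; ring.
- by move=> x _; rewrite fin lee_fin (le_trans (ler_Im_cmod _)).
Qed.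

Lemma Lp2_sub (F G : C2 R -> R[i]) : Lp 2 H F -> Lp 2 H G ->
  Lp 2 H (fun z => F z - G z).
Proof.
move=> /Lp2P[f1 f2 fi] /Lp2P[g1 g2 gi]; apply/Lp2P.
have mr : measurable_fun D (fun x => complex.Re (F (toC2 x) - G (toC2 x))).
  rewrite (_ : (fun _ => _) = fun x => complex.Re (F (toC2 x)) - complex.Re (G (toC2 x))).
    exact: measurable_funB.
  by apply/funext => x; case: (F _) => a b; case: (G _).
have mi : measurable_fun D (fun x => complex.Im (F (toC2 x) - G (toC2 x))).
  rewrite (_ : (fun _ => _) = fun x => complex.Im (F (toC2 x)) - complex.Im (G (toC2 x))).
    exact: measurable_funB.
  by apply/funext => x; case: (F _) => a b; case: (G _).
split => //.
apply: (le_integrable _ _ _ (integrableZl mD 2 (integrableD mD fi gi))) => //.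
  apply/measurable_EFinP; under eq_fun do rewrite cmod_sqr.
  by apply: measurable_funD; exact: measurable_funX.
move=> x _; rewrite -EFinD -EFinM !gee0_abs ?lee_fin ?sqr_ge0//; last first.
  by rewrite mulr_ge0// addr_ge0// sqr_ge0.
have := cmodD (F (toC2 x)) (- G (toC2 x)); rewrite cmodN.
have := cmod_ge0 (F (toC2 x)); have := cmod_ge0 (G (toC2 x)).
have := cmod_ge0 (F (toC2 x) - G (toC2 x)).
have := sqr_ge0 (cmod (F (toC2 x)) - cmod (G (toC2 x))).
by nra.
Qed.

Lemma Lp2_scale (c : R[i]) (F : C2 R -> R[i]) : Lp 2 H F -> Lp 2 H (fun z => c * F z).
Proof.
move=> /Lp2P[f1 f2 fi]; apply/Lp2P; split.
- rewrite (_ : (fun _ => _) = fun x => complex.Re c * complex.Re (F (toC2 x)) -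
    complex.Im c * complex.Im (F (toC2 x))).
    by apply: measurable_funB; apply: measurable_funM.
  by apply/funext => x; case: (F _) => a b; case: (c).
- rewrite (_ : (fun _ => _) = fun x => complex.Re c * complex.Im (F (toC2 x)) +
    complex.Im c * complex.Re (F (toC2 x))).
    by apply: measurable_funD; apply: measurable_funM.
  by apply/funext => x; case: (F _) => a b; case: (c).
- have := integrableZl mD (cmod c ^+ 2) fi; apply: eq_integrable => // x _.
  by rewrite cmodM exprMn EFinM.
Qed.

Lemma Lp2_bounded (F : C2 R -> R[i]) (B : R) :
  cmeasurable (fun x => F (toC2 x)) -> (forall z, H z -> cmod (F z) <= B) -> Lp 2 H F.
Proof.
move=> [m1 m2] FB; apply/Lp2P; split; [exact: measurable_funTS|exact: measurable_funTS|].
apply: measurable_bounded_integrable => //; first exact: dV_H_fin.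
  by apply: measurable_funX; apply: measurable_funTS; exact: cmod_measurable.
exists (B ^+ 2); split; first exact: num_real.
move=> M BM x /FB Fx /=; rewrite ger0_norm ?sqr_ge0// (le_trans _ (ltW BM))//.
by rewrite ler_sqr ?nnegrE ?cmod_ge0// (le_trans (cmod_ge0 _) Fx).
Qed.

Variables (p N : nat).
Hypotheses (p_gt0 : (0 < p)%N).
Hypothesis pN : (n * p.+1 + m = m * N + 1)%N.

(** The polynomial whose projection is singular: it has the same behaviour
as [mono p N] under rotations of both coordinates. *)
Definition conj_mono (z : C2 R) : R[i] := z.1 ^+ p * ((z.2^*)%C) ^+ N.

Definition normA := \int[@dV R]_(x in D) (cmod (mono p 0 (toC2 x)) ^+ 2).
Definition normB := \int[@dV R]_(x in D) (cmod (mono p N (toC2 x)) ^+ 2).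
(** [<conj_mono, e> / <e, e>] with [e = mono p N]: the product
[conj_mono * conj e] equals [|z1^p|^2], the integrand of [normA]. *)
Definition proj_coef : R := normA / normB.
Definition proj_mono (z : C2 R) : R[i] := (proj_coef%:C)%C * mono p N z.

Lemma cmod_mono0_le1 z : H z -> cmod (mono p 0 z) <= 1.
Proof.
move=> /(H_bounds m_gt0 n_gt0)[h1 _]; rewrite cmod_mono expr0 mulr1.
by rewrite exprn_ile1 ?cmod_ge0// ltW.
Qed.

Lemma cmod_conj_mono z : cmod (conj_mono z) = cmod z.1 ^+ p * cmod z.2 ^+ N.
Proof. by rewrite /conj_mono cmodM !cmodX cmod_conj. Qed.

Lemma Lp2_conj_mono : Lp 2 H conj_mono.
Proof.
apply: (@Lp2_bounded _ 1).
  apply: cmeasurableM; apply: cmeasurableX; first exact: cmeasurable_z1.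
  have [r i] := cmeasurable_z2 R; split.
    by rewrite (_ : (fun _ => _) = fun x : mR4 R => complex.Re (toC2 x).2).
  by rewrite (_ : (fun _ => _) = fun x : mR4 R => - complex.Im (toC2 x).2)//; exact: measurable_funN.
move=> z /(H_bounds m_gt0 n_gt0)[h1 /andP[_ h2]]; rewrite cmod_conj_mono.
by rewrite -[leRHS]mulr1 ler_pM ?exprn_ge0 ?cmod_ge0// exprn_ile1 ?cmod_ge0// ltW.
Qed.

Lemma Lp2_mono0 : Lp 2 H (mono p 0).
Proof. by apply: (@Lp2_bounded _ 1); [exact: cmeasurable_mono|exact: cmod_mono0_le1]. Qed.

Lemma Lp2_mono : Lp 2 H (mono p N).
Proof.
have [m1 m2] := cmeasurable_mono R p N; split; [exact: measurable_funTS|exact: measurable_funTS|].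
have := mono_L2 R m_gt0 n_gt0 pN; congr (_ < _)%E.
by apply: eq_integral => x _; rewrite powR_mulrn ?cmod_ge0.
Qed.

Lemma bergman_mono : bergman_space H (mono p N).
Proof.
by split; [move=> z /Hgamma_neq0 z0; exact: differentiable_mono|exact: Lp2_mono].
Qed.

Lemma bergman_sub g h : bergman_space H g -> bergman_space H h ->
  bergman_space H (fun z => g z - h z).
Proof.
move=> [dg lg] [dh lh]; split; last exact: Lp2_sub.
by move=> z hz; apply: differentiableB; [exact: dg|exact: dh].
Qed.

Lemma bergman_scale c h : bergman_space H h -> bergman_space H (fun z => c * h z).
Proof.
move=> [dh lh]; split; last exact: Lp2_scale.
move=> z hz; apply: differentiable_mul; [exact: differentiable_cst|exact: dh].
Qed.

Lemma norm_gt0 b : Lp 2 H (mono p b) ->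
  0 < \int[@dV R]_(x in D) (cmod (mono p b (toC2 x)) ^+ 2).
Proof.
move=> /Lp2P[_ _ fi]; have hb := base_in_H R m_gt0 n_gt0.
pose k := cmod (mono p b (toC2 (base R n))).
have b0 : 0 < k.
  rewrite /k cmod_gt0 /mono mulf_neq0// expf_neq0//; last first.
    by rewrite invr_eq0 (Hgamma_neq0 hb).
  by rewrite -cmod_gt0 /toC2 /base /= complexr0 cmod_real gtr0_norm ?exprn_gt0 ?invr_gt0.
rewrite /Rintegral fine_gt0//; apply/andP; split; last first.
  by have := integrable_fin_num mD fi; rewrite fin_numE => /andP[_]; rewrite lt_neqAle leey andbT.
apply: (@integral_gt0 R D _ (base R n) ((k / 2) ^+ 2)) => //.
- by apply/measurable_EFinP; exact: measurable_int fi.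
- by move=> y _; exact: sqr_ge0.
- by rewrite exprn_gt0// divr_gt0.
have k2 : k / 2 < k by rewrite ltr_pdivrMr// ltr_pMr// ltr1n.
have nb : \forall t \near base R n, k / 2 < cmod (mono p b (toC2 t)).
  by apply: (cvgr_gt _ (@cmod_mono_cont R p b (base R n) (Hgamma_neq0 hb)) _ k2).
apply: filterS (filterI (near_H4 n_gt0 hb) nb) => y [hy /ltW yb]; split => //.
by apply: lerXn2r yb; rewrite nnegrE ?cmod_ge0// divr_ge0// ltW.
Qed.

Lemma proj_coef_gt0 : 0 < proj_coef.
Proof. by rewrite divr_gt0//; apply: norm_gt0; [exact: Lp2_mono0|exact: Lp2_mono]. Qed.

(** The rotation invariant function [(conj_mono - proj_mono) * conj e] with
[e = mono p N]. *)
Definition kap0 (z : C2 R) : R :=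
  cmod (mono p 0 z) ^+ 2 - proj_coef * cmod (mono p N z) ^+ 2.

(** Extended by zero, because the torus averages are taken on the whole
space. *)
Definition kap (z : C2 R) : R := if `[< H z >] then kap0 z else 0.

Lemma kap0E z : H z ->
  (conj_mono z - proj_mono z) * ((mono p N z)^*)%C = ((kap0 z)%:C)%C.
Proof.
move=> hz; have z20 := Hgamma_neq0 hz.
have z2c : (z.2^*)%C != 0 by rewrite conjc_eq0.
have cE : ((mono p N z)^*)%C = ((z.1^*)%C) ^+ p * ((z.2^*)%C)^-1 ^+ N.
  by rewrite /mono rmorphM !rmorphXn /= conjc_inv.
rewrite /kap0 mulrBl rmorphB /=; congr (_ - _).
  rewrite cE /conj_mono mulrACA -!exprMn mulfV// expr1n mulr1 mulcJ -rmorphXn.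
  by rewrite cmod_mono expr0 mulr1 exprAC.
rewrite /proj_mono [in RHS]rmorphM -mulrA; congr (_ * _).
by rewrite mulcJ.
Qed.

Lemma integrable_mono_sqr b : Lp 2 H (mono p b) ->
  (@dV R).-integrable D (fun x => (cmod (mono p b (toC2 x)) ^+ 2)%:E).
Proof. by move=> /Lp2P[]. Qed.

Lemma kap_patch (x : mR4 R) :
  kap (toC2 x) = ((fun y : mR4 R => kap0 (toC2 y)) \_ D) x.
Proof.
rewrite /kap patchE; case: asboolP => hx; first by rewrite mem_set.
by rewrite memNset.
Qed.

Lemma integrable_kap : (@dV R).-integrable setT (fun x => (kap (toC2 x))%:E).
Proof.
have i := integrableB mD (integrable_mono_sqr Lp2_mono0)
  (integrableZl mD proj_coef (integrable_mono_sqr Lp2_mono)).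
have := i; rewrite (integrable_mkcond _ mD); apply: eq_integrable => // x _.
rewrite kap_patch !patchE.
by case: ifP.
Qed.

(** This is what the choice of [proj_coef] achieves. *)
Lemma integral_kap : (\int[@dV R]_x (kap (toC2 x))%:E = 0)%E.
Proof.
have iA := integrable_mono_sqr Lp2_mono0; have iB := integrable_mono_sqr Lp2_mono.
transitivity (\int[@dV R]_(x in D) ((cmod (mono p 0 (toC2 x)) ^+ 2)%:E -
    proj_coef%:E * (cmod (mono p N (toC2 x)) ^+ 2)%:E))%E.
  rewrite [RHS]integral_mkcond; apply: eq_integral => x _.
  rewrite kap_patch !patchE.
  by case: ifP.
rewrite integralB//; last exact: (integrableZl mD proj_coef iB).
rewrite integralZl//.
have fA := integrable_fin_num mD iA; have fB := integrable_fin_num mD iB.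
rewrite -(fineK fA) -(fineK fB) -EFinM -EFinB; congr _%:E.
have B0 := norm_gt0 Lp2_mono.
rewrite -[fine _]/normA -[X in _ - _ * X]/normB /proj_coef divfK ?subrr//.
by rewrite gt_eqF.
Qed.

(** Write [h = G e] with [e = mono p N] and [G] holomorphic off [z1 = 0]. The
integrand is [kap * Re G], also on the axis [z1 = 0], where [conj_mono] and
[proj_mono] vanish because [0 < p]. *)
Lemma orthogonal_Re h : bergman_space H h ->
  \int[@dV R]_(x in D)
    complex.Re ((conj_mono (toC2 x) - proj_mono (toC2 x)) * ((h (toC2 x))^*)%C) = 0.
Proof.
move=> [dh lh].
(* The quotient of [h] by the monomial. *)
pose G z := h z * ((z.1^-1) ^+ p * z.2 ^+ N) : R[i].
have dG z : H z -> z.1 != 0 -> differentiable (G : C2 R -> R[i]^o) z.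
  move=> hz z0; apply: differentiable_mul; first exact: dh.
  apply: differentiable_mul; apply: differentiable_pow.
    by apply: (@differentiableV _ _ (fun w : C2 R => w.1)) => //; exact: differentiable_z1.
  exact: differentiable_z2.
have hG z : H z -> z.1 != 0 -> h z = G z * mono p N z.
  move=> hz z0; have z20 := Hgamma_neq0 hz.
  rewrite /G /mono -mulrA mulrACA -!exprMn mulVf// mulfV// !expr1n.
  by rewrite !mulr1.
have key z : H z -> kap z * complex.Re (G z) =
    complex.Re ((conj_mono z - proj_mono z) * ((h z)^*)%C).
  move=> hz; rewrite /kap asboolT//.
  have [z0|z0] := eqVneq z.1 0.
    rewrite /kap0 /conj_mono /proj_mono /mono z0 expr0n gtn_eqF//= !mul0r mulr0.
    by rewrite cmod0 subr0 mul0r expr0n/= mulr0 subr0 mul0r.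
  rewrite (hG _ hz z0) rmorphM /= mulrCA (kap0E hz) mulrC.
  by case: (G z) => a b /=; rewrite mulr0 subr0.
have lf := Lp2_sub Lp2_conj_mono (Lp2_scale (proj_coef%:C)%C Lp2_mono).
have [iRe _] := Lp2_prod lf lh.
have E x : (kap (toC2 x) * complex.Re (G (toC2 x)))%:E =
  ((fun x => (complex.Re ((conj_mono (toC2 x) - proj_mono (toC2 x)) * ((h (toC2 x))^*)%C))%:E) \_ D) x.
  rewrite patchE; case: ifPn => [/set_mem xD|/negP xD]; first by rewrite key.
  by rewrite /kap asboolF ?mul0r// => hx; apply: xD; rewrite mem_set.
have iK : (@dV R).-integrable setT (fun x => (kap (toC2 x) * complex.Re (G (toC2 x)))%:E).
  have := iRe; rewrite (integrable_mkcond _ mD); exact: eq_integrable.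
have hb := base_in_H R m_gt0 n_gt0.
have b0 : (toC2 (base R n)).1 != 0.
  by rewrite -cmod_gt0 /toC2 /base /= complexr0 cmod_real gtr0_norm ?exprn_gt0 ?invr_gt0.
have G1 z : H z -> z.1 != 0 -> cdiff (fun w => G (w, z.2)) z.1.
  by move=> hz z0; apply: differentiable_cdiff1; exact: dG.
have G2 z : H z -> z.1 != 0 -> cdiff (fun w => G (z.1, w)) z.2.
  by move=> hz z0; apply: differentiable_cdiff2; exact: dG.
have Gc z : H z -> z.1 != 0 -> forall e, 0 < e -> exists2 d, 0 < d &
    forall z' : C2 R, cmod (z'.1 - z.1) <= d -> cmod (z'.2 - z.2) <= d -> cmod (G z' - G z) <= e.
  move=> hz z0 e e0; have /near_C2P[d d0 dP] := differentiable_cont (dG z hz z0) e0.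
  exists (d / 2); first by rewrite divr_gt0.
  have d2 : d / 2 < d by rewrite ltr_pdivrMr// ltr_pMr// ltr1n.
  by move=> z' h1 h2; apply/ltW/dP; apply: le_lt_trans d2.
have kt t1 t2 z : kap (torus t1 t2 z) = kap z.
  rewrite /kap /kap0 !cmod_mono /= !cmod_rot; congr (if _ then _ else _).
  by apply/asbool_equiv_eq; exact: Hgamma_torus.
have ks z : kap z != 0 -> H z /\ z.1 != 0.
  rewrite /kap; case: asboolP => [hz k0|]; last by rewrite eqxx.
  split => //; apply/negP => /eqP z0; move: k0; rewrite /kap0 /mono z0 expr0n gtn_eqF//=.
  by rewrite !mul0r cmod0 expr0n/= mulr0 subr0 eqxx.
have := integral_torus0 (gamma_gt0 R m_gt0 n_gt0) G1 G2 Gc kt ks integrable_kap iK hb b0 integral_kap.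
rewrite /Rintegral integral_mkcond => I0.
transitivity (fine (0%E : \bar R)) => //; congr fine; rewrite -I0.
by apply: eq_integral => x _; rewrite E.
Qed.

(** The imaginary part is the real part for ['i h]. *)
Lemma bergman_orthogonal h : bergman_space H h ->
  L2_dot H (fun z => conj_mono z - proj_mono z) h = 0.
Proof.
move=> bh; rewrite /L2_dot /cintegral orthogonal_Re//.
have := orthogonal_Re (bergman_scale 'i%C bh) => I0.
congr Complex; rewrite -[RHS]I0; apply: eq_Rintegral => x _.
by case: (_ - _) => a b; case: (h _) => c d /=; ring.
Qed.

(** The projection is pinned down by orthogonality up to a difference [h] of
zero norm; being continuous on the open domain, [h] vanishes there. *)
Lemma bergman_projection_conj_mono z : H z ->
  bergman_projection H conj_mono z = proj_mono z.
Proof.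
have bp : bergman_space H proj_mono by exact: bergman_scale bergman_mono.
set g := bergman_projection H conj_mono.
have [bg og] : bergman_space H g /\ forall h, bergman_space H h ->
    L2_dot H (fun z => conj_mono z - g z) h = 0.
  rewrite /g /bergman_projection; case: xgetP => [g' _ []//|].
  by move=> /(_ proj_mono) nn; exfalso; apply: nn; split => //; exact: bergman_orthogonal.
pose h z := g z - proj_mono z.
have bh : bergman_space H h := bergman_sub bg bp.
have [dh lh] := bh.
have lf1 := Lp2_sub Lp2_conj_mono bp.2; have lf2 := Lp2_sub Lp2_conj_mono bg.2.
have [i1 _] := Lp2_prod lf1 lh; have [i2 _] := Lp2_prod lf2 lh.
have I0 : \int[@dV R]_(x in D) (cmod (h (toC2 x)) ^+ 2) = 0.
  have := og _ bh; rewrite /L2_dot /cintegral => -[r2 _].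
  transitivity (\int[@dV R]_(x in D)
      complex.Re ((conj_mono (toC2 x) - proj_mono (toC2 x)) * ((h (toC2 x))^*)%C) -
    \int[@dV R]_(x in D)
      complex.Re ((conj_mono (toC2 x) - g (toC2 x)) * ((h (toC2 x))^*)%C)); last first.
    by rewrite r2 (orthogonal_Re bh) subrr.
  rewrite -RintegralB//.
  apply: eq_Rintegral => x _; rewrite /h.
  case: (conj_mono _) => a b; case: (proj_mono _) => c d; case: (g _) => u v /=.
  by rewrite cmod_sqr /=; ring.
move=> hz; apply/eqP; rewrite -subr_eq0 -cmod_eq0; apply/negPn/negP => hz0.
have k0 : 0 < cmod (h z) by rewrite lt_def hz0 cmod_ge0.
have k2 : 0 < cmod (h z) / 2 by rewrite divr_gt0.
have /Lp2P[_ _ fi] := lh.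
have := @integral_gt0 R D (fun x => cmod (h (toC2 x)) ^+ 2) (fromC2 z) ((cmod (h z) / 2) ^+ 2) mD.
have -> : (\int[@dV R]_(y in D) (cmod (h (toC2 y)) ^+ 2)%:E)%E = 0%E.
  by rewrite -(fineK (integrable_fin_num mD fi)); congr EFin; exact: I0.
rewrite ltxx => ig; apply: notF; apply: ig; last first.
- have nz : \forall w \near toC2 (fromC2 z), H w /\ cmod (h w - h z) < cmod (h z) / 2.
    rewrite fromC2K; apply: filterI; first exact: near_H2 hz.
    exact: differentiable_cont (dh z hz) _ k2.
  apply: filterS (near_C2_R4 nz) => x [hx hxz]; split => //.
  exact: cmod_near_sqr hxz.
- exact: exprn_gt0.
- by move=> y _; exact: sqr_ge0.
- by apply/measurable_EFinP; exact: measurable_int fi.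
Qed.

End L2.

(** * Membership in the Sobolev spaces *)

Section WeakDerivatives.
Variable R : realType.
Implicit Types (Omega : set (C2 R)) (u phi psi : R4 R -> R).

(** The closed support, as it occurs in [test_function]. *)
Definition supp phi : set (R4 R) := closure [set x | phi x != 0].

Lemma supp_out phi x : ~ supp phi x -> phi x = 0.
Proof.
by move=> nx; apply/eqP/negPn/negP => p0; apply: nx; exact: subset_closure.
Qed.

Lemma partials_supp_out phi s x : compact (supp phi) ->
  ~ supp phi x -> partials s phi x = 0.
Proof.
move=> cK; elim: s x => [|i s IH] x nx /=; first exact: supp_out.
by have [_ ->] := derive_off_supp (e4 R i) cK IH nx.
Qed.

Lemma Rintegral_supp (A K : set (mR4 R)) (f : mR4 R -> R) :
  measurable A -> K `<=` A -> (forall x, ~ K x -> f x = 0) ->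
  \int[@dV R]_(x in A) f x = \int[@dV R]_x f x.
Proof.
move=> mA KA f0; rewrite Rintegral_mkcond; apply: eq_Rintegral => x _.
rewrite patchE; case: ifPn => // /negP xA; rewrite f0// => /KA Ax.
by apply: xA; rewrite mem_set.
Qed.

Lemma smc_opp u : smc u -> smc (fun x => - u x).
Proof.
move=> su; rewrite (_ : (fun _ => _) = fun x => -1 * u x).
  by apply: smc_mul => //; exact: smc_cst.
by apply/funext => x; rewrite mulN1r.
Qed.

(** The derivatives are moved one at a time; as [u] is smooth on the whole
space, so is each intermediate factor. *)
Lemma smc_partials_ibp u (s : seq 'I_4) : smc u -> exists2 v, smc v &
  forall phi, smooth phi -> compact (supp phi) ->
    \int[@dV R]_x (u x * partials s phi x) =
    (- 1) ^+ size s * \int[@dV R]_x (v x * phi x).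
Proof.
elim: s u => [|i s IH] u su.
  by exists u => // phi _ _; rewrite expr0 mul1r.
have [du sdu duE] := smc_derive i su.
have [v sv vE] := IH du sdu.
exists v => // phi sphi cK; rewrite exprS -mulrA mulN1r -vE//.
have [cp dp] := sphi s; have [cq _] := sphi (i :: s).
apply: (ibp4 (U := setT) openT cK (@subsetT _ _)) => //.
- by move=> x nx; exact: partials_supp_out.
- by move=> x _; exact: smc_continuous.
- by move=> x _; exact: smc_continuous.
Qed.

Lemma size_flatten_nseq (alpha : multi_index) :
  size (flatten [seq nseq (alpha i) i | i <- enum 'I_4]) = mi_order alpha.
Proof.
rewrite size_flatten /shape -map_comp sumnE big_map big_enum /=.
by apply: eq_bigr => i _; rewrite size_nseq.
Qed.

(** The support of a test function is inside [Omega], so the integrals over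
[Omega] are integrals over the whole space. *)
Lemma smc_weak_derivative Omega (alpha : multi_index) u :
  measurable (real_domain Omega) -> smc u ->
  exists2 v, smc v & real_weak_derivative Omega alpha u v.
Proof.
move=> mO su.
have [v sv vE] := smc_partials_ibp (flatten [seq nseq (alpha i) i | i <- enum 'I_4]) su.
exists v => // phi [sphi cK KO].
rewrite (Rintegral_supp (K := supp phi) mO)//; last first.
  by move=> x nx; rewrite [X in _ * X]partials_supp_out ?mulr0.
rewrite (Rintegral_supp (K := supp phi) mO)//; last first.
  by move=> x nx; rewrite [phi x]supp_out ?mulr0.
by rewrite -size_flatten_nseq -vE.
Qed.

Definition smc2 (F : C2 R -> R[i]) :=
  smc (fun x : R4 R => complex.Re (F (toC2 x))) /\
  smc (fun x : R4 R => complex.Im (F (toC2 x))).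

Lemma smc2_mul F G : smc2 F -> smc2 G -> smc2 (fun z => F z * G z).
Proof.
move=> [f1 f2] [g1 g2]; split.
  rewrite (_ : (fun _ => _) = fun x => complex.Re (F (toC2 x)) * complex.Re (G (toC2 x)) +
    - (complex.Im (F (toC2 x)) * complex.Im (G (toC2 x)))).
    by apply: smc_add; [|apply: smc_opp]; exact: smc_mul.
  by apply/funext => x; case: (F _) => a b; case: (G _).
rewrite (_ : (fun _ => _) = fun x => complex.Re (F (toC2 x)) * complex.Im (G (toC2 x)) +
  complex.Im (F (toC2 x)) * complex.Re (G (toC2 x))).
  by apply: smc_add; exact: smc_mul.
by apply/funext => x; case: (F _) => a b; case: (G _) => c d /=; rewrite [b * c]mulrC.
Qed.

Lemma smc2_exp F k : smc2 F -> smc2 (fun z => F z ^+ k).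
Proof.
move=> sF; elim: k => [|k IH]; first by split; exact: smc_cst.
by under eq_fun do rewrite exprS; exact: smc2_mul.
Qed.

Lemma smc2_conj_mono p N : smc2 (@conj_mono R p N).
Proof.
apply: smc2_mul; apply: smc2_exp; split.
- exact: (smc_coordinate R (@Ordinal 4 0 isT)).
- exact: (smc_coordinate R (@Ordinal 4 1 isT)).
- exact: (smc_coordinate R (@Ordinal 4 2 isT)).
- exact: smc_opp (smc_coordinate R (@Ordinal 4 3 isT)).
Qed.

Lemma smc2_smooth_closure Omega F : smc2 F -> smooth_closure Omega F.
Proof. by move=> [f1 f2]; exists F; split => //; exact: smc_smooth. Qed.

Variables (m n : nat).
Hypotheses (m_gt0 : (0 < m)%N) (n_gt0 : (0 < n)%N).
Local Notation H := (Hgamma (m%:R / n%:R : R)).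

(** The domain is inside the unit bidisc, whence the boundedness on it of
all functions of class [smc]. *)
Lemma norm4_le1 (x : R4 R) : H (toC2 x) -> `|x| <= 1.
Proof.
move=> /(H_bounds m_gt0 n_gt0)[h1 /andP[_ h2]].
case: x h1 h2 => -[a b] [c d]; rewrite /toC2 /= => h1 h2.
have [h3 h4] := (ler_Re_cmod (Complex a b), ler_Im_cmod (Complex a b)).
have [h5 h6] := (ler_Re_cmod (Complex c d), ler_Im_cmod (Complex c d)).
move: h3 h4 h5 h6 => /= h3 h4 h5 h6.
by rewrite !prod_normE /= !ge_max; apply/andP; split; apply/andP; split; lra.
Qed.

Lemma smc2_Lp2 F : smc2 F -> Lp 2 H F.
Proof.
move=> [f1 f2]; have [B1 B1P] := smc_bounded 1 f1; have [B2 B2P] := smc_bounded 1 f2.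
apply: (@Lp2_bounded _ _ _ m_gt0 n_gt0 _ (B1 + B2)).
  by split; exact: smc_measurable.
move=> z hz; have h : `|fromC2 z| <= 1 by apply: norm4_le1; rewrite fromC2K.
have := B1P _ h; have := B2P _ h; rewrite !fromC2K.
by have := cmod_le (F z); lra.
Qed.

Lemma smc2_sobolev F k : smc2 F -> sobolev 2 k H F.
Proof.
move=> sF; split; first exact: smc2_Lp2.
have mD : measurable (real_domain H : set (mR4 R)) by exact: measurable_H.
move=> alpha _; have [f1 f2] := sF.
have [v1 sv1 v1E] := smc_weak_derivative alpha mD f1.
have [v2 sv2 v2E] := smc_weak_derivative alpha mD f2.
exists (fun z => Complex (v1 (fromC2 z)) (v2 (fromC2 z))).
  apply: smc2_Lp2; split => /=.
    by under eq_fun do rewrite toC2K.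
  by under eq_fun do rewrite toC2K.
by split => phi tphi; rewrite ?v1E ?v2E//; congr (_ * _);
  apply: eq_Rintegral => x _ /=; rewrite toC2K.
Qed.

End WeakDerivatives.

(** * Test functions on the dilated boxes *)

Section RealParts.
Variable R : realType.

Lemma Re_continuous (G : C2 R -> R[i]) (x : R4 R) :
  differentiable (G : C2 R -> R[i]^o) (toC2 x) ->
  {for x, continuous (fun y : R4 R => complex.Re (G (toC2 y)))}.
Proof.
move=> dG; apply/cvgrPdist_lt => e e0.
have := near_C2_R4 (differentiable_cont dG e0).
apply: filterS => y; apply: le_lt_trans.
rewrite -normrN opprB; apply: le_trans (ler_Re_cmod _).
by case: (G (toC2 y)) => a b; case: (G (toC2 x)).
Qed.

Lemma toC2_shift2 (t : R) (x : R4 R) :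
  toC2 (t *: e4 R (@Ordinal 4 2 isT) + x) = (t%:C)%C *: ((0, 1) : C2 R) + toC2 x.
Proof.
rewrite shift_z2; case: x => -[a b] [c d]; rewrite /e4 (tnth_nth 0) /= /toC2 /=.
have E (u v : R) : t *: u + v = t * u + v by [].
by rewrite !E !mulr0 mulr1 !add0r; congr pair; simpc; rewrite addrC ?addr0.
Qed.

(** A real increment of [Re z2] is a complex increment of [z2]. *)
Lemma is_derive_Re (G : C2 R -> R[i]) (x : R4 R) :
  differentiable (G : C2 R -> R[i]^o) (toC2 x) ->
  is_derive x (e4 R (@Ordinal 4 2 isT)) (fun y : R4 R => complex.Re (G (toC2 y)))
    (complex.Re (dz2 G (toC2 x))).
Proof.
move=> dG; set i2 := Ordinal _.
have d1 : derivable (G : C2 R -> R[i]^o) (toC2 x) (0, 1) by exact: diff_derivable.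
pose u (y : R4 R) := complex.Re (G (toC2 y)).
suff c : h^-1 *: ((u \o shift x) (h *: e4 R i2) - u x) @[h --> (0 : R)^'] -->
    complex.Re (dz2 G (toC2 x)).
  by apply: DeriveDef; [apply/cvg_ex; eexists; exact: c|exact: cvg_lim c].
apply/cvgrPdist_le => e e0.
have [d d0 dP] := derivable_approxC d1 e0.
near=> h.
have h0 : h != 0 by near: h; exact: nbhs_dnbhs_neq.
have hd : `|h| <= d.
  near: h; apply: dnbhs0_le => //.
have := dP (h%:C)%C; rewrite !cmod_real => /(_ hd) {}dP.
have hn : 0 < `|h| by rewrite normr_gt0.
rewrite /u /= -(ler_pM2r hn) -normrM -normrN.
apply: le_trans dP; rewrite -toC2_shift2 /dz2.
apply: le_trans (ler_Re_cmod _).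
rewrite le_eqVlt; apply/orP; left; apply/eqP; congr `|_|.
rewrite -[_^-1 *: _]/(_^-1 * _) mulrBl mulrAC mulVf// mul1r.
case: (G _) => a b; case: (G _) => a' b'; case: ('D_ _ _ _) => c c' /=; ring.
Unshelve. all: by end_near. Qed.

End RealParts.

Section BumpBox.
Variable R : realType.
Variables (m n : nat).
Hypotheses (m_gt0 : (0 < m)%N) (n_gt0 : (0 < n)%N).
Local Notation H := (Hgamma (m%:R / n%:R : R)).
Local Notation c4 k x := (coord4 (@Ordinal 4 k isT) x).

(** A product of one-dimensional bumps, positive in the interior of the box
[boxS m n w i]. *)
Definition bump_box (w : R) (i : nat) (x : R4 R) : R :=
  (bump1 (rho R n i * (x0 R n - w)) (rho R n i * (2 * w)) (c4 0 x) *
   bump1 (rho R n i * (- w)) (rho R n i * (2 * w)) (c4 1 x)) *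
  (bump1 (rho R m i * (2^-1 - w)) (rho R m i * (2 * w)) (c4 2 x) *
   bump1 (rho R m i * (- w)) (rho R m i * (2 * w)) (c4 3 x)).

Lemma smc_bump_box (w : R) i : smc (bump_box w i).
Proof. by apply: smc_mul; apply: smc_mul; exact: smc_bump1. Qed.

Lemma bump_box_ge0 (w : R) i x : 0 <= bump_box w i x.
Proof.
by rewrite mulr_ge0//; apply: mulr_ge0; exact: bump1_ge0.
Qed.

Lemma bump_box_le1 (w : R) i x : bump_box w i x <= 1.
Proof.
have M (a b : R) : 0 <= a -> a <= 1 -> b <= 1 -> a * b <= 1.
  by move=> a0 a1 b1; nra.
apply: (M); [|apply: (M)|apply: (M)]; rewrite ?bump1_le1 ?bump1_ge0//.
by apply: mulr_ge0; exact: bump1_ge0.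
Qed.

Lemma bump_box_supp (w : R) i x : 0 < w -> bump_box w i x != 0 -> boxS m n w i x.
Proof.
have nz (a b c d : R) : (a * b) * (c * d) != 0 -> [/\ a != 0, b != 0, c != 0 & d != 0].
  by rewrite !mulf_eq0 !negb_or => /andP[/andP[? ?] /andP[? ?]].
move=> w0 /nz[h1 h2 h3 h4].
have p k : 0 < rho R k i * (2 * w) by rewrite !mulr_gt0// rho_gt0.
have E k (a : R) : rho R k i * (a - w) + rho R k i * (2 * w) = rho R k i * (a + w) by ring.
have E0 k : rho R k i * - w + rho R k i * (2 * w) = rho R k i * w by ring.
move: (bump1_supp (p n) h1) (bump1_supp (p n) h2) (bump1_supp (p m) h3) (bump1_supp (p m) h4).
by rewrite !E !E0 => b1 b2 b3 b4; split; split; rewrite /= in_itv.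
Qed.

Lemma compact_boxS (w : R) i : compact (boxS m n w i : set (R4 R)).
Proof. by apply: compact_setX; apply: compact_setX; exact: segment_compact. Qed.

Lemma supp_bump_box (w : R) i : 0 < w -> supp (bump_box w i) `<=` boxS m n w i.
Proof.
move=> w0; have c : closed (boxS m n w i : set (R4 R)).
  by apply: compact_closed; [exact: norm_hausdorff|exact: compact_boxS].
rewrite /supp [X in _ `<=` X](closure_id _).1//; apply: closure_subset => x /=.
exact: bump_box_supp.
Qed.

Lemma test_bump_box (w : R) i : 0 < w -> boxS m n w i `<=` real_domain H ->
  test_function H (bump_box w i).
Proof.
move=> w0 SH; split.
- exact: smc_smooth (smc_bump_box _ _).
- by apply: subclosed_compact (supp_bump_box w0); [exact: closed_closure|exact: compact_boxS].
- by move=> x /(supp_bump_box w0)/SH.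
Qed.

(** Uniform in [i]: the bumps of different boxes are dilations of one
another. *)
Lemma bump_box_ge (w : R) i x : 0 < w -> boxS m n (w / 2) i x -> (eps (4^-1 : R) ^+ 2) ^+ 4 <= bump_box w i x.
Proof.
move=> w0 [[/= b1 b2] [/= b3 b4]]; move: b1 b2 b3 b4; rewrite !in_itv/=.
have p k : 0 < rho R k i * (2 * w) by rewrite !mulr_gt0// rho_gt0.
have e0 : 0 <= eps (4^-1 : R) ^+ 2 by exact: sqr_ge0.
have E1 k (a t : R) : rho R k i * (a - w / 2) <= t <= rho R k i * (a + w / 2) ->
    eps (4^-1 : R) ^+ 2 <= bump1 (rho R k i * (a - w)) (rho R k i * (2 * w)) t.
  move=> h; apply: bump1_ge => //; move: h.
  have -> : rho R k i * (a - w) + rho R k i * (2 * w) / 4 = rho R k i * (a - w / 2) by field.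
  by have -> : rho R k i * (a - w) + rho R k i * (2 * w) - rho R k i * (2 * w) / 4 =
    rho R k i * (a + w / 2) by field.
have E0 k (t : R) : rho R k i * - (w / 2) <= t <= rho R k i * (w / 2) ->
    eps (4^-1 : R) ^+ 2 <= bump1 (rho R k i * - w) (rho R k i * (2 * w)) t.
  by have := E1 k 0 t; rewrite !sub0r add0r.
move=> /E1 h1 /E0 h2 /E1 h3 /E0 h4.
rewrite (_ : _ ^+ 4 = (eps (4^-1 : R) ^+ 2 * eps (4^-1 : R) ^+ 2) * (eps (4^-1 : R) ^+ 2 * eps (4^-1 : R) ^+ 2)); last by ring.
by do !apply: ler_pM => //; rewrite mulr_ge0.
Qed.

Lemma boxS_half (w : R) i : 0 < w -> boxS m n (w / 2) i `<=` (boxS m n w i : set (mR4 R)).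
Proof.
move=> w0 [[a b] [c d]] [[/= b1 b2] [/= b3 b4]]; move: b1 b2 b3 b4; rewrite !in_itv/=.
have := rho_gt0 R n i; have := rho_gt0 R m i => r1 r2.
move=> /andP[? ?] /andP[? ?] /andP[? ?] /andP[? ?].
by split; split; rewrite /= in_itv/=; apply/andP; split; nra.
Qed.

End BumpBox.

(** * Lower bound for a weak derivative of the projection *)

Section Young.
Context d (T : measurableType d) (R : realType) (mu : {measure set T -> \bar R}).

(** Testing [r] against a bump bounds its square integral from below:
integrate [(r + M phi)^2 >= 0], using [phi^2 <= phi]. *)
Lemma young_lower_bound (S : set T) (r kap phi : T -> R) (M M1 : R) :
  measurable S -> (mu S < +oo)%E ->
  measurable_fun S r -> mu.-integrable S (fun x => (r x ^+ 2)%:E) ->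
  measurable_fun S kap -> measurable_fun S phi ->
  (forall x, S x -> 0 <= phi x <= 1) ->
  0 <= M -> (forall x, S x -> M <= kap x <= M1) ->
  (\int[mu]_(x in S) (r x * phi x) = \int[mu]_(x in S) (- kap x * phi x))%R ->
  M ^+ 2 * \int[mu]_(x in S) phi x <= \int[mu]_(x in S) (r x ^+ 2).
Proof.
move=> mS Sfin mr ir mk mphi p01 M0 kM E0.
have bint (f : T -> R) B : measurable_fun S f -> (forall x, S x -> `|f x| <= B) ->
    mu.-integrable S (EFin \o f).
  move=> mf fB; apply: measurable_bounded_integrable => //.
  exists B; split; first exact: num_real.
  by move=> C BC x /fB fx /=; rewrite (le_trans fx)// ltW.
have iZ (f : T -> R) c : mu.-integrable S (EFin \o f) ->
    mu.-integrable S (EFin \o (fun x => c * f x)).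
  by move=> i; apply: eq_integrable (integrableZl mS c i).
have iphi : mu.-integrable S (EFin \o phi).
  by apply: (bint _ 1) => // x /p01/andP[h1 h2]; rewrite ger0_norm.
have ikp : mu.-integrable S (EFin \o (fun x => kap x * phi x)).
  apply: (bint _ M1) => [|x Sx]; first exact: measurable_funM.
  have /andP[h1 h2] := p01 _ Sx; have /andP[h3 h4] := kM _ Sx.
  by rewrite normrM !ger0_norm//; nra.
have E : \int[mu]_(x in S) (r x * phi x) = - \int[mu]_(x in S) (kap x * phi x).
  rewrite E0 -mulN1r -RintegralZl//; apply: eq_Rintegral => x _; ring.
have irp : mu.-integrable S (EFin \o (fun x => r x * phi x)).
  have i1 := integrableD mS ir (bint (fun=> 1) 1 (measurable_cst _) (fun x _ => eq_ind_r (fun y => y <= 1) (lexx 1) (normr1 R))).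
  apply: (le_integrable mS _ _ i1); first exact/measurable_EFinP/measurable_funM.
  move=> x Sx; rewrite -EFinD lee_fin [leRHS]ger0_norm ?addr_ge0 ?sqr_ge0//.
  have /andP[h1 h2] := p01 _ Sx; rewrite normrM (ger0_norm h1).
  have := normr_ge0 (r x); have := sqr_ge0 (`|r x| - 1); rewrite -[r x ^+ 2]real_normK ?num_real//.
  by nra.
pose f x := (- (2 * M)) * (r x * phi x) - M ^+ 2 * phi x.
have i1 : mu.-integrable S (EFin \o (fun x => (- (2 * M)) * (r x * phi x))).
  exact: iZ.
have i2 : mu.-integrable S (EFin \o (fun x => M ^+ 2 * phi x)).
  exact: iZ.
have fr : \int[mu]_(x in S) f x <= \int[mu]_(x in S) (r x ^+ 2).
  apply: le_Rintegral => //; first by apply: eq_integrable (integrableB mS i1 i2).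
  move=> x Sx; have /andP[h1 h2] := p01 _ Sx; rewrite /f.
  have := sqr_ge0 (r x + M * phi x).
  have : 0 <= M ^+ 2 * (phi x * (1 - phi x)).
    by rewrite mulr_ge0 ?sqr_ge0// mulr_ge0// subr_ge0.
  by lra.
apply: le_trans fr; rewrite RintegralB// !RintegralZl// E.
have : M * \int[mu]_(x in S) phi x <= \int[mu]_(x in S) (kap x * phi x).
  rewrite -RintegralZl//; apply: le_Rintegral => //; first exact: iZ.
  move=> x Sx; have /andP[h1 h2] := p01 _ Sx; have /andP[h3 h4] := kM _ Sx.
  exact: ler_wpM2r.
move: (Rintegral _ _ _) (Rintegral _ _ _) => A B AB.
by rewrite -subr_ge0 in AB; have := mulr_ge0 M0 AB; lra.
Qed.

End Young.

Section NotSobolev.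
Variable R : realType.
Variables (m n : nat).
Hypotheses (m_gt0 : (0 < m)%N) (n_gt0 : (0 < n)%N).
Local Notation H := (Hgamma (m%:R / n%:R : R)).
Local Notation D := (real_domain H : set (mR4 R)).
Local Notation i2 := (@Ordinal 4 2 isT).

Variables (p N : nat).
Hypothesis N_gt0 : (0 < N)%N.
Hypothesis pN : (n * p.+1 + m = m * N + 1)%N.

Local Notation C := (proj_coef R m n p N).
Local Notation Pf := (@proj_mono R m n p N).

(** Minus the derivative of [Re (proj_mono)] in the direction of [Re z2],
positive near the base point. *)
Definition kappa (x : R4 R) : R := C * N%:R * complex.Re (mono p N.+1 (toC2 x)).

Lemma measurable_kappa : measurable_fun setT (kappa : mR4 R -> R).
Proof.
by have [h _] := cmeasurable_mono R p N.+1; apply: measurable_funM.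
Qed.

Lemma dz2_proj z : H z -> dz2 Pf z = - ((C * N%:R)%:C)%C * mono p N.+1 z.
Proof.
move=> hz; rewrite (dz2_mono n_gt0 (c := (C%:C)%C) (a := p) (b := N) _ hz)//.
have -> : ((C * N%:R)%:C)%C = (C%:C)%C * N%:R by rewrite rmorphM /= (rmorph_nat (real_complex R)).
by rewrite mulrN.
Qed.

Lemma Re_dz2_proj x : H (toC2 x) -> complex.Re (dz2 Pf (toC2 x)) = - kappa x.
Proof.
move=> hx; rewrite dz2_proj// mulNr /kappa.
by case: (mono _ _ _) => a b /=; rewrite mul0r subr0.
Qed.

Lemma differentiable_proj z : H z -> differentiable (Pf : C2 R -> R[i]^o) z.
Proof.
move=> hz; apply: differentiable_mul; first exact: differentiable_cst.
exact: differentiable_mono (Hgamma_neq0 hz).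
Qed.

Lemma kappa_continuous x : H (toC2 x) -> {for x, continuous kappa}.
Proof.
move=> hx; have := Re_continuous (differentiable_mono p N.+1 (Hgamma_neq0 hx)).
by move=> c; apply: cvgM c; exact: cvg_cst.
Qed.

Lemma kappa_base : 0 < kappa (base R n).
Proof.
rewrite /kappa mulr_gt0//.
  by rewrite mulr_gt0 ?ltr0n//; exact: proj_coef_gt0.
rewrite /mono /toC2 /base /= !complexr0 -fmorphV -!rmorphXn -rmorphM /=.
by rewrite mulr_gt0// exprn_gt0// ?invr_gt0 ?exprn_gt0 ?invr_gt0.
Qed.

Lemma exponents_kappa : (m * N.+1 = n * p + (n + 2 * m - 1))%N.
Proof.
apply/eqP; rewrite -(eqn_add2r 1) mulnS -addnA -pN -addnA subnK ?addn_gt0 ?n_gt0//.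
by apply/eqP; rewrite mulnS; ring.
Qed.

Lemma kappa_dil i x : kappa (dil m n i x) = 2 ^+ (i * (n + 2 * m - 1)) * kappa x.
Proof.
rewrite /kappa mono_dil (rho_scale _ i exponents_kappa).
by case: (mono _ _ _) => a b /=; rewrite mul0r subr0 mulrCA.
Qed.

(** The projection is smooth in the domain, hence in a neighbourhood of the
support of [phi], and there the classical derivative is the weak one. *)
Lemma proj_mono_ibp (phi : R4 R -> R) : test_function H phi ->
  \int[@dV R]_(x in D) (complex.Re (Pf (toC2 x)) * 'D_(e4 R i2) phi x) =
  - \int[@dV R]_(x in D) (- kappa x * phi x).
Proof.
move=> [sphi cK KH]; have mD : measurable D by exact: measurable_H.
rewrite (Rintegral_supp (K := supp phi) mD KH); last first.
  by move=> x nx; have := partials_supp_out [:: i2] cK nx => /= ->; rewrite mulr0.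
rewrite (Rintegral_supp (K := supp phi) mD KH); last first.
  by move=> x nx; rewrite [phi x]supp_out ?mulr0.
have [cp dp] := sphi [::]; have [cq _] := sphi [:: i2].
pose u (x : R4 R) := complex.Re (Pf (toC2 x)).
apply: (ibp4 (u := u) (du := fun x => - kappa x) (@open_H4 R m n n_gt0) cK KH) => //.
- by move=> x nx; exact: supp_out.
- by move=> x hx; apply: Re_continuous; exact: differentiable_proj.
- by move=> x hx; rewrite -Re_dz2_proj//; apply: is_derive_Re; exact: differentiable_proj.
- by move=> x hx; apply: cvgN; exact: kappa_continuous.
Qed.

Lemma near_kappa : \forall x \near base R n,
  kappa (base R n) / 2 <= kappa x <= 2 * kappa (base R n).
Proof.
have k0 := kappa_base; have c := kappa_continuous (base_in_H R m_gt0 n_gt0).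
have l1 : kappa (base R n) / 2 < kappa (base R n) by lra.
have l2 : kappa (base R n) < 2 * kappa (base R n) by lra.
have n1 : \forall x \near base R n, kappa (base R n) / 2 < kappa x.
  exact: (cvgr_gt _ c _ l1).
have n2 : \forall x \near base R n, kappa x < 2 * kappa (base R n).
  exact: (cvgr_lt _ c _ l2).
by apply: filterS (filterI n1 n2) => x [/ltW -> /ltW ->].
Qed.

(** The multi-index of the first derivative in [Re z2]. *)
Definition re_z2 : multi_index := [ffun i => (i == i2) : nat].

Lemma enum4 : enum 'I_4 = [:: @Ordinal 4 0 isT; @Ordinal 4 1 isT; i2; @Ordinal 4 3 isT].
Proof. by apply: (inj_map val_inj); rewrite val_enum_ord. Qed.

Lemma mi_partial_re_z2 (phi : R4 R -> R) x : mi_partial re_z2 phi x = 'D_(e4 R i2) phi x.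
Proof. by rewrite /mi_partial enum4 /= !ffunE. Qed.

Lemma mi_order_re_z2 : mi_order re_z2 = 1%N.
Proof. by rewrite -size_flatten_nseq enum4 /= !ffunE. Qed.

(** On the [i]-th box the square of the derivative grows at least as fast as
the volume decays: [2 (n + 2 m - 1) >= 2 (n + m)] because [m >= 1]. *)
Lemma box_scaling i : 1 <=
  (2 ^+ (i * (n + 2 * m - 1))) ^+ 2 * (rho R n i ^+ 2 * rho R m i ^+ 2).
Proof.
rewrite -!exprMn exprn_ege1// /rho -exprD !exprVn -mulnDl mulrC.
rewrite ler_pdivlMl ?exprn_gt0// mulr1 ler_eXn2l ?ltr1n// mulnC leq_mul2l.
rewrite -addnBA ?muln_gt0 ?m_gt0// leq_add2l mul2n -addnn -addnBA// leq_addr.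
by rewrite orbT.
Qed.

(** If [g] were the weak derivative in the direction of [Re z2], the square
of [Re g] would have an integral of at least [eta] over each of the disjoint
boxes. *)
Lemma proj_not_sobolev k (F : C2 R -> R[i]) : (1 <= k)%N ->
  (forall z, H z -> F z = Pf z) -> ~ sobolev 2 k H F.
Proof.
move=> k1 FP [_ sob].
have [g /(Lp2P m n g)[mr mi ig] [wg _]] := sob re_z2 (leq_trans (eq_leq mi_order_re_z2) k1).
have mD : measurable D by exact: measurable_H.
pose r (x : mR4 R) := complex.Re (g (toC2 x)).
have ir : (@dV R).-integrable D (fun x => (r x ^+ 2)%:E).
  apply: (le_integrable mD _ _ ig); first exact/measurable_EFinP/measurable_funX.
  move=> x _; rewrite lee_fin !ger0_norm ?sqr_ge0// -[r x ^+ 2]real_normK ?num_real//.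
  by rewrite ler_sqr ?nnegrE ?cmod_ge0//; exact: ler_Re_cmod.
have weak phi : test_function H phi ->
    \int[@dV R]_(x in D) (r x * phi x) = \int[@dV R]_(x in D) (- kappa x * phi x).
  move=> tphi; have := wg _ tphi; rewrite mi_order_re_z2 expr1 mulN1r.
  have -> : \int[@dV R]_(x in D) (complex.Re (F (toC2 x)) * mi_partial re_z2 phi x) =
      \int[@dV R]_(x in D) (complex.Re (Pf (toC2 x)) * 'D_(e4 R i2) phi x).
    by apply: eq_Rintegral => x /set_mem hx; rewrite mi_partial_re_z2 FP.
  by rewrite proj_mono_ibp// => /oppr_inj.
have [w [w0 w8 Pw SH]] := boxS_nearP m_gt0 n_gt0 near_kappa.
set M0 := kappa (base R n) / 2 in Pw; set M1 := 2 * _ in Pw.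
have M00 : 0 < M0 by rewrite divr_gt0// kappa_base.
pose e0 : R := (eps (4^-1 : R) ^+ 2) ^+ 4.
have e00 : 0 < e0 by rewrite !exprn_gt0// eps_gt0 ?invr_gt0.
(* [e0] is the lower bound of the bumps on the half boxes, and
   [16 (w / 2)^4] is the volume of the first of these. *)
pose eta : R := M0 ^+ 2 * (e0 * (16 * (w / 2) ^+ 4)).
have w4 : 0 < (w / 2) ^+ 4 by rewrite exprn_gt0// divr_gt0.
have eta0 : 0 < eta.
  by rewrite mulr_gt0 ?exprn_gt0// mulr_gt0// mulr_gt0.
have lower i : (eta%:E <= \int[@dV R]_(x in boxS m n w i) (r x ^+ 2)%:E)%E.
  pose L : R := 2 ^+ (i * (n + 2 * m - 1)).
  have L0 : 0 < L by rewrite exprn_gt0.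
  have mS : measurable (boxS m n w i) by exact: measurable_boxS.
  have mS2 : measurable (boxS m n (w / 2) i : set (mR4 R)) by exact: measurable_boxS.
  have Sfin : (dV R (boxS m n w i) < +oo)%E.
    by rewrite [ltLHS]dV_boxS ?ltry// ltW.
  have mp : measurable_fun setT (bump_box m n w i : mR4 R -> R).
    exact: smc_measurable (smc_bump_box _ _ _ _).
  have irS := integrableS mD mS (SH i) ir.
  have tp := test_bump_box w0 (SH i).
  have onS (f : mR4 R -> R) : \int[@dV R]_(x in D) (f x * bump_box m n w i x) =
      \int[@dV R]_(x in boxS m n w i) (f x * bump_box m n w i x).
    have z x : ~ boxS m n w i x -> f x * bump_box m n w i x = 0.
      move=> nx; apply/eqP/negPn/negP; rewrite mulf_eq0 negb_or => /andP[_ b].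
      exact: nx (bump_box_supp w0 b).
    rewrite (Rintegral_supp (K := boxS m n w i) mD (SH i))//.
    by rewrite (Rintegral_supp (K := boxS m n w i) mS).
  have wS := weak _ tp; rewrite (onS r) (onS (fun x => - kappa x)) in wS.
  have kS x : boxS m n w i x -> L * M0 <= kappa x <= L * M1.
    by move=> /boxS_dil[y /Pw yk ->]; rewrite kappa_dil !ler_pM2l.
  have := young_lower_bound mS Sfin (measurable_funS mD (SH i) mr) irS
    (measurable_funTS measurable_kappa) (measurable_funTS mp)
    (fun x _ => introT andP (conj (bump_box_ge0 _ _ _ _ _) (bump_box_le1 _ _ _ _ _)))
    (ltW (mulr_gt0 L0 M00)) kS wS.
  have phiS : e0 * (16 * (w / 2) ^+ 4 * (rho R n i ^+ 2 * rho R m i ^+ 2)) <=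
      \int[@dV R]_(x in boxS m n w i) bump_box m n w i x.
    have iphi : (@dV R).-integrable (boxS m n w i) (fun x => (bump_box m n w i x)%:E).
      apply: measurable_bounded_integrable => //; first exact: measurable_funTS.
      exists 1; split; first exact: num_real.
      move=> A A1 x _ /=; rewrite ger0_norm ?bump_box_ge0//.
      by rewrite (le_trans (bump_box_le1 _ _ _ _ _))// ltW.
    have sub : (\int[@dV R]_(x in boxS m n (w / 2) i) e0%:E <=
        \int[@dV R]_(x in boxS m n w i) (bump_box m n w i x)%:E)%E.
      apply: (@le_trans _ _ (\int[@dV R]_(x in boxS m n (w / 2) i) (bump_box m n w i x)%:E)%E).
        apply: ge0_le_integral => //.
        - by move=> x _; rewrite lee_fin ltW.
        - by apply/measurable_EFinP/measurable_funTS.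
        - by move=> x hx; rewrite lee_fin bump_box_ge.
      apply: ge0_subset_integral => //.
      - by apply/measurable_EFinP/measurable_funTS.
      - by move=> x _; rewrite lee_fin bump_box_ge0.
      - exact: boxS_half.
    rewrite integral_cst// [X in (_ * X)%E]dV_boxS in sub; last by rewrite divr_ge0// ltW.
    by rewrite -lee_fin /Rintegral fineK ?EFinM//; exact: integrable_fin_num.
  move=> yb; rewrite -(fineK (integrable_fin_num mS irS)) lee_fin.
  apply: le_trans yb; rewrite exprMn.
  apply: (@le_trans _ _ (L ^+ 2 * M0 ^+ 2 *
      (e0 * (16 * (w / 2) ^+ 4 * (rho R n i ^+ 2 * rho R m i ^+ 2))))); last first.
    by rewrite ler_pM2l// mulr_gt0// exprn_gt0.
  have := box_scaling i; rewrite -/L => /(ler_wpM2l (ltW eta0)); rewrite mulr1.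
  by rewrite /eta; move=> h; apply: (le_trans h); rewrite le_eqVlt; apply/orP; left; apply/eqP; ring.
have := integral_boxS_pinfty m_gt0 w0 w8 eta0 SH mD _ _ lower.
move=> I; have := integrable_fin_num mD ir.
rewrite I//; first by apply/measurable_EFinP/measurable_funX.
by move=> x; rewrite lee_fin sqr_ge0.
Qed.

End NotSobolev.

(** * Failure on Sobolev spaces and on smooth functions *)

Theorem theorem1p3 (R : realType) (m n : nat)
    (m_gt0 : (0 < m)%N) (n_gt0 : (0 < n)%N) (mn_coprime : coprime m n) :
  let H := Hgamma (m%:R / n%:R : R) in
  (forall k : nat, (1 <= k)%N ->
    fails_to_map (bergman_projection H) (sobolev 2 k H) (sobolev 2 k H)) /\
  (forall (j l : nat) (p : R), 1 < p ->
    (2 * m + 2 * n)%:R / ((m * (l + 1) + n * (j + 1))%:R - 1) <= p ->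
    fails_to_map
      (fun f => iter j (@dz1 R) (iter l (@dz2 R) (bergman_projection H f)))
      (smooth_closure H) (Lp p H)).
Proof.
move=> H; rewrite {}/H; split=> [k k1|j l q q1 hq].
  have [p [N [p0 _ N0 pN]]] := bezout_exponents m_gt0 n_gt0 0 mn_coprime.
  exists (@conj_mono R p N); split; first exact/smc2_sobolev/smc2_conj_mono.
  apply: (proj_not_sobolev m_gt0 n_gt0 N0 pN k1) => z hz.
  exact: bergman_projection_conj_mono.
have [p [N [p0 jp N0 pN]]] := bezout_exponents m_gt0 n_gt0 j mn_coprime.
exists (@conj_mono R p N); split; first exact/smc2_smooth_closure/smc2_conj_mono.
have c0 : ((proj_coef R m n p N)%:C)%C != 0.
  by rewrite fmorph_eq0 gt_eqF//; exact: proj_coef_gt0.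
have [c' c'0 E] := iter_dz_mono n_gt0 l c0 jp N0
  (fun z => bergman_projection_conj_mono m_gt0 n_gt0 p0 pN (z := z)).
have D0 : (0 < m * (l + 1) + n * (j + 1) - 1)%N.
  by rewrite subn_gt0 !addn1 !mulnS -(addn1 1) leq_add// ltn_addr.
(* The growth exponent of the derivative of order [(j, l)]. *)
have exps : (m * (N + l) = n * (p - j) + (m * (l + 1) + n * (j + 1) - 1))%N.
  apply/eqP; rewrite -(eqn_add2r (n * j + 1)); apply/eqP.
  have -> : (n * (p - j) + (m * (l + 1) + n * (j + 1) - 1) + (n * j + 1) =
    n * (p - j + j) + (m * (l + 1) + n * (j + 1) - 1 + 1))%N by ring.
  rewrite subnK// subnK; last by move: D0; rewrite subn_gt0 => /ltnW.
  have -> : (m * (N + l) + (n * j + 1) = (m * N + 1) + m * l + n * j)%N by ring.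
  by rewrite -pN mulnS; ring.
apply: (mono_not_Lp m_gt0 n_gt0 exps c'0 _ _ E); first exact: lt_trans q1.
have D0R : 0 < (m * (l + 1) + n * (j + 1) - 1)%:R :> R by rewrite ltr0n.
rewrite mulrC -ler_pdivrMr// natrB//.
by move: D0; rewrite subn_gt0 => /ltnW.
Qed.
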